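(* Let $\Gamma$ be a finite connected graph (a simplicial complex of dimension $1$), and fix $n\ge2$. Then the following are equivalent: (i) $\Gamma$ is weakly Goldberg; (ii) $\Gamma$ is Goldberg; (iii) $\Gamma$ is either a tree or homeomorphic to $S^1$.
   Context: $F_n(\Gamma)=\{(x_1,\dots,x_n)\in \Gamma^n: x_i\ne x_j\text{ for }i\ne j\}$, with fixed basepoint $\mathbf x^0=(x_1^0,\dots,x_n^0)$, and $\mathbb P_n(\Gamma,\mathbf x^0)=\pi_1(F_n(\Gamma),\mathbf x^0)$. The strand map $\iota_*:\mathbb P_n(\Gamma,\mathbf x^0)\to\prod_{i=1}^n\pi_1(\Gamma,x_i^0)$ is induced by $F_n(\Gamma)\subseteq \Gamma^n$. For a subcomplex $\Gamma_0\subseteq\Gamma$ (after a possible subdivision) with $\mathbf x^0\in F_n(\Gamma_0)$, let $j_*:\mathbb P_n(\Gamma_0,\mathbf x^0)\to\mathbb P_n(\Gamma,\mathbf x^0)$ be induced by inclusion. For fixed $n$: $\Gamma$ is *weakly Goldberg* if some contractible subcomplex $\Gamma_0$ with $\mathbf x^0\in F_n(\Gamma_0)$ satisfies: $\ker\iota_*$ equals the normal closure of $\operatorname{im}j_*$ in $\mathbb P_n(\Gamma,\mathbf x^0)$; $\Gamma$ is *Goldberg* if such a $\Gamma_0$ exists with $j_*$ in addition injective. *)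

(* Defs.v *)
From HB Require Import structures.
From mathcomp Require Import all_boot all_order all_algebra generic_quotient.
From mathcomp Require Import lra.
From mathcomp Require Import all_classical all_reals.
From mathcomp Require Import topology normedtype homotopy.

Set Implicit Arguments.
Unset Strict Implicit.
Unset Printing Implicit Defensive.

Import Order.TTheory GRing.Theory Num.Theory.
Import numFieldNormedType.Exports.

Local Open Scope classical_set_scope.
Local Open Scope ring_scope.

Section continuity.
Context {A B C : topologicalType}.

Lemma fun_comp_continuous (f : A -> B) (g : B -> C) :
  continuous f -> continuous g -> continuous (fun x => g (f x)).
Proof. by move=> cf cg x; apply: continuous_comp; [exact: cf|exact: cg]. Qed.

Lemma fun_pair_continuous (f : A -> B) (g : A -> C) :
  continuous f -> continuous g -> continuous (fun x => (f x, g x)).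
Proof.
move=> cf cg x; apply: (@cvg_pair _ _ _ _ (nbhs (f x)) (nbhs (g x))).
- exact: cf.
- exact: cg.
Qed.

Lemma fun_id_continuous : continuous (fun x : A => x).
Proof. by move=> x; exact: cvg_id. Qed.

End continuity.

Section pair_continuity.
Context {A B C : topologicalType}.

Lemma fun_fst_continuous (f : A -> B * C) :
  continuous f -> continuous (fun x => (f x).1).
Proof. by move=> cf; apply: fun_comp_continuous cf _ => x; exact: cvg_fst. Qed.

Lemma fun_snd_continuous (f : A -> B * C) :
  continuous f -> continuous (fun x => (f x).2).
Proof. by move=> cf; apply: fun_comp_continuous cf _ => x; exact: cvg_snd. Qed.

End pair_continuity.

Lemma fun_prod_continuous (Y : topologicalType) (J : Type)
    (K : J -> topologicalType) (f : Y -> prod_topology K) :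
  (forall j, continuous (fun y => f y j)) -> continuous f.
Proof.
move=> cf y; have FF : Filter (f @ y) by exact: fmap_filter.
apply/cvg_sup => j U [_ [[B oB <-] Bfy] BU].
apply: (@filterS _ (nbhs y) _ ((fun y => f y j) @^-1` B)) => [z Bz|].
  exact: BU.
by apply: cf; exact: open_nbhs_nbhs.
Qed.

Section real_continuity.
Context {R : realType} {T : topologicalType}.
Implicit Types f g : T -> R.

Lemma minr_continuous f g : continuous f -> continuous g ->
  continuous (fun x => Num.min (f x) (g x)).
Proof. by move=> cf cg x; exact: (@continuous_min R T f g x (cf x) (cg x)). Qed.

Lemma maxr_continuous f g : continuous f -> continuous g ->
  continuous (fun x => Num.max (f x) (g x)).
Proof. by move=> cf cg x; exact: (@continuous_max R T f g x (cf x) (cg x)). Qed.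

Lemma fun_cst_continuous (a : R) : continuous (fun _ : T => a).
Proof. by move=> x; exact: cvg_cst. Qed.

Lemma addr_fun_continuous f g : continuous f -> continuous g ->
  continuous (fun x => f x + g x).
Proof. by move=> cf cg x; apply: cvgD; [exact: cf|exact: cg]. Qed.

Lemma subr_fun_continuous f g : continuous f -> continuous g ->
  continuous (fun x => f x - g x).
Proof. by move=> cf cg x; apply: cvgB; [exact: cf|exact: cg]. Qed.

Lemma mulr_fun_continuous f g : continuous f -> continuous g ->
  continuous (fun x => f x * g x).
Proof. by move=> cf cg x; apply: cvgM; [exact: cf|exact: cg]. Qed.

End real_continuity.

Section unit_interval.
Variable R : realType.

Definition unitI : Type := set_type `[0 : R, 1]%classic.

HB.instance Definition _ := Topological.copy unitI (set_type `[0 : R, 1]%classic).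

Definition ival (t : unitI) : R := \val t.

Fact clamp_subproof (t : R) :
  Num.min (Num.max t 0) 1 \in `[0 : R, 1]%classic.
Proof.
by rewrite inE /= in_itv /= le_min le_max lexx ler01 orbT /= ge_min lexx orbT.
Qed.

(* The retraction of R onto [0, 1]. *)
Definition clamp (t : R) : unitI :=
  @exist R (fun x => x \in `[0 : R, 1]%classic) _ (clamp_subproof t).

Fact unitI_zero_neq_one : clamp 0 != clamp 1.
Proof.
apply/eqP => /(congr1 ival); rewrite /ival /= maxxx min_l ?ler01//.
by rewrite max_l ?ler01// minxx => /esym/eqP; rewrite oner_eq0.
Qed.

HB.instance Definition _ := isBiPointed.Build unitI unitI_zero_neq_one.

Lemma ival_itv t : 0 <= ival t <= 1.
Proof. by have := set_valP t; rewrite /= in_itv. Qed.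

Lemma ival_clamp t : ival (clamp t) = Num.min (Num.max t 0) 1.
Proof. by []. Qed.

Lemma ival_inj : injective ival.
Proof. exact: val_inj. Qed.

Lemma ivalK : cancel ival clamp.
Proof.
move=> t; apply: ival_inj; rewrite ival_clamp.
by have /andP[t0 t1] := ival_itv t; rewrite max_l// min_l.
Qed.

Lemma ival0 : ival zero = 0.
Proof. by rewrite ival_clamp maxxx min_l. Qed.

Lemma ival1 : ival one = 1.
Proof. by rewrite ival_clamp max_l// minxx. Qed.

Lemma clamp_le0 t : t <= 0 -> clamp t = zero.
Proof.
by move=> t0; apply: ival_inj; rewrite ival_clamp ival0 max_r// min_l.
Qed.

Lemma clamp_ge1 t : 1 <= t -> clamp t = one.
Proof.
move=> t1; apply: ival_inj; rewrite ival_clamp ival1 min_r// le_max.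
by rewrite t1.
Qed.

Lemma ival_continuous : continuous ival.
Proof. exact: initial_continuous. Qed.

Lemma clamp_continuous : continuous clamp.
Proof.
apply/continuousP => _ [B oB <-].
apply: (@open_comp _ _ (fun t : R => Num.min (Num.max t 0) 1)) => // t _.
apply: minr_continuous; last by move=> ?; exact: cvg_cst.
by apply: maxr_continuous => ?; [exact: cvg_id|exact: cvg_cst].
Qed.

Lemma paste_continuous (Y X : topologicalType) (u : Y -> R) (c : R)
    (f g : Y -> X) : continuous u -> continuous f -> continuous g ->
  (forall y, u y = c -> f y = g y) ->
  continuous (fun y => if u y <= c then f y else g y).
Proof.
move=> cu cf cg fg; set h := fun y => _.
have ucont (C : set R) : closed C -> closed (u @^-1` C).
  by move=> clC; apply: preimage_closed => // y _; exact: cu.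
have whole : u @^-1` [set x | x <= c] `|` u @^-1` [set x | c <= x] = setT.
  by apply/seteqP; split=> // y _ /=; apply/orP; exact: le_total.
apply/continuous_subspace_setT; rewrite -whole; apply: withinU_continuous.
- by apply: ucont; exact: closed_le.
- by apply: ucont; exact: closed_ge.
- apply: (@subspace_eq_continuous _ _ _ f); last exact: continuous_subspaceT.
  by move=> y; rewrite inE /= => uy; rewrite /h /from_subspace uy.
- apply: (@subspace_eq_continuous _ _ _ g); last exact: continuous_subspaceT.
  move=> y; rewrite inE /= => cy; rewrite /h /from_subspace; case: ifPn => // yc.
  by apply/esym/fg/le_anti; rewrite yc.
Qed.

End unit_interval.

Section paths.
Variables (R : realType) (X : topologicalType).
Local Notation I := (unitI R).

Definition homotopic (x y : X) (p q : {path I from x to y}) : Prop :=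
  exists H : I * I -> X, [/\ continuous H,
    forall t, H (zero, t) = p t, forall t, H (one, t) = q t &
    forall s, H (s, zero) = x /\ H (s, one) = y].

Definition concat_fun (p q : I -> X) (t : I) : X :=
  if ival t <= 2^-1 then p (clamp (2 * ival t)) else q (clamp (2 * ival t - 1)).

Lemma concat_fun_continuous (Y : topologicalType) (u : Y -> R)
    (p q : Y -> I -> X) :
  continuous u -> continuous (fun yt => p yt.1 yt.2) ->
  continuous (fun yt => q yt.1 yt.2) -> (forall y, p y one = q y zero) ->
  continuous (fun y => if u y <= 2^-1 then p y (clamp (2 * u y))
                       else q y (clamp (2 * u y - 1))).
Proof.
move=> cu cp cq pq.
have c2u : continuous (fun y => 2 * u y).
  by apply: mulr_fun_continuous => //; exact: fun_cst_continuous.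
have cc (v : Y -> R) : continuous v -> continuous (fun y => (y, clamp (v y))).
  move=> cv; apply: fun_pair_continuous; first exact: fun_id_continuous.
  by apply: (fun_comp_continuous cv); exact: clamp_continuous.
apply: (paste_continuous cu).
- exact: (fun_comp_continuous (cc _ c2u) cp).
- have c2u1 : continuous (fun y => 2 * u y - 1).
    by apply: subr_fun_continuous => //; exact: fun_cst_continuous.
  exact: (fun_comp_continuous (cc _ c2u1) cq).
- move=> y ->; rewrite mulfV ?pnatr_eq0// subrr.
  by rewrite [clamp 1]/(one) [clamp 0]/(zero) pq.
Qed.

Section concat.
Variables (x y z : X) (p : {path I from x to y}) (q : {path I from y to z}).

Let concat_cont : continuous (concat_fun p q).
Proof.
apply: (@concat_fun_continuous _ (@ival R) (fun=> p) (fun=> q)).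
- exact: ival_continuous.
- apply: fun_comp_continuous (@cts_fun _ _ p).
  by apply: fun_snd_continuous; exact: fun_id_continuous.
- apply: fun_comp_continuous (@cts_fun _ _ q).
  by apply: fun_snd_continuous; exact: fun_id_continuous.
- by move=> _; rewrite path_one path_zero.
Qed.

Let concat_zero : concat_fun p q zero = x.
Proof. by rewrite /concat_fun ival0 invr_ge0 ler0n mulr0 clamp_le0 ?path_zero. Qed.

Let concat_one : concat_fun p q one = z.
Proof.
rewrite /concat_fun ival1 mulr1 ifF; first last.
  by apply/negbTE; rewrite -ltNge invf_lt1 ?ltr0n// ltr1n.
by rewrite clamp_ge1 ?path_one// lerBrDr.
Qed.

Definition concat : {path I from x to z} :=
  mk_path concat_cont concat_zero concat_one.

End concat.

Section reversal.
Variables (x y : X) (p : {path I from x to y}).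

Definition reverse_fun (t : I) : X := p (clamp (1 - ival t)).

Let reverse_cont : continuous reverse_fun.
Proof.
apply: fun_comp_continuous (@cts_fun _ _ p).
apply: fun_comp_continuous (@clamp_continuous R).
by apply: subr_fun_continuous (@ival_continuous R); exact: fun_cst_continuous.
Qed.

Let reverse_zero : reverse_fun zero = y.
Proof. by rewrite /reverse_fun ival0 subr0 clamp_ge1 ?path_one. Qed.

Let reverse_one : reverse_fun one = x.
Proof. by rewrite /reverse_fun ival1 subrr clamp_le0 ?path_zero. Qed.

Definition reverse : {path I from y to x} :=
  mk_path reverse_cont reverse_zero reverse_one.

End reversal.

Lemma homotopic_refl x y (p : {path I from x to y}) : homotopic p p.
Proof.
exists (fun st => p st.2); split => //.
  apply: fun_comp_continuous (@cts_fun _ _ p).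
  by apply: fun_snd_continuous; exact: fun_id_continuous.
by move=> s; rewrite /= path_zero path_one.
Qed.

Lemma homotopic_sym x y (p q : {path I from x to y}) :
  homotopic p q -> homotopic q p.
Proof.
move=> [H [cH H0 H1 Hb]]; exists (fun st => H (clamp (1 - ival st.1), st.2)).
split=> [|t|t|s].
- apply: fun_comp_continuous cH; apply: fun_pair_continuous; last first.
    by apply: fun_snd_continuous; exact: fun_id_continuous.
  have ci1 : continuous (fun st : I * I => ival st.1).
    apply: fun_comp_continuous (@ival_continuous R).
    by apply: fun_fst_continuous; exact: fun_id_continuous.
  apply: fun_comp_continuous (@clamp_continuous R).
  by apply: subr_fun_continuous ci1; exact: fun_cst_continuous.
- by rewrite /= ival0 subr0 clamp_ge1// H1.
- by rewrite /= ival1 subrr clamp_le0// H0.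
- exact: Hb.
Qed.

Lemma homotopic_trans x y (p q r : {path I from x to y}) :
  homotopic p q -> homotopic q r -> homotopic p r.
Proof.
move=> [H [cH H0 H1 Hb]] [K [cK K0 K1 Kb]].
pose sw (H : I * I -> X) (y : I * I) s := H (s, y.2).
exists (fun st => concat_fun (sw H st) (sw K st) st.1); split=> [|t|t|s].
- have csw (L : I * I -> X) : continuous L ->
      continuous (fun yt => sw L yt.1 yt.2).
    move=> cL; apply: fun_comp_continuous cL; apply: fun_pair_continuous.
      by apply: fun_snd_continuous; exact: fun_id_continuous.
    apply: fun_snd_continuous; apply: fun_fst_continuous.
    exact: fun_id_continuous.
  apply: (@concat_fun_continuous _ (fun st : I * I => ival st.1) (sw H) (sw K)).
  + apply: fun_comp_continuous (@ival_continuous R).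
    by apply: fun_fst_continuous; exact: fun_id_continuous.
  + exact: csw.
  + exact: csw.
  + by move=> st; rewrite /sw H1 K0.
- by rewrite /concat_fun ival0 invr_ge0 ler0n mulr0 clamp_le0// /sw H0.
- rewrite /concat_fun ival1 mulr1 ifF; first last.
    by apply/negbTE; rewrite -ltNge invf_lt1 ?ltr0n// ltr1n.
  by rewrite clamp_ge1 ?lerBrDr// /sw K1.
- rewrite /concat_fun /sw /=; case: ifP => _; split.
  + exact: (Hb _).1.
  + exact: (Hb _).2.
  + exact: (Kb _).1.
  + exact: (Kb _).2.
Qed.

Lemma homotopic_concat x y z (p p' : {path I from x to y})
    (q q' : {path I from y to z}) :
  homotopic p p' -> homotopic q q' -> homotopic (concat p q) (concat p' q').
Proof.
move=> [H [cH H0 H1 Hb]] [K [cK K0 K1 Kb]].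
pose sw (H : I * I -> X) (y : I * I) t := H (y.1, t).
exists (fun st => concat_fun (sw H st) (sw K st) st.2); split=> [|t|t|s].
- have csw (L : I * I -> X) : continuous L ->
      continuous (fun yt => sw L yt.1 yt.2).
    move=> cL; apply: fun_comp_continuous cL; apply: fun_pair_continuous.
      by do 2!apply: fun_fst_continuous; exact: fun_id_continuous.
    by apply: fun_snd_continuous; exact: fun_id_continuous.
  apply: (@concat_fun_continuous _ (fun st : I * I => ival st.2) (sw H) (sw K)).
  + apply: fun_comp_continuous (@ival_continuous R).
    by apply: fun_snd_continuous; exact: fun_id_continuous.
  + exact: csw.
  + exact: csw.
  + by move=> st; rewrite /sw (Hb _).2 (Kb _).1.
- by rewrite /= /mk_path /concat_fun /sw /= H0 K0.
- by rewrite /= /mk_path /concat_fun /sw /= H1 K1.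
- rewrite /concat_fun /sw /= ival0 ival1 invr_ge0 ler0n mulr0 mulr1.
  rewrite ifF; last by apply/negbTE; rewrite -ltNge invf_lt1 ?ltr0n// ltr1n.
  by rewrite clamp_le0// clamp_ge1 ?lerBrDr// (Hb _).1 (Kb _).2.
Qed.

(* Two reparametrizations of the same map with equal endpoints are homotopic,
   by the straight-line homotopy between the parametrizations. *)
Lemma homotopic_reparam x y (p q : {path I from x to y}) (F : R -> X)
    (phi psi : R -> R) :
  continuous F -> continuous phi -> continuous psi ->
  phi 0 = psi 0 -> phi 1 = psi 1 ->
  (forall t, p t = F (phi (ival t))) -> (forall t, q t = F (psi (ival t))) ->
  homotopic p q.
Proof.
move=> cF cphi cpsi e0 e1 pE qE.
exists (fun st => F ((1 - ival st.1) * phi (ival st.2) +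
                     ival st.1 * psi (ival st.2))); split=> [|t|t|s].
- have ci1 : continuous (fun st : I * I => ival st.1).
    apply: fun_comp_continuous (@ival_continuous R).
    by apply: fun_fst_continuous; exact: fun_id_continuous.
  have ci2 : continuous (fun st : I * I => ival st.2).
    apply: fun_comp_continuous (@ival_continuous R).
    by apply: fun_snd_continuous; exact: fun_id_continuous.
  apply: fun_comp_continuous cF.
  apply: addr_fun_continuous; apply: mulr_fun_continuous.
  + by apply: subr_fun_continuous ci1; exact: fun_cst_continuous.
  + exact: (fun_comp_continuous ci2 cphi).
  + exact: ci1.
  + exact: (fun_comp_continuous ci2 cpsi).
- by rewrite /= ival0 subr0 mul1r mul0r addr0 pE.
- by rewrite /= ival1 subrr mul1r mul0r add0r qE.
- rewrite /= ival0 ival1 -e0 -e1 -!mulrDl subrK !mul1r.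
  by rewrite -[in LHS]ival0 -pE path_zero -[X in phi X]ival1 -pE path_one.
Qed.

Lemma path_clamp_continuous (x y : X) (p : {path I from x to y}) :
  continuous (fun t => p (clamp t)).
Proof.
by apply: fun_comp_continuous (@cts_fun _ _ p); exact: clamp_continuous.
Qed.

Let aff_cont (a b : R) : continuous (fun t : R => a * t + b).
Proof.
apply: addr_fun_continuous; last exact: fun_cst_continuous.
apply: mulr_fun_continuous; first exact: fun_cst_continuous.
exact: fun_id_continuous.
Qed.

Lemma concat_cstp x y (p : {path I from x to y}) :
  homotopic (concat (cst x) p) p.
Proof.
apply: (@homotopic_reparam _ _ _ _ (fun t => p (clamp t))
  (fun t => Num.max (2 * t + -1) 0) id).
- exact: path_clamp_continuous.
- by apply: maxr_continuous; [exact: aff_cont|exact: fun_cst_continuous].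
- exact: fun_id_continuous.
- by rewrite max_r//=; lra.
- by rewrite max_l//=; lra.
- move=> t; rewrite /= /mk_path /concat_fun; case: ifPn => [|/negP] t2.
    by rewrite max_r; [rewrite (clamp_le0 (lexx 0)) path_zero|lra].
  by rewrite max_l//; lra.
- by move=> t /=; rewrite ivalK.
Qed.

Lemma concat_pcst x y (p : {path I from x to y}) :
  homotopic (concat p (cst y)) p.
Proof.
apply: (@homotopic_reparam _ _ _ _ (fun t => p (clamp t))
  (fun t => Num.min (2 * t + 0) 1) id).
- exact: path_clamp_continuous.
- by apply: minr_continuous; [exact: aff_cont|exact: fun_cst_continuous].
- exact: fun_id_continuous.
- by rewrite min_l//=; lra.
- by rewrite min_r//=; lra.
- move=> t; rewrite /= /mk_path /concat_fun addr0; case: ifPn => [|/negP] t2.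
    by rewrite min_l//; lra.
  by rewrite min_r; [rewrite (clamp_ge1 (lexx 1)) path_one|lra].
- by move=> t /=; rewrite ivalK.
Qed.

Lemma concat_pV x y (p : {path I from x to y}) :
  homotopic (concat p (reverse p)) (cst x).
Proof.
apply: (@homotopic_reparam _ _ _ _ (fun t => p (clamp t))
  (fun t => Num.min (2 * t + 0) (- 2 * t + 2)) (fun=> 0)).
- exact: path_clamp_continuous.
- by apply: minr_continuous; exact: aff_cont.
- exact: fun_cst_continuous.
- by rewrite min_l//=; lra.
- by rewrite min_r//=; lra.
- move=> t; have /andP[t0 t1] := ival_itv t.
  rewrite /= /mk_path /concat_fun addr0; case: ifPn => [|/negP] t2.
    by rewrite min_l//; lra.
  rewrite min_r; last by lra.
  rewrite /reverse /= /mk_path /reverse_fun ival_clamp max_l; last by lra.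
  by rewrite min_l; [congr (p (clamp _)); lra|lra].
- by move=> t /=; rewrite clamp_le0 ?path_zero.
Qed.

Lemma concat_Vp x y (p : {path I from x to y}) :
  homotopic (concat (reverse p) p) (cst y).
Proof.
suff -> : concat (reverse p) p = concat (reverse p) (reverse (reverse p)).
  exact: concat_pV.
congr concat; apply/path_eqP => t.
rewrite /reverse /= /mk_path /reverse_fun /= /mk_path /reverse_fun.
congr (p _); apply: ival_inj; have /andP[t0 t1] := ival_itv t.
by rewrite (ival_clamp (1 - ival t)) max_l ?min_l ?subKr ?ivalK//; lra.
Qed.

Lemma concatA x y z w (p : {path I from x to y}) (q : {path I from y to z})
    (r : {path I from z to w}) :
  homotopic (concat p (concat q r)) (concat (concat p q) r).
Proof.
pose F (t : R) : X := if t <= 1 then p (clamp t) else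
  if t <= 2 then q (clamp (t - 1)) else r (clamp (t - 2)).
have cF : continuous F.
  have sh (x' y' : X) (p' : {path I from x' to y'}) (a : R) :
      continuous (fun t => p' (clamp (t - a))).
    apply: (@fun_comp_continuous _ _ _ (fun t => t - a)
      (fun t => p' (clamp t))); last exact: path_clamp_continuous.
    apply: subr_fun_continuous; first exact: fun_id_continuous.
    exact: fun_cst_continuous.
  apply: (@paste_continuous _ _ _ id).
  - exact: fun_id_continuous.
  - exact: path_clamp_continuous.
  - apply: (@paste_continuous _ _ _ id).
    + exact: fun_id_continuous.
    + exact: sh.
    + exact: sh.
    + move=> t ->; rewrite clamp_ge1 ?clamp_le0; [|lra..].
      by rewrite path_one path_zero.
  - move=> t ->; rewrite clamp_ge1// ler1n clamp_le0; last by lra.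
    by rewrite path_one path_zero.
have F1 t : t <= 1 -> F t = p (clamp t) by rewrite /F => ->.
have F2 t : 1 <= t -> t <= 2 -> F t = q (clamp (t - 1)).
  rewrite /F => t1 ->; case: ifPn => // t1'.
  by rewrite clamp_ge1// clamp_le0 ?path_one ?path_zero//; lra.
have F3 t : 2 <= t -> F t = r (clamp (t - 2)).
  move=> t2; rewrite /F ifF; last by apply/negP; lra.
  case: ifPn => // t2'.
  by rewrite clamp_ge1 ?clamp_le0 ?path_one ?path_zero//; lra.
have ivc (t : R) : 0 <= t <= 1 -> ival (clamp t) = t.
  by move=> /andP[t0 t1]; rewrite ival_clamp max_l// min_l.
apply: (@homotopic_reparam _ _ _ _ F
  (fun t => Num.max (2 * t + 0) (4 * t + -1))
  (fun t => Num.min (4 * t + 0) (2 * t + 1))).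
- exact: cF.
- by apply: maxr_continuous; exact: aff_cont.
- by apply: minr_continuous; exact: aff_cont.
- by rewrite max_l ?min_l; lra.
- by rewrite max_r ?min_r; lra.
- move=> t; have /andP[t0 t1] := ival_itv t.
  rewrite /= /mk_path /concat_fun; case: ifPn => [|/negP] t2.
    rewrite max_l; last by lra.
    by rewrite F1; [congr (p (clamp _))|]; lra.
  rewrite /= /mk_path /concat_fun max_r; last by lra.
  rewrite ivc; last by lra.
  case: ifPn => [|/negP] t3.
    by rewrite F2; [congr (q (clamp _))| |]; lra.
  by rewrite F3; [congr (r (clamp _))|]; lra.
- move=> t; have /andP[t0 t1] := ival_itv t.
  rewrite /= /mk_path /concat_fun; case: ifPn => [|/negP] t2.
    rewrite /= /mk_path /concat_fun min_l; last by lra.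
    rewrite ivc; last by lra.
    case: ifPn => [|/negP] t3.
      by rewrite F1; [congr (p (clamp _))|]; lra.
    by rewrite F2; [congr (q (clamp _))| |]; lra.
  rewrite min_r; last by lra.
  by rewrite F3; [congr (r (clamp _))|]; lra.
Qed.

End paths.

Section fundamental_group.
Variables (R : realType) (X : topologicalType) (x : X).
Local Notation loop := {path unitI R from x to x}.

Definition homotopicb (p q : loop) : bool := `[< homotopic p q >].

Fact homotopicb_refl : reflexive homotopicb.
Proof. by move=> p; apply/asboolP; exact: homotopic_refl. Qed.

Fact homotopicb_sym : symmetric homotopicb.
Proof.
by move=> p q; apply/asboolP/asboolP; exact: homotopic_sym.
Qed.

Fact homotopicb_trans : transitive homotopicb.
Proof.
move=> q p r /asboolP pq /asboolP qr; apply/asboolP.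
exact: homotopic_trans pq qr.
Qed.

Canonical homotopic_equiv :=
  EquivRel homotopicb homotopicb_refl homotopicb_sym homotopicb_trans.

Definition pi1 : Type := {eq_quot homotopic_equiv}%qT.

HB.instance Definition _ := Choice.on pi1.
HB.instance Definition _ := EqQuotient.on pi1.

Definition homotopy_class (p : loop) : pi1 := \pi_pi1%qT p.

Lemma homotopy_classP (p q : loop) :
  homotopy_class p = homotopy_class q <-> homotopic p q.
Proof.
split=> [/eqmodP/asboolP//|pq].
by apply/eqmodP/asboolP.
Qed.

Lemma homotopy_class_repr (a : pi1) : homotopy_class (repr a) = a.
Proof. exact: reprK. Qed.

Lemma homotopic_repr (p : loop) : homotopic (repr (homotopy_class p)) p.
Proof. by apply/homotopy_classP; rewrite homotopy_class_repr. Qed.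

Definition pi1_one : pi1 := homotopy_class (cst x).
Definition pi1_mul (a b : pi1) : pi1 := homotopy_class (concat (repr a) (repr b)).
Definition pi1_inv (a : pi1) : pi1 := homotopy_class (reverse (repr a)).

Lemma pi1_mulE (p q : loop) :
  pi1_mul (homotopy_class p) (homotopy_class q) = homotopy_class (concat p q).
Proof.
by apply/homotopy_classP/homotopic_concat; exact: homotopic_repr.
Qed.

Fact pi1_mulA : associative pi1_mul.
Proof.
move=> a b c; rewrite -(homotopy_class_repr a) -(homotopy_class_repr b).
rewrite -(homotopy_class_repr c) !pi1_mulE; apply/homotopy_classP.
exact: concatA.
Qed.

Fact pi1_mul1 : left_id pi1_one pi1_mul.
Proof.
move=> a; rewrite -(homotopy_class_repr a) pi1_mulE.
by apply/homotopy_classP; exact: concat_cstp.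
Qed.

Fact pi1_mulr1 : right_id pi1_one pi1_mul.
Proof.
move=> a; rewrite -(homotopy_class_repr a) pi1_mulE.
by apply/homotopy_classP; exact: concat_pcst.
Qed.

Fact pi1_mulV : left_inverse pi1_one pi1_inv pi1_mul.
Proof.
move=> a; rewrite -[X in pi1_mul _ X]homotopy_class_repr pi1_mulE.
by apply/homotopy_classP; exact: concat_Vp.
Qed.

Fact pi1_mulrV : right_inverse pi1_one pi1_inv pi1_mul.
Proof.
move=> a; rewrite -[X in pi1_mul X _]homotopy_class_repr pi1_mulE.
by apply/homotopy_classP; exact: concat_pV.
Qed.

HB.instance Definition _ :=
  isGroup.Build pi1 pi1_mulA pi1_mul1 pi1_mulr1 pi1_mulV pi1_mulrV.

End fundamental_group.

Arguments pi1 : clear implicits.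

Section induced_map.
Variables (R : realType) (X Y : topologicalType) (f : continuousType X Y).
Variables (x : X) (y : Y) (fx : f x = y).

Section loop.
Variable p : {path unitI R from x to x}.

Let map_cont : continuous (f \o p).
Proof. exact: fun_comp_continuous (@cts_fun _ _ p) (@cts_fun _ _ f). Qed.

Let map_zero : (f \o p) zero = y.
Proof. by rewrite /= path_zero. Qed.

Let map_one : (f \o p) one = y.
Proof. by rewrite /= path_one. Qed.

Definition map_loop : {path unitI R from y to y} :=
  mk_path map_cont map_zero map_one.

End loop.

Lemma map_loop_homotopic (p q : {path unitI R from x to x}) :
  homotopic p q -> homotopic (map_loop p) (map_loop q).
Proof.
move=> [H [cH H0 H1 Hb]]; exists (f \o H); split=> [|t|t|s] /=.
- exact: fun_comp_continuous cH (@cts_fun _ _ f).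
- by rewrite H0.
- by rewrite H1.
- by rewrite (Hb s).1 (Hb s).2.
Qed.

Definition pi1_map (a : pi1 R X x) : pi1 R Y y :=
  homotopy_class (map_loop (repr a)).

Lemma pi1_mapE (p : {path unitI R from x to x}) :
  pi1_map (homotopy_class p) = homotopy_class (map_loop p).
Proof.
by apply/homotopy_classP/map_loop_homotopic; exact: homotopic_repr.
Qed.

Fact pi1_map1 : pi1_map 1%g = 1%g.
Proof.
rewrite [1%g in LHS]/(homotopy_class (cst x)) pi1_mapE; congr homotopy_class.
by apply/path_eqP => t /=.
Qed.

Fact pi1_mapM : {morph pi1_map : a b / (a * b)%g}.
Proof.
move=> a b; rewrite -(homotopy_class_repr a) -(homotopy_class_repr b).
rewrite [(_ * _)%g in LHS]pi1_mulE !pi1_mapE [RHS]pi1_mulE.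
congr homotopy_class; apply/path_eqP => t; rewrite /= /mk_path /concat_fun /=.
by rewrite /map_loop /= /mk_path; case: ifP.
Qed.

HB.instance Definition _ := isMultiplicative.Build _ _ pi1_map pi1_mapM.
HB.instance Definition _ :=
  Multiplicative_isUMagmaMorphism.Build _ _ pi1_map pi1_map1.

End induced_map.

Section product_group.
Variables (I : Type) (G : I -> groupType).

Definition prod_group : Type := forall i, G i.

HB.instance Definition _ := gen_eqMixin prod_group.
HB.instance Definition _ := gen_choiceMixin prod_group.

Lemma prod_groupP (a b : prod_group) : (forall i, a i = b i) -> a = b.
Proof. exact: functional_extensionality_dep. Qed.

Let one : prod_group := fun i => 1%g.
Let inv (a : prod_group) : prod_group := fun i => (a i)^-1%g.
Let mul (a b : prod_group) : prod_group := fun i => (a i * b i)%g.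

Fact prod_group_mulA : associative mul.
Proof. by move=> a b c; apply/prod_groupP => i; rewrite /mul mulgA. Qed.

Fact prod_group_mul1 : left_id one mul.
Proof. by move=> a; apply/prod_groupP => i; rewrite /mul mul1g. Qed.

Fact prod_group_mulr1 : right_id one mul.
Proof. by move=> a; apply/prod_groupP => i; rewrite /mul mulg1. Qed.

Fact prod_group_mulV : left_inverse one inv mul.
Proof. by move=> a; apply/prod_groupP => i; rewrite /mul mulVg. Qed.

Fact prod_group_mulrV : right_inverse one inv mul.
Proof. by move=> a; apply/prod_groupP => i; rewrite /mul mulgV. Qed.

HB.instance Definition _ := isGroup.Build prod_group prod_group_mulA
  prod_group_mul1 prod_group_mulr1 prod_group_mulV prod_group_mulrV.

End product_group.

Definition kernel (G H : groupType) (f : G -> H) : set G := [set a | f a = 1%g].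

Definition normal_subgroup (G : groupType) (N : set G) : Prop :=
  [/\ N 1%g, (forall a b, N a -> N b -> N (a * b)%g),
      (forall a, N a -> N a^-1%g) & (forall a b, N a -> N (a ^ b)%g)].

Definition normal_closure (G : groupType) (S : set G) : set G :=
  smallest (@normal_subgroup G) S.

Definition homeomorphic (X Y : topologicalType) : Prop :=
  exists (f : X -> Y) (g : Y -> X),
    [/\ continuous f, continuous g, cancel f g & cancel g f].

Definition contractible (R : realType) (X : topologicalType) : Prop :=
  exists (x0 : X) (H : X * unitI R -> X),
    [/\ continuous H, forall x, H (x, zero) = x & forall x, H (x, one) = x0].

Definition circle (R : realType) : topologicalType :=
  set_type [set z : R * R | z.1 ^+ 2 + z.2 ^+ 2 = 1].

Section configuration_space.
Variables (R : realType) (n : nat).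

Definition conf_set (X : topologicalType) : set {ptws 'I_n -> X} :=
  [set x | injective x].
Arguments conf_set X : clear implicits.

Definition conf (X : topologicalType) : topologicalType := set_type (conf_set X).

Definition conf_pt (X : topologicalType) (i : 'I_n) (x : conf X) : X :=
  (\val x) i.

Lemma conf_pt_continuous (X : topologicalType) (i : 'I_n) :
  continuous (@conf_pt X i).
Proof.
apply: (@fun_comp_continuous _ _ _ (fun x : conf X => \val x)
  (fun x : {ptws 'I_n -> X} => x i)).
  exact: initial_continuous.
exact: (@proj_continuous _ (fun=> X) i).
Qed.

HB.instance Definition _ (X : topologicalType) (i : 'I_n) :=
  isContinuous.Build (conf X) X (@conf_pt X i) (@conf_pt_continuous X i).

(* Composing F_n(X) -> X^n with the i-th projection of X^n gives conf_pt i, so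
   this is the map induced by F_n(X) -> X^n, followed by the identification of
   pi1(X^n, x) with the product of the pi1(X, x_i). *)
Definition strand_map (X : topologicalType) (x : conf X)
    (a : pi1 R (conf X) x) : prod_group (fun i => pi1 R X (conf_pt i x)) :=
  fun i => pi1_map (f := @conf_pt X i) erefl a.

Fact strand_mapM (X : topologicalType) (x : conf X) :
  {morph @strand_map X x : a b / (a * b)%g}.
Proof.
by move=> a b; apply: functional_extensionality_dep => i; exact: pi1_mapM.
Qed.

Fact strand_map1 (X : topologicalType) (x : conf X) : @strand_map X x 1%g = 1%g.
Proof. by apply: functional_extensionality_dep => i; exact: pi1_map1. Qed.

HB.instance Definition _ (X : topologicalType) (x : conf X) :=
  isMultiplicative.Build _ _ (@strand_map X x) (@strand_mapM X x).
HB.instance Definition _ (X : topologicalType) (x : conf X) :=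
  Multiplicative_isUMagmaMorphism.Build _ _ (@strand_map X x) (@strand_map1 X x).

Section inclusion.
Variables (X : topologicalType) (A : set X).

Fact conf_incl_subproof (x : conf A) :
  (fun i => \val (conf_pt i x)) \in conf_set X.
Proof.
apply/mem_set => i j /val_inj; exact: (set_valP x).
Qed.

Definition conf_incl (x : conf A) : conf X :=
  @exist {ptws 'I_n -> X} (fun x => x \in conf_set X) _ (conf_incl_subproof x).

Lemma conf_incl_continuous : continuous conf_incl.
Proof.
have cval : continuous (fun x : conf A => \val (conf_incl x)).
  apply: fun_prod_continuous => i.
  apply: (@fun_comp_continuous _ _ _ (@conf_pt A i) (fun a : A => \val a)).
    exact: conf_pt_continuous.
  exact: initial_continuous.
apply/continuousP => _ [B oB <-].
exact: (@open_comp _ _ (fun x : conf A => \val (conf_incl x))).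
Qed.

HB.instance Definition _ :=
  isContinuous.Build (conf A) (conf X) conf_incl conf_incl_continuous.

Definition incl_map (y : conf A) (x : conf X) (yx : conf_incl y = x) :
    pi1 R (conf A) y -> pi1 R (conf X) x :=
  pi1_map yx.

End inclusion.
End configuration_space.

Arguments conf n X : clear implicits.

(* A finite abstract simplicial complex is the set K of its (nonempty)
   simplices; its vertices are the v with [set v] \in K, possibly not all of V.
   Points of |K| are given by their barycentric coordinates. *)
Section simplicial_complex.
Variable R : realType.

Definition simplicial_complex (V : finType) (K : {set {set V}}) : Prop :=
  finset.set0 \notin K /\
  forall s t : {set V}, s \in K -> t \subset s -> t != finset.set0 -> t \in K.

Definition dimension (V : finType) (K : {set {set V}}) : nat :=
  (\max_(s in K) #|s|.-1)%N.

Definition simplex (V : finType) (s : {set V}) : set {ptws V -> R} :=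
  [set t | [/\ forall v, 0 <= t v, \sum_v t v = 1 &
               forall v, t v != 0 -> v \in s]].

Definition polyhedron (V : finType) (K : {set {set V}}) : set {ptws V -> R} :=
  [set t | exists2 s, s \in K & simplex s t].

Definition realization (V : finType) (K : {set {set V}}) : topologicalType :=
  set_type (polyhedron K).

Definition affine_ext (V W : finType) (p : W -> {ptws V -> R})
    (t : {ptws W -> R}) : {ptws V -> R} :=
  fun v => \sum_w t w * p w v.

(* L subdivides K: p places the vertices of L in |K|, and its affine extension
   maps every simplex of L into a simplex of K and |L| bijectively onto |K|
   (hence homeomorphically, |L| being compact and |K| Hausdorff). *)
Definition subdivision (V W : finType) (K : {set {set V}}) (L : {set {set W}})
    (p : W -> {ptws V -> R}) : Prop :=
  (forall s, s \in L ->
     exists2 t, t \in K & forall w, w \in s -> simplex t (p w)) /\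
  set_bij (polyhedron L) (polyhedron K) (affine_ext p).

Definition subcomplex_after_subdivision (V : finType) (K : {set {set V}})
    (A : set (realization K)) : Prop :=
  exists (W : finType) (L L0 : {set {set W}}) (p : W -> {ptws V -> R}),
    [/\ simplicial_complex L, subdivision K L p,
        simplicial_complex L0, L0 \subset L &
        \val @` A = affine_ext p @` polyhedron L0].

End simplicial_complex.

Section graph.
Variables (V : finType) (K : {set {set V}}).

Definition edge (u v : V) : bool := (u != v) && ([set u; v]%SET \in K).

Definition connected_graph : Prop :=
  forall u v : V, [set u]%SET \in K -> [set v]%SET \in K -> connect edge u v.

(* K being simplicial, every circuit has at least three vertices; ucycle also
   accepts sequences of at most two vertices, which are not circuits. *)
Definition tree : Prop :=
  connected_graph /\ forall c : seq V, ucycle edge c -> (size c <= 2)%N.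

End graph.

Section goldberg.
Variables (R : realType) (n : nat) (V : finType) (K : {set {set V}}).
Local Notation Gamma := (realization R K).
Variable x : conf n Gamma.

(* The pair (y, yx) expresses that x lies in F_n(Gamma0). *)
Definition weakly_Goldberg : Prop :=
  exists (Gamma0 : set Gamma) (y : conf n Gamma0) (yx : conf_incl y = x),
    [/\ subcomplex_after_subdivision Gamma0, contractible R Gamma0 &
        kernel (@strand_map R n Gamma x) =
        normal_closure (range (@incl_map R n Gamma Gamma0 y x yx))].

Definition Goldberg : Prop :=
  exists (Gamma0 : set Gamma) (y : conf n Gamma0) (yx : conf_incl y = x),
    [/\ subcomplex_after_subdivision Gamma0, contractible R Gamma0,
        kernel (@strand_map R n Gamma x) =
        normal_closure (range (@incl_map R n Gamma Gamma0 y x yx)) &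
        injective (@incl_map R n Gamma Gamma0 y x yx)].

End goldberg.

(* Main.v *)
(* If K is a tree, the whole graph is contractible and may serve as Gamma_0.  If
   it is a circle, cut out an open arc free of base points.  Lift a loop in
   ker iota_* strand by strand to the line: the gaps between the lifts stay
   between consecutive integers, a convex condition, so the straight-line
   homotopy to the constant lifts never makes two particles collide.  Hence
   ker iota_* is trivial, and so is the fundamental group of the configurations of
   the remaining arc.

   Otherwise some circuit has a further edge attached. A contractible Gamma_0
   cannot contain the circuit, so it misses an interior point of one of its
   edges, the mark. Reading a letter g_i of a nonabelian group, with g_i^2 = 1,
   whenever particle i crosses the mark is a locally defined cocycle on
   configurations, so it has a homotopy invariant holonomy, which is trivial on
   im j_*. The extra edge lets a particle step aside, which gives loops A and B
   sending essentially one particle each around the circuit; [A, B] lies in ker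
   iota_*, but has holonomy [g_i, g_j] <> 1. *)
From HB Require Import structures.
From mathcomp Require Import all_boot all_order all_algebra.
From mathcomp Require Import perm zify lra.
From mathcomp Require Import all_classical all_reals interval_inference.
From mathcomp Require Import topology normedtype derive trigo homotopy.
Require Import Defs.

Set Implicit Arguments.
Unset Strict Implicit.
Unset Printing Implicit Defensive.

Import Order.TTheory GRing.Theory Num.Theory.
Import numFieldNormedType.Exports.

Local Open Scope classical_set_scope.
Local Open Scope ring_scope.

(** The commutator has to be based at the given configuration [x], although the configuration space
    need not be connected. On a connected graph the particles can still be brought to prescribed
    places in some order: a particle that blocks the way completes the journey of the one behind it.
    The two letters are then given to whichever particles arrive on either side of the mark. Letters
    of order two make the direction of a crossing immaterial, so two transpositions of three points
    suffice and the edge needs no orientation.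

    That Gamma_0 misses a mark rests on its being closed: a closed set that meets the interior of an
    edge in all its points contains the edge, so it would contain the circuit.

    For the circle, the obstacle is that the homeomorphism with S^1 is arbitrary and unrelated to
    the edges. The arc is cut out of an edge but parametrised through the homeomorphism; that its
    parameters form an interval then needs the intermediate value theorem. *)

Section covering.
Variable R : realType.

(** A Lebesgue number for the unit square, with [Good] in the role of an open cover. The boxes may
    stick out of the square, so maps of the square are extended to the plane through [clamp] before
    this is applied. *)
Lemma lebesgue_box (Good : set (R * R) -> Prop) :
  (forall A B, A `<=` B -> Good B -> Good A) ->
  (forall q : R * R, exists2 U, nbhs q U & Good U) ->
  exists N0 : nat, forall N, (N0 <= N)%N -> forall q : R * R,
    0 <= q.1 <= 1 -> 0 <= q.2 <= 1 ->
    Good [set q' | `|q'.1 - q.1| <= N.+1%:R^-1 /\ `|q'.2 - q.2| <= N.+1%:R^-1].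
Proof.
move=> mono loc.
have cK : compact (`[0, 1]%classic `*` `[0, 1]%classic : set (R * R)).
  by apply: compact_setX; exact: segment_compact.
have /= := (proj1 (compact_near_coveringP _) cK) nat \oo
  (fun N q => Good [set q' : R * R | `|q'.1 - q.1| <= N.+1%:R^-1 /\
                                     `|q'.2 - q.2| <= N.+1%:R^-1]) _.
move=> /(_ _)[].
  move=> q _; have [U /nbhs_ballP[e /= e0 eU] gU] := loc q.
  (* One half of the radius is for moving the centre, the other for the box around it. *)
  have e2 : 0 < e / 2 by rewrite divr_gt0.
  exists (ball q (e / 2), [set N : nat | N.+1%:R^-1 < e / 2]).
    split; first exact: nbhsx_ballx.
    exact: (near_infty_natSinv_lt (PosNum e2)).
  move=> [q' N] /= [[b1 b2] Ne]; apply: mono gU => z /= [z1 z2].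
  apply: eU; move: b1 b2; rewrite /ball /= => b1 b2.
  split; rewrite /ball /=.
    apply: le_lt_trans (ler_distD q'.1 _ _) _; rewrite [`|q'.1 - z.1|]distrC.
    by rewrite [e]splitr ltrD//; exact: le_lt_trans z1 Ne.
  apply: le_lt_trans (ler_distD q'.2 _ _) _; rewrite [`|q'.2 - z.2|]distrC.
  by rewrite [e]splitr ltrD//; exact: le_lt_trans z2 Ne.
move=> N0 _ HN; exists N0 => N N0N q q1 q2.
by apply: (HN N) => //; split; rewrite /= in_itv.
Qed.

End covering.

(** * Holonomy of locally defined cocycles *)

Section holonomy.
Variables (R : realType) (X : topologicalType) (G : groupType) (c : X -> X -> G).
Local Notation I := (unitI R).

(** The discrete form of a flat connection: [c a b] is the parallel transport between two points
    that are close to each other. *)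
Definition local_cocycle : Prop := forall x : X, exists2 U, nbhs x U &
  forall a b d, U a -> U b -> U d -> (c a b * c b d = c a d)%g.

Definition chain (f : nat -> X) (m n : nat) : G :=
  \big[*%g/1%g]_(m <= k < n) c (f k) (f k.+1).

Definition sample (p : I -> X) (N k : nat) : X := p (clamp (k%:R / N%:R)).

Definition hol_at (p : I -> X) (N : nat) : G := chain (sample p N) 0 N.

(** The products over subdivisions become constant once the mesh is fine enough ([hol_spec]), so the
    holonomy is an eventual value and no limit is taken. For a local cocycle and a continuous path
    the default [1%g] is not reached. *)
Definition hol (p : I -> X) : G :=
  xget 1%g [set g | exists N0, forall N, (N0 <= N)%N -> hol_at p N.+1 = g].

Lemma chain_cat f m n l : (m <= n)%N -> (n <= l)%N ->
  chain f m l = (chain f m n * chain f n l)%g.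
Proof. by move=> mn nl; rewrite /chain (big_cat_nat mn nl). Qed.

Lemma eq_chain f g m n : (forall k, (m <= k <= n)%N -> f k = g k) ->
  chain f m n = chain g m n.
Proof.
move=> fg; apply: eq_big_nat => k /andP[mk kn].
by rewrite !fg// ?mk ?(ltnW kn)// kn leqW.
Qed.

(** Telescoping. The empty product is covered because the identity at three equal indices forces
    [c (f m) (f m) = 1]. *)
Lemma chain_cocycle f m n : (m <= n)%N ->
  (forall i j k, (m <= i <= n)%N -> (m <= j <= n)%N -> (m <= k <= n)%N ->
     c (f i) (f j) * c (f j) (f k) = c (f i) (f k))%g ->
  chain f m n = c (f m) (f n).
Proof.
move=> mn; elim: n mn => [|n IH] mn coc.
  move: mn; rewrite leqn0 => /eqP m0; subst m.
  rewrite /chain big_geq//; apply/(mulgI (c (f 0) (f 0))).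
  by rewrite coc// mulg1.
have [mn'|] := leqP m n; last first.
  move=> nm; have -> : m = n.+1 by apply/eqP; rewrite eqn_leq mn nm.
  rewrite /chain big_geq//; apply/(mulgI (c (f n.+1) (f n.+1))).
  by rewrite coc ?leqnn ?mn// mulg1.
rewrite /chain big_nat_recr//= -/(chain f m n) IH//; last first.
  by move=> i j k /andP[? ?] /andP[? ?] /andP[? ?]; apply: coc; lia.
by apply: coc; lia.
Qed.

(** Invariance under refinement: each block of [m] fine steps telescopes to one coarse step. *)
Lemma chain_mul f n m :
  (forall k i j l, (k < n)%N -> (k * m <= i <= k.+1 * m)%N ->
     (k * m <= j <= k.+1 * m)%N -> (k * m <= l <= k.+1 * m)%N ->
     c (f i) (f j) * c (f j) (f l) = c (f i) (f l))%g ->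
  chain f 0 (n * m) = chain (fun k => f (k * m)%N) 0 n.
Proof.
elim: n => [|n IH] coc; first by rewrite mul0n /chain !big_geq.
rewrite (@chain_cat _ 0 (n * m)) ?leq_mul//.
rewrite IH => [|k i j l kn]; last by apply: coc; exact: leqW.
rewrite [RHS]/chain big_nat_recr//=; congr (_ * _)%g.
by apply: chain_cocycle => [|i j k]; [rewrite leq_mul|exact: coc].
Qed.

Hypothesis coc : local_cocycle.

Lemma cocyclexx x : c x x = 1%g.
Proof.
have [U nU cU] := coc x; have Ux := nbhs_singleton nU.
by apply/(mulgI (c x x)); rewrite cU// mulg1.
Qed.

(** One statement serves paths and homotopies alike: a path is treated as a map of the square that
    is constant in the first variable ([path_square]). *)
Lemma cocycle_grid (H : I * I -> X) : continuous H ->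
  exists N0 : nat, forall N, (N0 <= N)%N -> forall q : R * R,
    0 <= q.1 <= 1 -> 0 <= q.2 <= 1 -> forall q1 q2 q3 : R * R,
    `|q1.1 - q.1| <= N.+1%:R^-1 -> `|q1.2 - q.2| <= N.+1%:R^-1 ->
    `|q2.1 - q.1| <= N.+1%:R^-1 -> `|q2.2 - q.2| <= N.+1%:R^-1 ->
    `|q3.1 - q.1| <= N.+1%:R^-1 -> `|q3.2 - q.2| <= N.+1%:R^-1 ->
    let F (q : R * R) := H (clamp q.1, clamp q.2) in
    (c (F q1) (F q2) * c (F q2) (F q3) = c (F q1) (F q3))%g.
Proof.
move=> cH; pose F (q : R * R) := H (clamp q.1, clamp q.2).
have cF : continuous F.
  apply: fun_comp_continuous cH; apply: fun_pair_continuous.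
    apply: fun_comp_continuous (@clamp_continuous R).
    by apply: fun_fst_continuous; exact: fun_id_continuous.
  apply: fun_comp_continuous (@clamp_continuous R).
  by apply: fun_snd_continuous; exact: fun_id_continuous.
have [|q|N0 HN] := @lebesgue_box R (fun U => forall q1 q2 q3, U q1 -> U q2 ->
    U q3 -> (c (F q1) (F q2) * c (F q2) (F q3) = c (F q1) (F q3))%g).
- by move=> A B AB gB q1 q2 q3 /AB ? /AB ? /AB ?; exact: gB.
- have [U nU cU] := coc (F q); exists (F @^-1` U); first exact: cF.
  by move=> q1 q2 q3 ? ? ?; exact: cU.
by exists N0 => N N0N q q1 q2 a b d *; apply: (HN N N0N q q1 q2).
Qed.

Lemma grid_pt (N k : nat) : (k <= N.+1)%N ->
  0 <= (k%:R / N.+1%:R : R) <= 1.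
Proof.
by move=> kN; rewrite divr_ge0//= ler_pdivrMr ?ltr0n// mul1r ler_nat.
Qed.

Lemma path_square (p : I -> X) : continuous p ->
  continuous (fun st : I * I => p st.2).
Proof.
move=> cp; apply: fun_comp_continuous cp.
by apply: fun_snd_continuous; exact: fun_id_continuous.
Qed.

Lemma hol_spec (p : I -> X) : continuous p ->
  exists N0, forall N, (N0 <= N)%N -> hol_at p N.+1 = hol p.
Proof.
move=> cp; have [N0 HN] := cocycle_grid (path_square cp).
(* Two fine subdivisions have the common refinement with [N.+1 * M.+1] steps, so it is enough to
   compare each of them with it. *)
suff refine N M : (N0 <= N)%N -> hol_at p N.+1 = hol_at p (N.+1 * M.+1).
  suff : [set g | exists N0, forall N, (N0 <= N)%N -> hol_at p N.+1 = g]
      (hol p) by [].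
  rewrite /hol; case: xgetP => [g -> //|/(_ (hol_at p N0.+1)) []].
  by exists N0 => N N0N; rewrite (refine N N0)// mulnC -refine.
move=> N0N; have -> : hol_at p N.+1 =
    chain (fun k => sample p (N.+1 * M.+1) (k * M.+1)%N) 0 N.+1.
  by apply: eq_chain => k _; rewrite /sample !natrM -mulf_div divff ?mulr1.
apply/esym/chain_mul => k i j l kN ik jk lk.
have nearby r : (k * M.+1 <= r <= k.+1 * M.+1)%N ->
   `|r%:R / (N.+1 * M.+1)%:R - (k%:R / N.+1%:R) : R| <= N.+1%:R^-1.
  move=> /andP[kr rk].
  have -> : k%:R / N.+1%:R = (k * M.+1)%:R / (N.+1 * M.+1)%:R :> R.
    by rewrite !natrM -mulf_div divff ?mulr1.
  rewrite -mulrBl -natrB// ger0_norm ?mulr_ge0 ?invr_ge0//.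
  rewrite natrM invfM mulrA [_ * _^-1 * _^-1]mulrAC ler_piMl ?invr_ge0//.
  rewrite ler_pdivrMr ?ltr0n// mul1r ler_nat leq_subLR.
  by rewrite mulSn addnC in rk.
apply: (HN N N0N (0, k%:R / N.+1%:R) _ _ (0, _) (0, _) (0, _)) => /=.
all: rewrite ?subrr ?normr0 ?invr_ge0//; try exact: nearby.
- by rewrite lexx ler01.
- by apply: grid_pt; exact: ltnW.
Qed.

(** A discrete Stokes argument: on a fine grid the two ways around each cell agree, and the cells
    are crossed one at a time. *)
Lemma hol_square (H : I * I -> X) : continuous H ->
  (hol (fun t => H (t, zero)) * hol (fun t => H (one, t)) =
   hol (fun t => H (zero, t)) * hol (fun t => H (t, one)))%g.
Proof.
move=> cH; have [N0 HN] := cocycle_grid cH.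
have c1 a : continuous (fun t => H (t, a)).
  apply: fun_comp_continuous cH; apply: fun_pair_continuous.
    exact: fun_id_continuous.
  exact: cst_continuous.
have c2 a : continuous (fun t => H (a, t)).
  apply: fun_comp_continuous cH; apply: fun_pair_continuous.
    exact: cst_continuous.
  exact: fun_id_continuous.
have [N1 H1] := hol_spec (c1 zero); have [N2 H2] := hol_spec (c2 one).
have [N3 H3] := hol_spec (c2 zero); have [N4 H4] := hol_spec (c1 one).
pose N := (N0 + N1 + N2 + N3 + N4)%N.
rewrite -(H1 N) -?(H2 N) -?(H3 N) -?(H4 N) /N; try by lia.
rewrite -/N.
pose x (k : nat) : R := k%:R / N.+1%:R.
pose F j k := H (clamp (x j), clamp (x k)).
have x0 : clamp (x 0) = zero by rewrite /x mul0r.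
have x1 : clamp (x N.+1) = one by rewrite /x divff ?pnatr_eq0.
have E1 a : (fun t => H (t, clamp (x a))) = (fun t => H (t, clamp (x a))) by [].
rewrite -x0 -x1 /hol_at -/(sample _ _).
have cell j k : (j < N.+1)%N -> (k < N.+1)%N ->
  (c (F j k) (F j.+1 k) * c (F j.+1 k) (F j.+1 k.+1) =
   c (F j k) (F j k.+1) * c (F j k.+1) (F j.+1 k.+1))%g.
  move=> jN kN.
  have nx i : `|x i - x i| <= N.+1%:R^-1 by rewrite subrr normr0 invr_ge0.
  have nxS i : `|x i.+1 - x i| <= N.+1%:R^-1.
    by rewrite /x -mulrBl -natrB// subSnn mul1r ger0_norm ?invr_ge0.
  have N0N : (N0 <= N)%N by rewrite /N; lia.
  have := HN N N0N (x j, x k) (grid_pt (ltnW jN)) (grid_pt (ltnW kN)).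
  move=> /= h.
  rewrite (h (x j, x k) (x j.+1, x k) (x j.+1, x k.+1))//=.
  by rewrite (h (x j, x k) (x j, x k.+1) (x j.+1, x k.+1))//=.
(* A step in the second variable is carried across [j] cells of one row; [col] then stacks the
   rows. *)
have row k j : (k < N.+1)%N -> (j <= N.+1)%N ->
  (chain (fun i => F i k) 0 j * c (F j k) (F j k.+1) =
   c (F 0 k) (F 0 k.+1) * chain (fun i => F i k.+1) 0 j)%g.
  move=> kN; elim: j => [|j IH] jN.
    by rewrite /chain !big_geq// mul1g mulg1.
  rewrite /chain !big_nat_recr//= -!/(chain _ _ _) -mulgA cell// mulgA.
  by rewrite IH ?(ltnW jN)// mulgA.
have col k : (k <= N.+1)%N ->
  (chain (fun i => F i 0%N) 0 N.+1 * chain (fun i => F N.+1 i) 0 k =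
   chain (fun i => F 0%N i) 0 k * chain (fun i => F i k) 0 N.+1)%g.
  elim: k => [|k IH] kN.
    rewrite {2}/chain big_geq// {2}/chain big_geq// mul1g mulg1//.
  rewrite /chain [X in (_ * X)%g]big_nat_recr//= [X in (X * _)%g = _]/=.
  rewrite [in RHS]big_nat_recr//= -!/(chain _ _ _) mulgA IH ?(ltnW kN)//.
  by rewrite -mulgA row// mulgA.
exact: (col N.+1).
Qed.

Lemma hol_global (U : set X) (p : I -> X) : continuous p ->
  (forall a b d, U a -> U b -> U d -> (c a b * c b d = c a d)%g) ->
  (forall t, U (p t)) -> hol p = c (p zero) (p one).
Proof.
move=> cp cU Up; have [N0 HN] := hol_spec cp; rewrite -(HN N0)//.
rewrite /hol_at chain_cocycle//; last by move=> *; apply: cU; exact: Up.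
by rewrite /sample mul0r divff// pnatr_eq0.
Qed.

Lemma hol_trivial (p : I -> X) : continuous p ->
  (forall t, exists2 U, nbhs (p t) U & forall a b, U a -> U b -> c a b = 1%g) ->
  hol p = 1%g.
Proof.
move=> cp triv; have [N1 H1] := hol_spec cp.
have [|q|N0 HN] := @lebesgue_box R (fun U => forall q1 q2, U q1 -> U q2 ->
    c (p (clamp q1.2)) (p (clamp q2.2)) = 1%g).
- by move=> A B AB gB q1 q2 /AB ? /AB ?; exact: gB.
- have [U nU cU] := triv (clamp q.2).
  exists ((fun q : R * R => p (clamp q.2)) @^-1` U); last first.
    by move=> q1 q2 ? ?; exact: cU.
  have : continuous (fun q : R * R => p (clamp q.2)).
    apply: fun_comp_continuous cp; apply: fun_comp_continuous (@clamp_continuous R).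
    by apply: fun_snd_continuous; exact: fun_id_continuous.
  exact.
pose N := (N0 + N1)%N.
rewrite -(H1 N) /N ?leq_addl// -/N /hol_at /chain big1_seq// => k.
rewrite mem_index_iota/= => kN; have N0N : (N0 <= N)%N by rewrite leq_addr.
apply: (HN N N0N (0, k%:R / N.+1%:R) _ _ (0, k%:R / N.+1%:R)
  (0, k.+1%:R / N.+1%:R)) => /=; rewrite ?subrr ?normr0 ?invr_ge0 ?lexx ?ler01//.
  by apply: grid_pt; exact: ltnW.
by rewrite -mulrBl -natrB// subSnn mul1r ger0_norm ?invr_ge0.
Qed.

Lemma hol_cst x : hol (fun=> x) = 1%g.
Proof.
rewrite (@hol_global [set x]) ?cocyclexx//; first exact: cst_continuous.
by move=> a b d -> -> ->; rewrite !cocyclexx mulg1.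
Qed.

Lemma hol_homotopic x y (p q : {path I from x to y}) :
  homotopic p q -> hol p = hol q.
Proof.
move=> [H [cH H0 H1 Hb]]; have := hol_square cH.
have -> : (fun t => H (t, zero)) = (fun=> x) by apply/funext => t; have [] := Hb t.
have -> : (fun t => H (t, one)) = (fun=> y) by apply/funext => t; have [] := Hb t.
have -> : (fun t => H (zero, t)) = p by apply/funext.
have -> : (fun t => H (one, t)) = q by apply/funext.
by rewrite !hol_cst mul1g mulg1.
Qed.

Lemma hol_concat x y z (p : {path I from x to y}) (q : {path I from y to z}) :
  hol (concat p q) = (hol p * hol q)%g.
Proof.
have [N1 H1] := hol_spec (@cts_fun _ _ p).
have [N2 H2] := hol_spec (@cts_fun _ _ q).
have [N3 H3] := hol_spec (@cts_fun _ _ (concat p q)).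
pose N := (N1 + N2 + N3)%N.
(* The concatenation is subdivided into twice as many steps, so that one sample falls on the
   junction. *)
rewrite -(H1 N) -?(H2 N) -?(H3 (N.+1 + N)%N) /N; try by lia.
rewrite -/N -addnS addnn -mul2n mulnC.
have v2 (k : nat) : 2 * (k%:R / (N.+1 * 2)%:R) = k%:R / N.+1%:R :> R.
  by rewrite natrM invfM mulrCA [2 * _]mulrC -mulrA mulVf ?mulr1 ?pnatr_eq0.
have iv (k : nat) : (k <= N.+1 * 2)%N ->
    ival (clamp (k%:R / (N.+1 * 2)%:R)) = k%:R / (N.+1 * 2)%:R :> R.
  move=> kN; rewrite ival_clamp max_l ?divr_ge0// min_l//.
  by rewrite ler_pdivrMr ?ltr0n ?muln_gt0// mul1r ler_nat.
rewrite /hol_at (@chain_cat _ 0 N.+1); [|lia..]; congr (_ * _)%g.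
  apply: eq_chain => k /andP[_ kN]; rewrite /sample /= /mk_path /concat_fun.
  rewrite iv; last by lia.
  rewrite ifT ?v2//.
  by rewrite -(ler_pM2l (ltr0n R 2)) v2 divff ?pnatr_eq0// ler_pdivrMr// mul1r ler_nat.
rewrite [in LHS]/chain -{1}[N.+1]add0n big_addn muln2 -addnn addnK.
rewrite -[RHS]/(chain _ _ _) -[LHS]/(chain (fun k => sample (concat p q) _ (k + N.+1)) 0 N.+1).
apply: eq_chain => k /andP[_ kN]; rewrite /sample /= /mk_path /concat_fun.
rewrite addnn -muln2 iv; last by lia.
have e1 : 2 * ((k + N.+1)%:R / (N.+1 * 2)%:R) = k%:R / N.+1%:R + 1 :> R.
  by rewrite v2 natrD mulrDl divff ?pnatr_eq0.
(* In the second half the first branch can only be taken at the junction, where the end of [p] is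
   the start of [q]. *)
case: ifPn => [|_]; last by rewrite e1 addrK.
rewrite -(ler_pM2l (ltr0n R 2)) e1 divff ?pnatr_eq0// -lerBrDr subrr.
move=> k0; have -> : k%:R / N.+1%:R = 0 :> R.
  by apply/le_anti; rewrite k0 divr_ge0.
by rewrite add0r clamp_ge1// clamp_le0// path_zero path_one.
Qed.

Lemma hol_reverse x y (p : {path I from x to y}) : hol (reverse p) = (hol p)^-1%g.
Proof.
apply/(mulgI (hol p)); rewrite mulgV -hol_concat.
by rewrite (hol_homotopic (concat_pV p)) hol_cst.
Qed.

Definition pi1_hol (x : X) (a : pi1 R X x) : G := hol (repr a).

Lemma pi1_holE x (p : {path I from x to x}) : pi1_hol (homotopy_class p) = hol p.
Proof. by apply: hol_homotopic; exact: homotopic_repr. Qed.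

Lemma pi1_holM x (a b : pi1 R X x) : pi1_hol (a * b)%g = (pi1_hol a * pi1_hol b)%g.
Proof. by rewrite -hol_concat -pi1_holE. Qed.

Lemma pi1_hol1 x : pi1_hol (1%g : pi1 R X x) = 1%g.
Proof. by apply/(mulgI (pi1_hol (1%g : pi1 R X x))); rewrite -pi1_holM !mulg1. Qed.

Lemma pi1_holV x (a : pi1 R X x) : pi1_hol a^-1%g = (pi1_hol a)^-1%g.
Proof. by apply/(mulgI (pi1_hol a)); rewrite -pi1_holM !mulgV pi1_hol1. Qed.

Lemma normal_closure_hol x (S : set (pi1 R X x)) :
  (forall a, S a -> pi1_hol a = 1%g) ->
  forall a, normal_closure S a -> pi1_hol a = 1%g.
Proof.
move=> S1 a /(_ [set b | pi1_hol b = 1%g]); apply; split=> //; split=> /=.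
- exact: pi1_hol1.
- by move=> u v u1 v1; rewrite pi1_holM u1 v1 mulg1.
- by move=> u u1; rewrite pi1_holV u1 invg1.
- by move=> u v u1; rewrite /conjg !pi1_holM pi1_holV u1 mul1g mulVg.
Qed.

End holonomy.

Section subspace_maps.
Context {X Y : topologicalType}.

Lemma val_set_continuous (A : set X) : continuous (fun a : A => \val a).
Proof. exact: initial_continuous. Qed.

Lemma subset_continuous (A : set X) (f : Y -> A) :
  continuous (fun y => \val (f y)) -> continuous f.
Proof.
move=> cf; apply/continuousP => _ [B oB <-].
exact: (@open_comp _ _ (fun y => \val (f y))).
Qed.

End subspace_maps.

(** * Moving particles *)

Section configurations.
Variables (n : nat) (X : topologicalType).
Implicit Types a b z : conf n X.

Definition mk_conf (x : 'I_n -> X) (xI : injective x) : conf n X :=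
  @exist {ptws 'I_n -> X} (fun x => x \in @conf_set n X) x (mem_set xI).

Lemma conf_pt_mk x (xI : injective x) i : conf_pt i (mk_conf xI) = x i.
Proof. by []. Qed.

Lemma conf_inj a : injective (fun i => conf_pt i a).
Proof. exact: (set_valP a). Qed.

Lemma conf_eqP a b : (forall i, conf_pt i a = conf_pt i b) -> a = b.
Proof. by move=> ab; apply/val_inj/funext. Qed.

Lemma conf_continuous (Y : topologicalType) (f : Y -> conf n X) :
  (forall i, continuous (fun y => conf_pt i (f y))) -> continuous f.
Proof. by move=> cf; apply: subset_continuous; exact: fun_prod_continuous. Qed.

Variable R : realType.
Local Notation I := (unitI R).

Section path.
Variables (a b : conf n X) (q : 'I_n -> I -> X).
Hypotheses (cq : forall i, continuous (q i)).
Hypotheses (qI : forall t, injective (fun i => q i t)).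
Hypotheses (q0 : forall i, q i zero = conf_pt i a).
Hypotheses (q1 : forall i, q i one = conf_pt i b).

Let f (t : I) : conf n X := mk_conf (@qI t).

Let f_cont : continuous f.
Proof. exact: conf_continuous. Qed.

Let f_zero : f zero = a.
Proof. by apply: conf_eqP => i; rewrite conf_pt_mk q0. Qed.

Let f_one : f one = b.
Proof. by apply: conf_eqP => i; rewrite conf_pt_mk q1. Qed.

Definition conf_path : {path I from a to b} := mk_path f_cont f_zero f_one.

End path.

Lemma exists_conf_path a b (q : 'I_n -> I -> X) :
  (forall i, continuous (q i)) -> (forall t, injective (fun i => q i t)) ->
  (forall i, q i zero = conf_pt i a) -> (forall i, q i one = conf_pt i b) ->
  exists p : {path I from a to b}, forall i t, conf_pt i (p t) = q i t.
Proof. by move=> cq qI q0 q1; exists (conf_path cq qI q0 q1). Qed.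

Lemma exists_conf_move a b k (p : I -> X) : continuous p ->
  p zero = conf_pt k a -> p one = conf_pt k b ->
  (forall i, i != k -> conf_pt i a = conf_pt i b) ->
  (forall i t, i != k -> p t <> conf_pt i a) ->
  exists c : {path I from a to b},
    forall t, conf_pt k (c t) = p t /\
      forall i, i != k -> conf_pt i (c t) = conf_pt i a.
Proof.
move=> cp p0 p1 ab pa.
have [i|t i j|i|i|c cE] := @exists_conf_path a b
  (fun i => if i == k then p else fun=> conf_pt i a).
- by case: eqP => // _; exact: cst_continuous.
- case: (eqVneq i k) => [->|ik]; case: (eqVneq j k) => [->|jk] //.
  + by move/pa => /(_ jk).
  + by move/esym/pa => /(_ ik).
  + by move/conf_inj.
- by case: eqP => // ->.
- by case: eqP => [->//|/eqP/ab].
by exists c => t; split => [|i ik]; rewrite cE ?eqxx// (negbTE ik).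
Qed.

End configurations.

(** * Reaching prescribed places up to the order of the particles *)

Section pebbles.
Variables (R : realType) (X : topologicalType) (n : nat).
Hypothesis X_hausdorff : hausdorff_space X.
Local Notation I := (unitI R).
Implicit Types x y z : conf n X.

Definition connects (Y : topologicalType) (a b : Y) : Prop :=
  inhabited {path I from a to b}.

Lemma connects_trans (Y : topologicalType) (a b d : Y) :
  connects a b -> connects b d -> connects a d.
Proof. by move=> [p] [q]; constructor; exact: concat p q. Qed.

Lemma connects_refl (Y : topologicalType) (a : Y) : connects a a.
Proof. by constructor; exact: cst a. Qed.

Lemma connects_sym (Y : topologicalType) (a b : Y) : connects a b -> connects b a.
Proof. by move=> [p]; constructor; exact: reverse p. Qed.

Definition occupied x : set X := range (fun i => conf_pt i x).

Lemma last_visit (f : R -> X) (C : set X) (s : R) : continuous f -> closed C ->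
  0 <= s -> C (f 0) -> exists r, [/\ 0 <= r <= s, C (f r) &
    forall r', r < r' <= s -> ~ C (f r')].
Proof.
move=> cf cC s0 C0.
have cK : compact (`[0, s]%classic `&` f @^-1` C).
  apply: compact_closedI; first exact: segment_compact.
  by apply: preimage_closed cC => ? _; exact: cf.
have [||r] := compact_EVT_max (f := id) _ cK.
- by exists 0; split => //=; rewrite in_itv /= lexx.
- by apply: continuous_subspaceT => ?; exact: cvg_id.
rewrite inE /= in_itv /= => -[rs Cr] rmax; exists r; split=> // r' /andP[rr' r's] Cr'.
have := rmax r'; rewrite inE /= in_itv /= r's (le_trans _ (ltW rr')) ?(andP rs).1//.
by move=> /(_ (conj isT Cr')); rewrite leNgt rr'.
Qed.

Lemma first_visit (f : R -> X) (C : set X) (s : R) : continuous f -> closed C ->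
  0 <= s -> C (f s) -> exists r, [/\ 0 <= r <= s, C (f r) &
    forall r', 0 <= r' < r -> ~ C (f r')].
Proof.
move=> cf cC s0 Cs.
have [||r [/andP[r0 rs] Cr H]] := @last_visit (fun t => f (s - t)) C s _ cC s0.
- apply: fun_comp_continuous cf; apply: subr_fun_continuous.
    exact: fun_cst_continuous.
  exact: fun_id_continuous.
- by rewrite subr0.
exists (s - r); split => // [|r' /andP[r'0 r'r]]; first lra.
by have := H (s - r'); rewrite subKr; apply; lra.
Qed.

Lemma closed_occupied x : closed (occupied x).
Proof.
rewrite (_ : occupied x = \bigcup_(i in setT) [set conf_pt i x]).
  apply: closed_bigcup => [|i _]; first exact: finite_finset.
  apply: accessible_closed_set1.
  exact: hausdorff_accessible.
by apply/seteqP; split=> [u [i _ <-]|u [i _ ->]]; exists i.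
Qed.

Definition hits (f : R -> X) (s : R) x : {set 'I_n} :=
  [set i | `[< exists2 r, 0 <= r <= s & f r = conf_pt i x >]]%SET.

Lemma move_along x (k : 'I_n) (f : R -> X) (a b : R) : continuous f -> a < b ->
  f a = conf_pt k x -> (forall r, a < r <= b -> ~ occupied x (f r)) ->
  exists x', [/\ connects x x', conf_pt k x' = f b &
    forall i, i != k -> conf_pt i x' = conf_pt i x].
Proof.
move=> cf ab fa fo.
have fob : ~ occupied x (f b) by apply: fo; rewrite ab lexx.
have xI : injective (fun i => if i == k then f b else conf_pt i x).
  move=> i j; case: (eqVneq i k) => [->|ik]; case: (eqVneq j k) => [->|jk] //.
  - by move=> e; case: fob; exists j.
  - by move=> e; case: fob; exists i.
  - by move/conf_inj.
exists (mk_conf xI); split; last 2 first.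
- by rewrite conf_pt_mk eqxx.
- by move=> i ik; rewrite conf_pt_mk (negbTE ik).
have [|||i|i t ik|c _] := @exists_conf_move n X R x (mk_conf xI) k
  (fun t => f (a + (b - a) * ival t)).
- apply: (@fun_comp_continuous _ _ _ (fun t : I => a + (b - a) * ival t) f) => //.
  apply: addr_fun_continuous; first exact: fun_cst_continuous.
  apply: mulr_fun_continuous; first exact: fun_cst_continuous.
  exact: ival_continuous.
- by rewrite ival0 mulr0 addr0 fa.
- by rewrite ival1 mulr1 addrC subrK conf_pt_mk eqxx.
- by move=> ik; rewrite conf_pt_mk (negbTE ik).
- have /andP[t0 t1] := ival_itv t; move: t0; rewrite le_eqVlt => /predU1P[<-|t0].
    by rewrite mulr0 addr0 fa => /conf_inj ki; rewrite ki eqxx in ik.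
  move=> e; apply: (fo (a + (b - a) * ival t)); last by exists i.
  have ba : 0 < b - a by rewrite subr_gt0.
  by rewrite ltrDl mulr_gt0//= -lerBrDl ger_pMr.
- by constructor.
Qed.

(** Other particles may block the path, so only the occupied set is controlled. The last particle
    [j] met on the way moves on to the end [f s]. Its old place is now free and becomes the end of
    the path, cut at the first visit there. The cut path meets fewer particles: as [f s] is not
    reached before time [s], [j] no longer lies on it. *)
Lemma pebble_chain (m : nat) x (k : 'I_n) (f : R -> X) (s : R) :
  continuous f -> 0 <= s -> f 0 = conf_pt k x -> ~ occupied x (f s) ->
  (forall r, 0 <= r < s -> f r <> f s) -> (#|hits f s x| <= m)%N ->
  exists2 z, connects x z &
    forall w, occupied z w <-> w = f s \/ (w <> conf_pt k x /\ occupied x w).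
Proof.
elim: m x s => [|m IH] x s cf s0 f0 ns fs hm.
  have : k \in hits f s x by rewrite inE; apply/asboolP; exists 0; rewrite ?lexx.
  by move: hm; rewrite leqn0 cards_eq0 => /eqP ->; rewrite inE.
have [|r [/andP[r0 rs] [j _ xj] after]] := last_visit cf (@closed_occupied x) s0.
  by exists k.
have {rs} rs : r < s.
  rewrite lt_neqAle rs andbT; apply/eqP => rs'; apply: ns; rewrite -rs'.
  by exists j.
have [x' [xx' x'j x'i]] := move_along cf rs (esym xj) after.
have occ' w : occupied x' w <-> w = f s \/ (w <> conf_pt j x /\ occupied x w).
  split=> [[i _ <-]|[->|[wj [i _ wi]]]].
  - have [->|ij] := eqVneq i j; first by left.
    by right; rewrite x'i//; split; [move/conf_inj => /eqP; rewrite (negbTE ij)|exists i].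
  - by exists j.
  - exists i => //; rewrite x'i//; apply/eqP => ij; apply: wj.
    by rewrite -wi ij.
have [jk|jk] := eqVneq j k; first by exists x' => //; rewrite -jk.
have [||r' [/andP[r'0 r'r] r'j before]] := @first_visit f [set conf_pt j x] r cf _ r0.
- by apply: accessible_closed_set1; exact: hausdorff_accessible.
- by rewrite /= xj.
rewrite /= in r'j before.
have xjs : conf_pt j x <> f s by move=> e; apply: ns; rewrite -e; exists j.
have [||||z x'z zE] := IH x' r' cf r'0.
- by rewrite f0 x'i// eq_sym.
- by rewrite r'j => /occ'[//|[]].
- by move=> u ur'; rewrite r'j; exact: before.
- rewrite -ltnS; apply: leq_trans hm; apply: proper_card.
  apply/properP; split.
    apply/fintype.subsetP => i; rewrite !inE => -[u /andP[u0 ur'] fu].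
    have us : u < s by exact: le_lt_trans (le_trans ur' r'r) rs.
    have [ij|ij] := eqVneq i j.
      by case: (fs u); rewrite ?u0 ?us// fu ij.
    by exists u; rewrite ?u0 ?(ltW us)// fu x'i.
  exists j; rewrite inE; first by apply/asboolP; exists r; rewrite ?r0 ?(ltW rs).
  apply/negP => /asboolP[u /andP[u0 ur'] fu].
  by case: (fs u); rewrite ?u0 ?(le_lt_trans (le_trans ur' r'r))// fu.
exists z; first exact: connects_trans x'z.
have xkj : conf_pt j x <> conf_pt k x by move/conf_inj/eqP; rewrite (negbTE jk).
have sk : f s <> conf_pt k x by move=> e; apply: ns; rewrite e; exists k.
move=> w; rewrite zE r'j x'i 1?eq_sym//.
split.
  case=> [->|[wk /occ'[->|[wj ow]]]]; [right|left|right] => //.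
  by split=> //; exists j.
case=> [->|[wk ow]]; first by right; split => //; apply/occ'; left.
by have [->|wj] := pselect (w = conf_pt j x); [left|right; split => //; apply/occ'; right].
Qed.

Hypothesis X_connected : forall a b : X, connects a b.

(** On an interval, for instance, the order of the particles cannot be changed, so [y] is reached
    only up to a permutation. Each use of [pebble_chain] fills one more place of [y] and vacates a
    place outside [y]. *)
Lemma pebbles x y : exists2 z, connects x z & occupied z `<=` occupied y.
Proof.
pose miss x := [set j | ~~ `[< occupied x (conf_pt j y) >]]%SET.
suff H m : forall x, (#|miss x| <= m)%N ->
    exists2 z, connects x z & occupied z `<=` occupied y by exact: (H _ x (leqnn _)).
elim: m => [|m IH] {}x.
  rewrite leqn0 cards_eq0 => /eqP xm; exists x; first exact: connects_refl.
  have {xm} all_occ j : exists i, conf_pt i x = conf_pt j y.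
    have : j \notin miss x by rewrite xm inE.
    by rewrite inE negbK => /asboolP[i]; exists i.
  have [g gE] := choice all_occ.
  have /injF_bij[h _ hK] : injective g.
    by move=> i j gij; apply: (@conf_inj _ _ y); rewrite -!gE gij.
  by move=> _ [i _ <-]; exists (h i) => //; rewrite -gE hK.
have [xm _|/set0Pn[j jm]] := eqVneq (miss x) finset.set0.
  by apply: IH; rewrite xm cards0.
move=> xm.
(* By counting, if some place of [y] is empty then some particle of [x] stands outside the places of
   [y]. *)
have [k kn] : exists k, ~ occupied y (conf_pt k x).
  apply: contrapT => /forallNP occ.
  have /choice[g gE] k : exists j', conf_pt j' y = conf_pt k x.
    by have /contrapT[j' _ e] := occ k; exists j'.
  have /injF_bij[h _ hK] : injective g.
    by move=> i i' gii'; apply: (@conf_inj _ _ x); rewrite -!gE gii'.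
  by move: jm; rewrite inE => /asboolP; apply; exists (h j) => //; rewrite -gE hK.
have ny : ~ occupied x (conf_pt j y) by move: jm; rewrite inE => /asboolP.
(* The path is cut at its first visit to the target, as [pebble_chain] requires. *)
have [p] := X_connected (conf_pt k x) (conf_pt j y).
pose f (t : R) := p (clamp t).
have cf : continuous f by exact: path_clamp_continuous.
have f1 : f 1 = conf_pt j y by rewrite /f clamp_ge1// path_one.
have f0 : f 0 = conf_pt k x by rewrite /f clamp_le0// path_zero.
have [||r [/andP[r0 r1] fr before]] := @first_visit f [set conf_pt j y] 1 cf _ ler01.
- by apply: accessible_closed_set1; exact: hausdorff_accessible.
- by rewrite /= f1.
rewrite /= in fr before.
have [||z xz zE] := pebble_chain cf r0 f0 _ _ (leqnn _).
- by rewrite fr.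
- by move=> u ur; rewrite fr; exact: before.
rewrite fr in zE.
have [|w zw wy] := IH z; last by exists w => //; exact: connects_trans zw.
rewrite -ltnS; apply: leq_trans xm; apply: proper_card; apply/properP; split.
  apply/fintype.subsetP => i; rewrite inE => /asboolP iz; rewrite inE; apply/asboolP => ix.
  apply: iz.
  by apply/zE; right; split => // e; apply: kn; exists i.
by exists j => //; rewrite inE negbK; apply/asboolP/zE; left.
Qed.

End pebbles.

(** * Loops in contractible spaces *)

Section contractible_loops.
Variables (R : realType) (X : topologicalType).
Local Notation I := (unitI R).

(* Conjugating by the track q of the base point turns the free contraction F of
   the loop into one relative to the endpoints. *)
Lemma contractible_loop (x : X) (p : {path I from x to x}) :
  contractible R X -> homotopic p (cst x).
Proof.
move=> [x0 [H [cH H0 H1]]].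
pose F (s t : R) : X := H (p (clamp t), clamp s).
have cF (Y : topologicalType) (u v : Y -> R) : continuous u -> continuous v ->
    continuous (fun y => F (u y) (v y)).
  move=> cu cv; apply: fun_comp_continuous cH; apply: fun_pair_continuous.
    apply: fun_comp_continuous (@cts_fun _ _ p).
    exact: fun_comp_continuous cv (@clamp_continuous R).
  exact: fun_comp_continuous cu (@clamp_continuous R).
have F0 s t : s <= 0 -> F s t = p (clamp t) by move=> s0; rewrite /F (clamp_le0 s0) H0.
have F1 s t : 1 <= s -> F s t = x0 by move=> s1; rewrite /F (clamp_ge1 s1) H1.
have Ft0 s t : t <= 0 -> F s t = H (x, clamp s).
  by move=> t0; rewrite /F (clamp_le0 t0) path_zero.
have Ft1 s t : 1 <= t -> F s t = H (x, clamp s).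
  by move=> t1; rewrite /F (clamp_ge1 t1) path_one.
(* [h] is at least 1 on the middle third, where [mid] runs through the loop and the contraction is
   to be completed. On the outer thirds it is the time along the track of the base point. *)
pose h (t : R) : R := Num.min (3 * t) (3 - 3 * t).
have c1 : continuous (fun st : I * I => ival st.1).
  apply: fun_comp_continuous (@ival_continuous R).
  by apply: fun_fst_continuous; exact: fun_id_continuous.
have c2 : continuous (fun st : I * I => ival st.2).
  apply: fun_comp_continuous (@ival_continuous R).
  by apply: fun_snd_continuous; exact: fun_id_continuous.
have c3 : continuous (fun t : R => 3 * t).
  apply: mulr_fun_continuous; first exact: fun_cst_continuous.
  exact: fun_id_continuous.
have ch : continuous h.
  apply: minr_continuous => //; apply: subr_fun_continuous => //.
  exact: fun_cst_continuous.
have c4 : continuous (fun t : R => 3 * t - 1).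
  by apply: subr_fun_continuous => //; exact: fun_cst_continuous.
have h0 : h 0 = 0 by rewrite /h min_l; lra.
have h1 : h 1 = 0 by rewrite /h min_r; lra.
pose mid (t : I) := F 0 (3 * ival t - 1).
pose top (t : I) := F (h (ival t)) 0.
have cmid : continuous mid.
  apply: cF; first exact: fun_cst_continuous.
  exact: fun_comp_continuous (@ival_continuous R) c4.
have ctop : continuous top.
  apply: cF; last exact: fun_cst_continuous.
  exact: fun_comp_continuous (@ival_continuous R) ch.
have mid0 : mid zero = x.
  by rewrite /mid ival0 Ft0 ?clamp_le0 ?H0//; lra.
have mid1 : mid one = x.
  by rewrite /mid ival1 Ft1 ?clamp_le0 ?H0//; lra.
have top0 : top zero = x by rewrite /top ival0 h0 Ft0// clamp_le0 ?H0.
have top1 : top one = x by rewrite /top ival1 h1 Ft0// clamp_le0 ?H0.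
apply: (@homotopic_trans _ _ _ _ _ (mk_path cmid mid0 mid1)).
  apply: (@homotopic_reparam _ _ _ _ _ _ (fun t => p (clamp t)) id
    (fun t => Num.min (Num.max (3 * t - 1) 0) 1)) => //.
  - exact: path_clamp_continuous.
  - exact: fun_id_continuous.
  - apply: minr_continuous; last exact: fun_cst_continuous.
    by apply: maxr_continuous => //; exact: fun_cst_continuous.
  - by rewrite /= max_r ?min_l; lra.
  - by rewrite /= max_l ?min_r; lra.
  - by move=> t; rewrite ivalK.
  - move=> t; rewrite /= /mk_path /mid F0//; congr (p _).
    by rewrite -[LHS]ivalK.
apply: (@homotopic_trans _ _ _ _ _ (mk_path ctop top0 top1)).
  exists (fun st => F (Num.min (ival st.1) (h (ival st.2))) (3 * ival st.2 - 1)).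
  split.
  - apply: cF; last exact: fun_comp_continuous c2 c4.
    by apply: minr_continuous => //; exact: fun_comp_continuous c2 ch.
  - move=> t; rewrite /= /mk_path /mid ival0 F0 ?F0// ge_min; lra.
  - move=> t; rewrite /= /mk_path /top ival1.
    have [t1|t1] := leP (3 * ival t) 1.
      by rewrite Ft0 ?Ft0//; [congr (H (_, clamp _)); rewrite min_r// /h ge_min t1|lra].
    have [t2|t2] := leP (3 * ival t) 2.
      by rewrite min_l ?F1// /h le_min; lra.
    by rewrite Ft1 ?Ft0//; [congr (H (_, clamp _)); rewrite min_r// /h ge_min; lra|lra].
  - move=> s; have /andP[s0 s1] := ival_itv s; rewrite /= ival0 ival1 h0 h1 min_r//.
    rewrite !F0//; split.
      by rewrite clamp_le0 ?path_zero//; lra.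
    by rewrite clamp_ge1 ?path_one//; lra.
exists (fun st => F (Num.min (1 - ival st.1) 1 * h (ival st.2)) 0); split.
- apply: cF; last exact: fun_cst_continuous.
  apply: mulr_fun_continuous; last exact: fun_comp_continuous c2 ch.
  apply: minr_continuous; last exact: fun_cst_continuous.
  by apply: subr_fun_continuous => //; exact: fun_cst_continuous.
- by move=> t; rewrite /= /mk_path ival0 subr0 minxx mul1r.
- move=> t; rewrite /= ival1 subrr min_l// mul0r Ft0// clamp_le0 ?H0//.
- by move=> s; rewrite /= ival0 ival1 h0 h1 mulr0 Ft0// clamp_le0 ?H0.
Qed.

Lemma contractible_pi1 (x : X) (a : pi1 R X x) : contractible R X -> a = 1%g.
Proof.
move=> cX; rewrite -(homotopy_class_repr a).
by apply/homotopy_classP; exact: contractible_loop.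
Qed.

End contractible_loops.

Lemma convex_gt0 (R : realType) (t : unitI R) (x y : R) :
  0 < x -> 0 < y -> 0 < (1 - ival t) * x + ival t * y.
Proof.
move=> x0 y0; have /andP[t0 t1] := ival_itv t.
move: t0; rewrite le_eqVlt => /predU1P[<-|t0].
  by rewrite subr0 mul1r mul0r addr0.
by rewrite ltr_wpDl ?mulr_gt0// mulr_ge0 ?subr_ge0// ltW.
Qed.

Lemma convex_itv (R : realType) (r x y : R) : 0 <= r <= 1 -> x <= y ->
  x <= (1 - r) * x + r * y <= y.
Proof.
move=> /andP[r0 r1] xy; have h1 : 0 <= r * (y - x) by rewrite mulr_ge0// subr_ge0.
have h2 : 0 <= (1 - r) * (y - x) by rewrite mulr_ge0 ?subr_ge0.
by lra.
Qed.

(** * Realizations of simplicial complexes *)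

Section realization.
Variables (R : realType) (V : finType) (K : {set {set V}}).
Hypothesis K_complex : simplicial_complex K.
Local Notation Gamma := (realization R K).
Local Notation I := (unitI R).
Implicit Types a b t : Gamma.

Definition coord (v : V) (t : Gamma) : R :=
  (\val (t : set_type (@polyhedron R V K)) : {ptws V -> R}) v.

Definition mk_real (t : V -> R) (ht : polyhedron K (t : {ptws V -> R})) : Gamma :=
  @exist {ptws V -> R} (fun c => c \in polyhedron K) t (mem_set ht).

Lemma coord_continuous v : continuous (coord v).
Proof.
apply: (@fun_comp_continuous _ _ _ (fun t : Gamma => \val t)
  (fun c : {ptws V -> R} => c v)).
  exact: initial_continuous.
exact: (@proj_continuous _ (fun=> R) v).
Qed.

Lemma nbhs_coord_gt v t (c : R) : c < coord v t -> nbhs t [set x | c < coord v x].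
Proof.
move=> h; apply: (@coord_continuous v t [set r | c < r]).
by apply: open_nbhs_nbhs; split => //; exact: open_gt.
Qed.

Lemma nbhs_coord_lt v t (c : R) : coord v t < c -> nbhs t [set x | coord v x < c].
Proof.
move=> h; apply: (@coord_continuous v t [set r | r < c]).
by apply: open_nbhs_nbhs; split => //; exact: open_lt.
Qed.

Lemma real_continuous (Y : topologicalType) (f : Y -> Gamma) :
  (forall v, continuous (fun y => coord v (f y))) -> continuous f.
Proof. by move=> cf; apply: subset_continuous; exact: fun_prod_continuous. Qed.

Lemma coordP a b : (forall v, coord v a = coord v b) -> a = b.
Proof. by move=> ab; apply/val_inj/funext. Qed.

Lemma realP t : exists2 s, s \in K & simplex s (\val t).
Proof. exact: (set_valP t). Qed.

Lemma coord_ge0 v t : 0 <= coord v t.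
Proof. by have [s _ [t0 _ _]] := realP t; exact: t0. Qed.

Lemma sum_coord t : \sum_v coord v t = 1.
Proof. by have [s _ [_ t1 _]] := realP t; exact: t1. Qed.

Lemma simplexP (s : {set V}) t :
  simplex s (\val t) <-> (forall v, coord v t != 0 -> v \in s).
Proof.
split=> [[_ _ st] v|st]; first exact: st.
by split=> //; [move=> v; exact: (coord_ge0 v t)|exact: (sum_coord t)].
Qed.

Definition support_of (t : V -> R) : {set V} := [set v | t v != 0]%SET.

Lemma support_neq0 (t : V -> R) : \sum_v t v = 1 -> support_of t != finset.set0.
Proof.
move=> t1; apply/negP => /eqP s0; move/eqP: t1; rewrite big1.
  by rewrite eq_sym oner_eq0.
move=> v _; apply/eqP; apply: contraT => tv.
by move/setP/(_ v): s0; rewrite !inE tv.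
Qed.

Lemma polyhedronP (t : {ptws V -> R}) : polyhedron K t <->
  [/\ forall v, 0 <= t v, \sum_v t v = 1 & support_of t \in K].
Proof.
split=> [[s sK [t0 t1 ts]]|[t0 t1 tK]]; last first.
  by exists (support_of t) => //; split => // v; rewrite inE.
split=> //; apply: (K_complex.2 s) => //; last exact: support_neq0.
by apply/fintype.subsetP => v; rewrite inE => /ts.
Qed.

Lemma vertex_of_simplex (s : {set V}) v :
  s \in K -> v \in s -> [set v]%SET \in K.
Proof.
move=> sK vs; apply: (K_complex.2 s) => //; first by rewrite finset.sub1set.
by apply/set0Pn; exists v; rewrite inE.
Qed.

Lemma exists_vertex t : exists2 v, coord v t != 0 & [set v]%SET \in K.
Proof.
have [s sK [t0 t1 ts]] := realP t.
have /set0Pn[v] := support_neq0 t1; rewrite inE => tv; exists v => //.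
by apply: (vertex_of_simplex sK); exact: ts.
Qed.

Lemma real_hausdorff : hausdorff_space Gamma.
Proof.
move=> a b ab; apply: coordP => v; apply: (@Rhausdorff R) => A B nA nB.
have [t [tA tB]] := ab _ _ (coord_continuous nA) (coord_continuous nB).
by exists (coord v t).
Qed.

Fact simplex_conv (s : {set V}) a b (r : R) : s \in K ->
  simplex s (\val a) -> simplex s (\val b) -> 0 <= r <= 1 ->
  polyhedron K ((fun v => (1 - r) * coord v a + r * coord v b) : {ptws V -> R}).
Proof.
move=> sK [a0 a1 sa] [b0 b1 sb] /andP[r0 r1]; exists s => //; split.
- by move=> v; rewrite addr_ge0// mulr_ge0 ?subr_ge0//; [exact: a0|exact: b0].
- by rewrite big_split/= -!mulr_sumr !sum_coord !mulr1 subrK.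
- move=> v; apply: contraNT => vs.
  have -> : coord v a = 0 by apply/eqP; apply: contraNT vs; exact: sa.
  have -> : coord v b = 0 by apply/eqP; apply: contraNT vs; exact: sb.
  by rewrite !mulr0 addr0.
Qed.

Lemma exists_segment (s : {set V}) a b : s \in K ->
  simplex s (\val a) -> simplex s (\val b) ->
  exists q : {path I from a to b}, forall r v,
    coord v (q r) = (1 - ival r) * coord v a + ival r * coord v b.
Proof.
move=> sK sa sb.
pose q (r : I) := mk_real (simplex_conv sK sa sb (ival_itv r)).
have cq : continuous q.
  apply: real_continuous => v.
  apply: addr_fun_continuous; apply: mulr_fun_continuous.
  - apply: subr_fun_continuous (@ival_continuous R).
    exact: fun_cst_continuous.
  - exact: fun_cst_continuous.
  - exact: ival_continuous.
  - exact: fun_cst_continuous.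
have q0 : q zero = a.
  by apply: coordP => v; rewrite /coord /= ival0 subr0 mul1r mul0r addr0.
have q1 : q one = b.
  by apply: coordP => v; rewrite /coord /= ival1 subrr mul1r mul0r add0r.
by exists (mk_path cq q0 q1).
Qed.

Fact vtx_subproof (v : V) (hv : [set v]%SET \in K) :
  polyhedron K ((fun w => (w == v)%:R) : {ptws V -> R}).
Proof.
exists [set v]%SET => //; split => [w|| w]; first exact: ler0n.
  by rewrite (bigD1 v)//= eqxx big1 ?addr0// => w /negbTE ->.
by rewrite inE; apply: contraNT => /negbTE ->.
Qed.

Definition vtx (v : V) (hv : [set v]%SET \in K) : Gamma := mk_real (vtx_subproof hv).

Lemma coord_vtx v w (hv : [set v]%SET \in K) : coord w (vtx hv) = (w == v)%:R.
Proof. by []. Qed.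

Lemma vtx_simplex (s : {set V}) v (hv : [set v]%SET \in K) :
  v \in s -> simplex s (\val (vtx hv)).
Proof.
move=> vs; split.
- exact: (coord_ge0^~ (vtx hv)).
- exact: (sum_coord (vtx hv)).
- move=> w; rewrite -/(coord w (vtx hv)) coord_vtx.
  by apply: contraNT; case: (eqVneq w v) => [->|]; rewrite ?vs ?eqxx.
Qed.

(** [Q] records what the walk has to avoid. Its value at the start serves the walk without edges. *)
Lemma exists_walk (e : rel V) (Q : Gamma -> Prop) :
  (forall x y, e x y -> [set x; y]%SET \in K) ->
  (forall x y a, e x y -> simplex [set x; y]%SET (\val a) -> Q a) ->
  forall x y (hx : [set x]%SET \in K) (hy : [set y]%SET \in K),
  connect e x y -> Q (vtx hx) ->
  exists q : {path I from vtx hx to vtx hy}, forall r, Q (q r).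
Proof.
move=> eK eQ x y hx hy /connectP[p].
elim: p x hx => [|z p IH] x hx /=.
  move=> _ xy Qx; move: hy; rewrite xy => hy.
  by rewrite (bool_irrelevance hy hx); exists (cst (vtx hx)).
move=> /andP[xz zp] yE Qx.
have hz : [set z]%SET \in K by exact: vertex_of_simplex (eK _ _ xz) (set22 x z).
have sz : simplex [set x; z]%SET (\val (vtx hz)) by apply: vtx_simplex; rewrite !inE eqxx orbT.
have sx : simplex [set x; z]%SET (\val (vtx hx)) by apply: vtx_simplex; rewrite !inE eqxx.
have [q2 Q2] := IH z hz zp yE (eQ _ _ _ xz sz).
have [q1 E1] := exists_segment (eK _ _ xz) sx sz.
exists (concat q1 q2) => r; rewrite /= /mk_path /concat_fun; case: ifP => _ //.
apply: (eQ _ _ _ xz); split.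
- by move=> v; exact: coord_ge0.
- exact: sum_coord.
- move=> v; rewrite -/(coord _ _) E1 !coord_vtx !inE.
  by case: (v == x); case: (v == z) => //; rewrite !mulr0 addr0 eqxx.
Qed.

Lemma real_connected : connected_graph K -> forall a b, connects R a b.
Proof.
move=> Kc a b.
have tovtx t : exists v (hv : [set v]%SET \in K), connects R t (vtx hv).
  have [v tv hv] := exists_vertex t; exists v, hv.
  have [s sK st] := realP t; have vs : v \in s by have [_ _] := st; exact.
  by have [q _] := exists_segment sK st (vtx_simplex hv vs); constructor.
have [v [hv av]] := tovtx a; have [w [hw bw]] := tovtx b.
apply: connects_trans av _; apply: connects_trans (connects_sym bw).
have [x y /andP[]||//|q _] := @exists_walk (edge K) (fun=> True) _ _ v w hv hw (Kc _ _ hv hw) => //.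
Qed.

End realization.

Section dimension_one.
Variables (R : realType) (V : finType) (K : {set {set V}}).
Hypothesis K_complex : simplicial_complex K.
Hypothesis K_dim1 : dimension K = 1%N.
Local Notation Gamma := (realization R K).
Implicit Types t : Gamma.

Lemma card_simplex (s : {set V}) : s \in K -> (#|s| <= 2)%N.
Proof.
move=> sK; have : (#|s|.-1 <= dimension K)%N by 
  exact: (@leq_bigmax_cond _ (fun r => r \in K) (fun r : {set V} => #|r|.-1) s sK).
by rewrite K_dim1; case: #|s| => // -[].
Qed.

Lemma two_coords (u v : V) t : u != v -> coord u t != 0 -> coord v t != 0 ->
  [/\ [set u; v]%SET \in K, coord u t + coord v t = 1 &
      forall w, w != u -> w != v -> coord w t = 0].
Proof.
move=> uv tu tv; have [s sK [t0 t1 ts]] := realP t.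
have sE : s = [set u; v]%SET.
  apply/esym/eqP; rewrite eqEcard cards2 uv card_simplex// andbT.
  by apply/fintype.subsetP => w; rewrite !inE => /orP[] /eqP ->; exact: ts.
have others w : w != u -> w != v -> coord w t = 0.
  move=> wu wv; apply/eqP; apply: contraNT (negbT (orbF false)) => tw.
  by have := ts _ tw; rewrite sE !inE (negbTE wu) (negbTE wv).
split=> //; first by rewrite -sE.
rewrite -(sum_coord t) (bigD1 u)//= (bigD1 v) 1?eq_sym//= big1 ?addr0//.
by move=> w /andP[wu wv]; exact: others.
Qed.

Lemma coord_le1 (u : V) t : coord u t <= 1.
Proof.
rewrite -(sum_coord t) (bigD1 u)//= lerDl.
by apply: sumr_ge0 => w _; exact: coord_ge0.
Qed.

End dimension_one.

(** * Crossings of a marked point of an edge *)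

Section crossing.
Variables (R : realType) (V : finType) (K : {set {set V}}).
Hypothesis K_complex : simplicial_complex K.
Hypothesis K_dim1 : dimension K = 1%N.
Local Notation Gamma := (realization R K).
Implicit Types t x y z : Gamma.
Variables (u v : V) (m : R).
Hypotheses (uv : u != v) (m0 : 0 < m) (m1 : m < 1).

Definition open_edge (u v : V) t : bool := (0 < coord u t) && (0 < coord v t).

(** The mark itself is counted on the side of [v]. *)
Definition crosses x y : bool :=
  [&& open_edge u v x, open_edge u v y & (coord v x < m) != (coord v y < m)].

(** The condition on [u] excludes the points of other edges at [v] with the same coordinate [m]. *)
Definition at_mark t : Prop := 0 < coord u t /\ coord v t = m.

Lemma crosses_off t : ~ at_mark t ->
  exists2 U, nbhs t U & forall x y, U x -> U y -> crosses x y = false.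
Proof.
move=> tm.
have [tv|tv|tv] := ltrgtP (coord v t) m.
- exists [set x | coord v x < m] => [|x y /= xm ym]; first exact: nbhs_coord_lt.
  by rewrite /crosses xm ym eqxx !andbF.
- exists [set x | m < coord v x] => [|x y /= xm ym]; first exact: nbhs_coord_gt.
  by rewrite /crosses ![_ < m]ltNge (ltW xm) (ltW ym) !andbF.
(* Here [t] lies on another edge at [v]. Points of the open edge [uv] with coordinate less than
   [1 - m] at [u] are all past the mark, so no two of them are separated by it. *)
- have tu : coord u t = 0.
    apply/eqP; apply: contra_notT tm => tu; split=> //.
    by rewrite lt_def tu coord_ge0.
  exists [set x | coord u x < 1 - m] => [|x y /= xm ym].
    by apply: nbhs_coord_lt; rewrite tu subr_gt0.
  have side z : open_edge u v z -> coord u z < 1 - m -> (coord v z < m) = false.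
    move=> /andP[zu zv] zm.
    have [_ e _] := two_coords K_dim1 uv (lt0r_neq0 zu) (lt0r_neq0 zv).
    by apply/negbTE; rewrite -leNgt; lra.
  rewrite /crosses; case ox : (open_edge u v x) => //=.
  by case oy : (open_edge u v y) => //=; rewrite !side.
Qed.

Lemma nbhs_open_edge t : open_edge u v t -> nbhs t [set x | open_edge u v x].
Proof.
move=> /andP[tu tv].
by apply: filterS2 (nbhs_coord_gt tu) (nbhs_coord_gt tv) => x /= xu xv; rewrite /open_edge xu xv.
Qed.

Lemma crosses_on x y : open_edge u v x -> open_edge u v y ->
  crosses x y = (coord v x < m) (+) (coord v y < m).
Proof. by move=> ox oy; rewrite /crosses ox oy /=; do 2 case: (_ < m). Qed.

End crossing.

Section conjugation.
Variables (R : realType) (X Y : topologicalType) (f : continuousType X Y).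
Local Notation I := (unitI R).

Lemma exists_map_path (a b : X) (p : {path I from a to b}) :
  exists q : {path I from f a to f b}, forall t, q t = f (p t).
Proof.
have c : continuous (f \o p) by exact: fun_comp_continuous (@cts_fun _ _ p) (@cts_fun _ _ f).
have c0 : (f \o p) zero = f a by rewrite /= path_zero.
have c1 : (f \o p) one = f b by rewrite /= path_one.
by exists (mk_path c c0 c1).
Qed.

Definition null_image (a : X) (p : {path I from a to a}) : Prop :=
  homotopic (map_loop (f := f) erefl p) (cst (f a)).

Lemma null_image_conj (a b : X) (p : {path I from a to b}) (q : {path I from b to b}) :
  null_image q -> null_image (concat p (concat q (reverse p))).
Proof.
move=> nq; rewrite /null_image; have [fp fpE] := exists_map_path p.
have -> : map_loop (f := f) erefl (concat p (concat q (reverse p))) =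
    concat fp (concat (map_loop (f := f) erefl q) (reverse fp)).
  apply/path_eqP => t; rewrite /= /mk_path /concat_fun /=.
  case: ifP => _; first by rewrite fpE.
  rewrite /= /mk_path /concat_fun /=; case: ifP => _ //.
  by rewrite /reverse /= /mk_path /reverse_fun fpE.
apply: homotopic_trans (concat_pV fp); apply: homotopic_concat.
  exact: homotopic_refl.
apply: homotopic_trans (concat_cstp (reverse fp)); apply: homotopic_concat => //.
exact: homotopic_refl.
Qed.

Lemma null_image_pi1 (a : X) (p : {path I from a to a}) :
  null_image p <-> pi1_map (f := f) erefl (homotopy_class p) = 1%g.
Proof. by rewrite pi1_mapE; split=> /homotopy_classP. Qed.

Lemma null_image_const (a : X) (p : {path I from a to a}) :
  (forall t, f (p t) = f a) -> null_image p.
Proof.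
move=> pa; rewrite /null_image (_ : map_loop _ _ = cst (f a)).
  exact: homotopic_refl.
by apply/path_eqP => t; exact: pa.
Qed.

Lemma pi1_mapV (a : X) (g : pi1 R X a) :
  pi1_map (f := f) erefl g^-1%g = (pi1_map (f := f) erefl g)^-1%g.
Proof.
apply: (mulgI (pi1_map (f := f) erefl g)).
by rewrite -pi1_mapM !mulgV pi1_map1.
Qed.

Lemma pi1_map_comm (a : X) (g h : pi1 R X a) :
  pi1_map (f := f) erefl g = 1%g \/ pi1_map (f := f) erefl h = 1%g ->
  pi1_map (f := f) erefl (commg g h) = 1%g.
Proof.
by rewrite /commg /conjg !pi1_mapM !pi1_mapV => -[] ->;
  rewrite ?invg1 ?mul1g ?mulg1 ?mulVg// mulVg.
Qed.

End conjugation.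

Lemma nbhs_conf (n : nat) (X : topologicalType) (y : conf n X) (U : 'I_n -> set X) :
  (forall i, nbhs (conf_pt i y) (U i)) -> nbhs y [set z | forall i, U i (conf_pt i z)].
Proof.
move=> nU; pose f i := [set z : conf n X | U i (conf_pt i z)].
apply: (@filter_forall (conf n X) 'I_n f (nbhs y)) => i.
exact: conf_pt_continuous (nU i).
Qed.

Section cross_letter.
Variables (R : realType) (V : finType) (K : {set {set V}}) (u v : V) (m : R).
Variables (G : groupType) (g : G).
Hypothesis gg : (g * g = 1)%g.
Implicit Types x y z : realization R K.

Definition cross_letter x y : G := if crosses u v m x y then g else 1%g.

(** On the open edge the letter records whether the sides differ, which is additive modulo 2; [g]
    being an involution turns this into multiplicativity. *)
Lemma cross_letterM x y z : open_edge u v x -> open_edge u v y -> open_edge u v z ->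
  (cross_letter x y * cross_letter y z = cross_letter x z)%g.
Proof.
move=> ox oy oz; rewrite /cross_letter !crosses_on//.
by do 3 case: (_ < m); rewrite /= ?mulg1 ?mul1g.
Qed.

End cross_letter.

Section labelled_crossings.
Variables (R : realType) (V : finType) (K : {set {set V}}).
Hypothesis K_complex : simplicial_complex K.
Hypothesis K_dim1 : dimension K = 1%N.
Local Notation Gamma := (realization R K).
Local Notation I := (unitI R).
Variables (u v : V) (m : R).
Hypotheses (uv : u != v) (m0 : 0 < m) (m1 : m < 1).
Variables (n : nat) (G : groupType) (g : 'I_n -> G).
Hypothesis gg : forall i, (g i * g i = 1)%g.
Local Notation F := (conf n Gamma).

(* Particle i crossing the mark contributes the letter g i; two particles never
   sit at the mark simultaneously, so nearby the product has at most one letter. *)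
Definition cross_word (y z : F) : G :=
  \big[*%g/1%g]_(i < n) cross_letter u v m (g i) (conf_pt i y) (conf_pt i z).

Lemma cross_word_only (k : 'I_n) (y z : F) :
  (forall j, j != k -> crosses u v m (conf_pt j y) (conf_pt j z) = false) ->
  cross_word y z = cross_letter u v m (g k) (conf_pt k y) (conf_pt k z).
Proof.
by move=> jk; apply: big_only1 => // j /jk; rewrite /cross_letter => ->.
Qed.

Lemma at_mark_inj (x y : Gamma) : at_mark u v m x -> at_mark u v m y -> x = y.
Proof.
move=> [xu xv] [yu yv]; apply: coordP => w.
have [_ ex ox] := two_coords K_dim1 uv (lt0r_neq0 xu) (lt0r_neq0 (eq_ind_r (fun r => 0 < r) m0 xv)).
have [_ ey oy] := two_coords K_dim1 uv (lt0r_neq0 yu) (lt0r_neq0 (eq_ind_r (fun r => 0 < r) m0 yv)).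
have [->|wu] := eqVneq w u; first by move: ex ey; rewrite xv yv => <- /addIr ->.
by have [->|wv] := eqVneq w v; rewrite ?xv ?yv// ox ?oy.
Qed.

Lemma cross_word_cocycle : local_cocycle cross_word.
Proof.
move=> y.
have loc i : exists U : set Gamma, [/\ nbhs (conf_pt i y) U,
    ~ at_mark u v m (conf_pt i y) ->
      forall a b, U a -> U b -> crosses u v m a b = false &
    at_mark u v m (conf_pt i y) -> forall a, U a -> open_edge u v a].
  have [mi|mi] := pselect (at_mark u v m (conf_pt i y)).
    exists [set x | open_edge u v x]; split => //.
    by apply: nbhs_open_edge; rewrite /open_edge mi.1 mi.2.
  by have [U nU cU] := crosses_off K_dim1 uv m1 mi; exists U.
have [U HU] := choice loc.
exists [set z | forall i, U i (conf_pt i z)].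
  by apply: nbhs_conf => i; have [] := HU i.
have off j : ~ at_mark u v m (conf_pt j y) -> forall a b : F,
    (forall i, U i (conf_pt i a)) -> (forall i, U i (conf_pt i b)) ->
    crosses u v m (conf_pt j a) (conf_pt j b) = false.
  by move=> mj a b Ua Ub; have [_ cU _] := HU j; exact: cU.
move=> a b d /= Ua Ub Ud.
have [[k mk]|nomark] := pselect (exists k, at_mark u v m (conf_pt k y)).
  have [_ _ /(_ mk) oU] := HU k.
  have offk j : j != k -> ~ at_mark u v m (conf_pt j y).
    by move=> jk mj; move: jk; rewrite (conf_inj (at_mark_inj mj mk)) eqxx.
  by rewrite !(@cross_word_only k) ?cross_letterM//; try exact: oU;
    move=> j jk; apply: off => //; exact: offk.
have triv (a' b' : F) : (forall i, U i (conf_pt i a')) ->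
    (forall i, U i (conf_pt i b')) -> cross_word a' b' = 1%g.
  move=> Ua' Ub'; apply: big1 => j _; rewrite /cross_letter off//.
  by move=> mj; apply: nomark; exists j.
by rewrite !triv// mulg1.
Qed.

Lemma hol_off (p : I -> F) : continuous p ->
  (forall t i, ~ at_mark u v m (conf_pt i (p t))) -> hol cross_word p = 1%g.
Proof.
move=> cp off; apply: hol_trivial => //; first exact: cross_word_cocycle.
move=> t.
have loc i : exists2 U, nbhs (conf_pt i (p t)) U &
    forall a b, U a -> U b -> crosses u v m a b = false.
  exact: crosses_off (off t i).
have /choice[U HU] : forall i, exists U : set Gamma, nbhs (conf_pt i (p t)) U /\
    forall a b, U a -> U b -> crosses u v m a b = false.
  by move=> i; have [U] := loc i; exists U.
exists [set z | forall i, U i (conf_pt i z)].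
  by apply: nbhs_conf => i; have [] := HU i.
move=> a b Ua Ub; apply: big1 => i _; rewrite /cross_letter.
by have [_ ->] := HU i.
Qed.

Lemma hol_cross (k : 'I_n) (p : I -> F) : continuous p ->
  (forall t, open_edge u v (conf_pt k (p t))) ->
  (forall t i, i != k -> conf_pt i (p t) = conf_pt i (p zero)) ->
  (coord v (conf_pt k (p zero)) < m) != (coord v (conf_pt k (p one)) < m) ->
  hol cross_word p = g k.
Proof.
move=> cp ok fix_others sides.
(* On [U] only particle [k] varies, within the open edge, so the cocycle identity holds on all of
   [U] and the holonomy can be read off the endpoints. *)
pose U : set F := [set z | open_edge u v (conf_pt k z) /\
  forall i, i != k -> conf_pt i z = conf_pt i (p zero)].
have noc x : crosses u v m x x = false by rewrite /crosses eqxx !andbF.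
have offU (a b : F) : U a -> U b -> forall j, j != k ->
    crosses u v m (conf_pt j a) (conf_pt j b) = false.
  by move=> [_ Ua] [_ Ub] j jk; rewrite Ua// Ub.
rewrite (@hol_global _ _ _ _ cross_word_cocycle U)//.
- rewrite (@cross_word_only k); last by apply: offU; split=> // i; exact: fix_others.
  by rewrite /cross_letter /crosses !ok sides.
- move=> a b d Ua Ub Ud; rewrite !(@cross_word_only k); [|exact: offU..].
  by apply: cross_letterM => //; [case: Ua|case: Ub|case: Ud].
- by move=> t; split=> // i; exact: fix_others.
Qed.

(* Particle l steps aside along al, particle k runs once through the mark and
   back along s and w, and particle l returns. *)
Lemma orbit_loop (z : F) (k l : 'I_n) (p q d : Gamma)
    (s : {path I from p to q}) (al : {path I from q to d}) (w : {path I from q to p}) :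
  p = conf_pt k z -> q = conf_pt l z -> k != l ->
  (forall t i, i != l -> al t <> conf_pt i z) ->
  (forall t, s t <> d) -> (forall t, w t <> d) ->
  (forall t i, i != k -> i != l -> s t <> conf_pt i z) ->
  (forall t i, i != k -> i != l -> w t <> conf_pt i z) ->
  (forall t, ~ at_mark u v m (al t)) -> (forall t, ~ at_mark u v m (w t)) ->
  (forall i, ~ at_mark u v m (conf_pt i z)) ->
  (forall t, open_edge u v (s t)) ->
  (coord v (conf_pt k z) < m) != (coord v (conf_pt l z) < m) ->
  exists2 A : {path I from z to z}, hol cross_word A = g k &
    forall j, j != k -> null_image (@conf_pt n Gamma j) A.
Proof.
move=> ? ?; subst p q => kl alz sd wd sz wz alm wm zm so sides.
have ald i : i != l -> conf_pt i z <> d.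
  by move=> il e; apply: (alz one i il); rewrite path_one.
have z1I : injective (fun i => if i == l then d else conf_pt i z).
  move=> i j; case: (eqVneq i l) => [->|il]; case: (eqVneq j l) => [->|jl] //.
  - by move=> e; case: (ald j jl).
  - by move=> e; case: (ald i il).
  - by move/conf_inj.
pose z1 : F := mk_conf z1I.
have z2I : injective (fun i => if i == k then conf_pt l z else conf_pt i z1).
  move=> i j; case: (eqVneq i k) => [->|ik]; case: (eqVneq j k) => [->|jk] //.
  - rewrite conf_pt_mk; case: (eqVneq j l) => [_ e|jl /conf_inj e].
      by case: (sd one); rewrite path_one.
    by rewrite e eqxx in jl.
  - rewrite conf_pt_mk; case: (eqVneq i l) => [_ e|il /conf_inj e].
      by case: (sd one); rewrite path_one.
    by rewrite e eqxx in il.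
  - by move/conf_inj.
pose z2 : F := mk_conf z2I.
have z1l : conf_pt l z1 = d by rewrite conf_pt_mk eqxx.
have z1i i : i != l -> conf_pt i z1 = conf_pt i z.
  by move=> il; rewrite conf_pt_mk (negbTE il).
have z2k : conf_pt k z2 = conf_pt l z by rewrite conf_pt_mk eqxx.
have z2i i : i != k -> conf_pt i z2 = conf_pt i z1.
  by move=> ik; rewrite conf_pt_mk (negbTE ik).
have [||||i t il|P PE] := @exists_conf_move n Gamma R z z1 l al.
- exact: cts_fun.
- by rewrite path_zero.
- by rewrite path_one z1l.
- by move=> i il; rewrite z1i.
- exact: alz.
have [||||i t ik|S SE] := @exists_conf_move n Gamma R z1 z2 k s.
- exact: cts_fun.
- by rewrite path_zero z1i.
- by rewrite path_one z2k.
- by move=> i ik; rewrite z2i.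
- by have [->|il] := eqVneq i l; [rewrite z1l|rewrite z1i//; exact: sz].
have [||||i t ik|W WE] := @exists_conf_move n Gamma R z2 z1 k w.
- exact: cts_fun.
- by rewrite path_zero z2k.
- by rewrite path_one z1i.
- by move=> i ik; rewrite z2i.
- by rewrite z2i//; have [->|il] := eqVneq i l; [rewrite z1l|rewrite z1i//; exact: wz].
have z1m i : ~ at_mark u v m (conf_pt i z1).
  by have [->|il] := eqVneq i l; [have := alm one; rewrite z1l path_one|rewrite z1i].
(* The inner loop at [z1] moves particle [k] alone, so every other strand is the conjugate by [P] of
   a constant loop. *)
exists (concat P (concat (concat S W) (reverse P))).
  rewrite !(hol_concat cross_word_cocycle) (hol_reverse cross_word_cocycle).
  have -> : hol cross_word P = 1%g.
    apply: hol_off; first exact: cts_fun.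
    move=> t i; have [Pl Pi] := PE t.
    by have [->|il] := eqVneq i l; [rewrite Pl|rewrite Pi].
  have -> : hol cross_word W = 1%g.
    apply: hol_off; first exact: cts_fun.
    move=> t i; have [Wk Wi] := WE t.
    by have [->|ik] := eqVneq i k; [rewrite Wk|rewrite Wi// z2i].
  rewrite (@hol_cross k) ?invg1 ?mulg1 ?mul1g//; first exact: cts_fun.
  - by move=> t; rewrite (SE t).1.
  - by move=> t i ik; rewrite (SE t).2// (SE zero).2.
  - by rewrite path_zero path_one z2k z1i.
move=> j jk; apply: null_image_conj; apply: null_image_const => t.
rewrite /= /mk_path /concat_fun; case: ifP => _.
  by rewrite (SE _).2.
by rewrite (WE _).2// z2i.
Qed.

End labelled_crossings.

Lemma exists_noncommuting_involutions :
  exists (G : groupType) (g h : G),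
    [/\ (g * g = 1)%g, (h * h = 1)%g & (g * h <> h * g)%g].
Proof.
pose o (k : nat) : 'I_3 := inord k.
have oE k l : (k < 3)%N -> (l < 3)%N -> (o k == o l) = (k == l).
  by move=> k3 l3; rewrite -val_eqE /= !inordK.
exists ({perm 'I_3} : groupType), (tperm (o 0%N) (o 1%N)), (tperm (o 1%N) (o 2)).
split; [exact: tperm2|exact: tperm2|].
move=> /(congr1 (fun s : {perm 'I_3} => s (o 0%N))); rewrite !permM.
rewrite tpermL tpermL [tperm (o 1%N) _ _]tpermD ?oE// tpermL => /eqP.
by rewrite oE.
Qed.

Lemma commg_neq1 (G : groupType) (g h : G) : (g * h <> h * g)%g -> commg g h <> 1%g.
Proof.
move=> gh e; apply: gh; apply: (mulgI h^-1%g); apply: (mulgI g^-1%g).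
by rewrite mulKg mulVg.
Qed.

Section path_values.
Variables (R : realType) (X : topologicalType) (P : X -> Prop).
Local Notation I := (unitI R).

Lemma concat_values a b d (p : {path I from a to b}) (q : {path I from b to d}) :
  (forall t, P (p t)) -> (forall t, P (q t)) -> forall t, P (concat p q t).
Proof. by move=> Pp Pq t; rewrite /= /mk_path /concat_fun; case: ifP. Qed.

Lemma reverse_values a b (p : {path I from a to b}) :
  (forall t, P (p t)) -> forall t, P (reverse p t).
Proof. by move=> Pp t; exact: Pp. Qed.

End path_values.

Section edges.
Variables (R : realType) (V : finType) (K : {set {set V}}).
Hypothesis K_complex : simplicial_complex K.
Local Notation Gamma := (realization R K).
Implicit Types t : Gamma.

Lemma pair_sub (a b x y : V) : a != b -> a \in [set x; y]%SET -> b \in [set x; y]%SET ->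
  [set x; y]%SET = [set a; b]%SET.
Proof.
move=> ab ax bx; apply/esym/eqP; rewrite eqEcard !cards2 ab.
apply/andP; split; last by case: (x != y).
by apply/fintype.subsetP => w; rewrite !inE => /orP[] /eqP ->; rewrite -in_set2.
Qed.

Lemma simplex_open_edge (a b x y : V) t : a != b -> simplex [set x; y]%SET (\val t) ->
  open_edge a b t -> [set x; y]%SET = [set a; b]%SET.
Proof.
move=> ab [_ _ st] /andP[ta tb].
by apply: pair_sub => //; apply: st; rewrite gt_eqF.
Qed.

Lemma exists_edge_point (a b : V) (r : R) : a != b -> [set a; b]%SET \in K ->
  0 <= r <= 1 -> exists t, [/\ simplex [set a; b]%SET (\val t),
    coord a t = 1 - r & coord b t = r].
Proof.
move=> ab abK r01.
have aK := vertex_of_simplex K_complex abK (set21 a b).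
have bK := vertex_of_simplex K_complex abK (set22 a b).
have sa : simplex [set a; b]%SET (\val (vtx R aK)) by apply: vtx_simplex; rewrite !inE eqxx.
have sb : simplex [set a; b]%SET (\val (vtx R bK)) by apply: vtx_simplex; rewrite !inE eqxx orbT.
pose t := mk_real (simplex_conv abK sa sb r01).
have E w : coord w t = (1 - r) * (w == a)%:R + r * (w == b)%:R by [].
exists t; split.
- by apply/simplexP => w; rewrite E !inE; case: (w == a); case: (w == b) => //;
    rewrite !mulr0 addr0 eqxx.
- by rewrite E eqxx (negbTE ab) mulr1 mulr0 addr0.
- by rewrite E eqxx eq_sym (negbTE ab) mulr1 mulr0 add0r.
Qed.

Lemma segment_simplex (s : {set V}) (x y z : Gamma) (r r' : R) :
  simplex s (\val x) -> simplex s (\val y) ->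
  (forall v, coord v z = r * coord v x + r' * coord v y) -> simplex s (\val z).
Proof.
move=> /simplexP sx /simplexP sy zE; apply/simplexP => v; apply: contraNT => vs.
have -> : coord v z = r * 0 + r' * 0.
  by rewrite zE; congr (_ * _ + _ * _); apply/eqP; apply: contraNT vs; [exact: sx|exact: sy].
by rewrite !mulr0 addr0.
Qed.

Lemma simplex_pair_sum (a b : V) t : a != b -> simplex [set a; b]%SET (\val t) ->
  coord a t + coord b t = 1.
Proof.
move=> ab [_ _ st]; rewrite -(sum_coord t) (bigD1 a)//= (bigD1 b) 1?eq_sym//= big1 ?addr0//.
move=> w /andP[wa wb]; apply/eqP; apply: contraT => /st.
by rewrite !inE (negbTE wa) (negbTE wb).
Qed.

End edges.

(** * Weakly Goldberg graphs *)

Section two_edges.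
Variables (R : realType) (V : finType) (K : {set {set V}}) (n : nat).
Hypothesis K_complex : simplicial_complex K.
Hypothesis K_dim1 : dimension K = 1%N.
Hypothesis K_connected : connected_graph K.
Hypothesis n_ge2 : (2 <= n)%N.
Local Notation Gamma := (realization R K).
Local Notation I := (unitI R).
Variables (a b v w : V) (m : R).
Hypotheses (ab : a != b) (abK : [set a; b]%SET \in K).
Hypotheses (vw : v != w) (vwK : [set v; w]%SET \in K).
Hypothesis abvw : [set a; b]%SET != [set v; w]%SET.
Hypotheses (m0 : 0 < m) (m1 : m < 1).

Definition avoiding : rel V := fun x y =>
  [&& edge K x y, [set x; y]%SET != [set a; b]%SET & [set x; y]%SET != [set v; w]%SET].

Hypotheses (bv : connect avoiding b v) (av : connect avoiding a v).

Lemma avoiding_sym : symmetric avoiding.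
Proof.
by move=> x y; rewrite /avoiding /edge eq_sym finset.setUC.
Qed.

(** The stage for the commutator. Two particles stand at [p] and [q], on either side of the mark;
    the others are parked along the edge [vw]. The point [d] is nearer to [v] than all parked
    particles and is kept free for the side steps: [al] and [be] lead there from [q] and [p] without
    crossing the mark. Together, [s] (through the mark) and [wq] (back by way of [v]) run once
    around. *)
Lemma exists_commutator_data : exists (p q d : Gamma) (T : 'I_n -> Gamma),
  exists (s : {path I from p to q}) (al : {path I from q to d})
    (be : {path I from p to d}) (wq : {path I from q to p}), 
  [/\ [/\ injective T, (forall i : 'I_n, i = 0%N :> nat -> T i = p) &
         (forall i : 'I_n, i = 1%N :> nat -> T i = q)],
    [/\ coord b p < m, m < coord b q,
      ~ at_mark a b m p & ~ at_mark a b m q],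
    (forall i : 'I_n, (1 < i)%N -> [/\ open_edge v w (T i), ~ open_edge a b (T i) & d <> T i]),
    [/\ (forall t, open_edge a b (s t)), (forall t, s t <> d),
        (forall t, ~ at_mark a b m (wq t)), (forall t, wq t <> d) &
        (forall t, ~ open_edge v w (wq t))] &
    [/\ (forall t, ~ at_mark a b m (al t)), (forall t, al t <> p),
        (forall t, ~ at_mark a b m (be t)), (forall t, be t <> q) &
        forall i : 'I_n, (1 < i)%N -> forall t, al t <> T i /\ be t <> T i]].
Proof.
have [m0' m1'] := (m0, m1).
have aK := vertex_of_simplex K_complex abK (set21 a b).
have bK := vertex_of_simplex K_complex abK (set22 a b).
have vK := vertex_of_simplex K_complex vwK (set21 v w).
(* The coordinates [m / 2] and [(1 + m) / 2] are the midpoints of the two sides of the mark. *)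
have [p [sp pa pb]] : exists t : Gamma, [/\ simplex [set a; b]%SET (\val t),
  coord a t = 1 - m / 2 & coord b t = m / 2] by apply: exists_edge_point => //; lra.
have [q [sq qa qb]] : exists t : Gamma, [/\ simplex [set a; b]%SET (\val t),
  coord a t = 1 - (1 + m) / 2 & coord b t = (1 + m) / 2] by apply: exists_edge_point => //; lra.
(* Equally spaced coordinates on the edge [vw]: index 0 is [v] itself, index 1 is [d], and the
   indices from 2 on are the parking places. *)
pose pos (k : nat) : R := k%:R / n.+1%:R.
have pos0 k : (0 < k)%N -> 0 < pos k by move=> k0; rewrite divr_gt0// ltr0n.
have pos1 k : (k <= n)%N -> pos k < 1 by move=> kn; rewrite ltr_pdivrMr// mul1r ltr_nat.
have poslt k l : (k < l)%N -> pos k < pos l by move=> kl; rewrite ltr_pM2r ?invr_gt0// ltr_nat.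
have tailp (k : nat) : exists t : Gamma, (k <= n)%N -> [/\ simplex [set v; w]%SET (\val t),
    coord v t = 1 - pos k & coord w t = pos k].
  (* Beyond [n] the point [p] is only a default value, which makes [tl] total. *)
  have [kn|_] := leqP k n; last by exists p.
  have [|t ht] := @exists_edge_point R V K K_complex v w (pos k) vw vwK; last by exists t.
  by rewrite (ltW (pos1 _ kn)) divr_ge0.
have [tl tlE] := choice tailp.
have tlo k : (0 < k <= n)%N -> open_edge v w (tl k).
  move=> /andP[k0 kn]; have [_ ev ew] := tlE _ kn.
  by rewrite /open_edge ev ew subr_gt0 pos1// pos0.
have sd k : (k <= n)%N -> simplex [set v; w]%SET (\val (tl k)) by move=> /tlE[].
pose d := tl 1%N.
have n1 : (1 <= n)%N by exact: ltnW.
have [_ dv dw] := tlE _ n1.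
have pne : open_edge a b p by rewrite /open_edge pa pb; lra.
have qne : open_edge a b q by rewrite /open_edge qa qb; lra.
have tail_not_ab t : simplex [set v; w]%SET (\val t) -> ~ open_edge a b t.
  by move=> st /(simplex_open_edge ab st) e; move: (abvw); rewrite e eqxx.
have ab_not_tail t : simplex [set a; b]%SET (\val t) -> ~ open_edge v w t.
  by move=> st /(simplex_open_edge vw st) e; move: (abvw); rewrite e eqxx.
have vab : ~ open_edge a b (vtx R vK).
  by apply: tail_not_ab; apply: vtx_simplex; rewrite !inE eqxx.
pose T (i : 'I_n) := if (i == 0%N :> nat) then p else if (i == 1%N :> nat) then q else tl i.
have [s sE] := exists_segment abK sp sq.
have [bq bqE] : exists q1 : {path I from q to vtx R bK}, forall r x,
    coord x (q1 r) = (1 - ival r) * coord x q + ival r * coord x (vtx R bK).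
  by apply: exists_segment abK sq _; apply: vtx_simplex; rewrite !inE eqxx orbT.
have [ap apE] : exists q1 : {path I from p to vtx R aK}, forall r x,
    coord x (q1 r) = (1 - ival r) * coord x p + ival r * coord x (vtx R aK).
  by apply: exists_segment abK sp _; apply: vtx_simplex; rewrite !inE eqxx.
have [vd vdE] : exists q1 : {path I from vtx R vK to d}, forall r x,
    coord x (q1 r) = (1 - ival r) * coord x (vtx R vK) + ival r * coord x d.
  by apply: exists_segment vwK _ (sd _ n1); apply: vtx_simplex; rewrite !inE eqxx.
pose Q (t : Gamma) := ~ open_edge a b t /\ ~ open_edge v w t.
have Qwalk x y t : avoiding x y -> simplex [set x; y]%SET (\val t) -> Q t.
  move=> /and3P[_ xyab xyvw] st; split.
    by move/(simplex_open_edge ab st) => e; rewrite e eqxx in xyab.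
  by move/(simplex_open_edge vw st) => e; rewrite e eqxx in xyvw.
have avK x y : avoiding x y -> [set x; y]%SET \in K by move=> /and3P[/andP[]].
have Qvtx x (xK : [set x]%SET \in K) : Q (vtx R xK).
  split; rewrite /open_edge !coord_vtx => /andP[].
    by case: eqP => [<-|]; rewrite 1?[b == a]eq_sym ?(negbTE ab) ?ltxx.
  by case: eqP => [<-|]; rewrite 1?[w == v]eq_sym ?(negbTE vw) ?ltxx.
have [wb wbQ] := exists_walk K_complex avK Qwalk vK bv (Qvtx _ bK).
have [wa waQ] := exists_walk K_complex avK Qwalk vK av (Qvtx _ aK).
(* [QA] holds along [al] and [QB] along [be]: each stays on its own side of the mark and enters the
   edge [vw] no further than [d]. *)
pose QA (t : Gamma) := (open_edge a b t -> m < coord b t) /\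
  (open_edge v w t -> coord w t <= pos 1%N).
pose QB (t : Gamma) := (open_edge a b t -> coord b t < m) /\
  (open_edge v w t -> coord w t <= pos 1%N).
have sb : simplex [set a; b]%SET (\val (vtx R bK)) by apply: vtx_simplex; rewrite !inE eqxx orbT.
have sa : simplex [set a; b]%SET (\val (vtx R aK)) by apply: vtx_simplex; rewrite !inE eqxx.
have sv : simplex [set v; w]%SET (\val (vtx R vK)) by apply: vtx_simplex; rewrite !inE eqxx.
have bq_tail t : ~ open_edge v w (bq t).
  by apply: ab_not_tail; exact: segment_simplex sq sb (bqE t).
have ap_tail t : ~ open_edge v w (ap t).
  by apply: ab_not_tail; exact: segment_simplex sp sa (apE t).
have bq_m t : m < coord b (bq t).
  rewrite bqE coord_vtx eqxx qb; have /andP[t0 t1] := ival_itv t.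
  have : 0 <= ival t * (1 - m) by rewrite mulr_ge0//; lra.
  by rewrite /=; lra.
have ap_m t : coord b (ap t) < m.
  rewrite apE coord_vtx [b == a]eq_sym (negbTE ab) pb mulr0 addr0.
  have /andP[t0 t1] := ival_itv t.
  apply: le_lt_trans (_ : m / 2 < m); last by lra.
  by rewrite ler_piMl//; lra.
have vd_ab t : ~ open_edge a b (vd t).
  by apply: tail_not_ab; exact: segment_simplex sv (sd _ n1) (vdE t).
have vd_w t : coord w (vd t) <= pos 1%N.
  rewrite vdE coord_vtx [w == v]eq_sym (negbTE vw) mulr0 add0r dw.
  by have /andP[t0 t1] := ival_itv t; rewrite ler_piMl// ltW// pos0.
pose al := concat bq (concat wb vd); pose be := concat ap (concat wa vd).
pose wq := concat bq (concat wb (concat (reverse wa) (reverse ap))).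
have alQ t : QA (al t).
  move: t; apply: (concat_values (P := QA)) => [t|]; last first.
    apply: (concat_values (P := QA)) => t; split => //.
    - by have [ho _] := wbQ t.
    - by have [_ ho] := wbQ t.
    - by move=> /(vd_ab t).
  by split=> // /(bq_tail t).
have beQ t : QB (be t).
  move: t; apply: (concat_values (P := QB)) => [t|]; last first.
    apply: (concat_values (P := QB)) => t; split => //.
    - by have [ho _] := waQ t.
    - by have [_ ho] := waQ t.
    - by move=> /(vd_ab t).
  by split=> // /(ap_tail t).
have mark_open t : at_mark a b m t -> open_edge a b t.
  by move=> [ta tb]; rewrite /open_edge ta tb m0'.
pose QW (t : Gamma) := ~ at_mark a b m t /\ ~ open_edge v w t.
have wqQ t : QW (wq t).
  have Q_QW y : Q y -> QW y by move=> [oab ovw]; split => // /mark_open.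
  move: t; apply: (concat_values (P := QW)) => [t|].
    by split=> // -[_ e]; have := bq_m t; rewrite e ltxx.
  apply: (concat_values (P := QW)) => [t|]; first exact: Q_QW.
  apply: (concat_values (P := QW)).
  - by apply: (reverse_values (P := QW)) => {}t; exact: Q_QW.
  - apply: (reverse_values (P := QW)) => t; split=> // -[_ e].
    by have := ap_m t; rewrite e ltxx.
have pm : coord b p < m by rewrite pb; lra.
have qm : m < coord b q by rewrite qb; lra.
have Ti (i : 'I_n) : (1 < i)%N -> T i = tl i.
  by rewrite /T; case: (i : nat) => [|[]].
have Ttail (i : 'I_n) : (1 < i)%N -> [/\ open_edge v w (T i), ~ open_edge a b (T i),
    coord w (T i) = pos i & pos 1 < pos i].
  move=> i1; rewrite Ti//; have iN : (i <= n)%N by exact: ltnW.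
  split; last exact: poslt.
  - by apply: tlo; rewrite iN (ltn_trans _ i1).
  - by apply: tail_not_ab; exact: sd.
  - by have [] := tlE _ iN.
have pq : p <> q by move=> e; move: pm qm; rewrite e; lra.
have d_ab : ~ open_edge a b d by apply: tail_not_ab; exact: sd.
have T0 (i : 'I_n) : i = 0%N :> nat -> T i = p by rewrite /T => ->.
have T1 (i : 'I_n) : i = 1%N :> nat -> T i = q by rewrite /T => ->.
have s_ab t : open_edge a b (s t).
  by rewrite /open_edge !sE pa pb qa qb !convex_gt0//; lra.
exists p, q, d, T, s, al, be, wq; split.
- split=> // i j.
  have cases (k : 'I_n) : [\/ k = 0%N :> nat, k = 1%N :> nat | (1 < k)%N].
    by case: (k : nat) => [|[|k']]; [constructor 1|constructor 2|constructor 3].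
  case: (cases i) => [i0|i1|i2]; case: (cases j) => [j0|j1|j2].
  + by move=> _; apply: val_inj; rewrite /= i0 j0.
  + by rewrite (T0 i)// (T1 j)// => /pq.
  + by rewrite (T0 i)// => e; have [_ no _ _] := Ttail _ j2; case: no; rewrite -e.
  + by rewrite (T1 i)// (T0 j)// => /esym/pq.
  + by move=> _; apply: val_inj; rewrite /= i1 j1.
  + by rewrite (T1 i)// => e; have [_ no _ _] := Ttail _ j2; case: no; rewrite -e.
  + by rewrite (T0 j)// => e; have [_ no _ _] := Ttail _ i2; case: no; rewrite e.
  + by rewrite (T1 j)// => e; have [_ no _ _] := Ttail _ i2; case: no; rewrite e.
  + move=> e; have [_ _ ei _] := Ttail _ i2; have [_ _ ej _] := Ttail _ j2.
    apply: ord_inj; case: (ltngtP i j) => // /poslt; rewrite -ei -ej e ltxx//.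
- split=> //; first by move=> [_ e]; move: pm; rewrite e ltxx.
  by move=> [_ e]; move: qm; rewrite e ltxx.
- move=> i i1; have [h1 h2 ei ip] := Ttail _ i1; split; [exact: h1|exact: h2|move=> e].
  by move: ip; rewrite -ei -e dw ltxx.
- split=> // [t e|t|t|t].
  + by move: (s_ab t); rewrite e.
  + by have [] := wqQ t.
  + move=> e; have [_] := wqQ t; apply; rewrite e; exact: tlo.
  + by have [] := wqQ t.
- split=> [t /[dup] /mark_open o [_ e]|t e|t /[dup] /mark_open o [_ e]|t e|i i1 t].
  + by have [/(_ o)] := alQ t; rewrite e ltxx.
  + by have [/(_ _)] := alQ t; rewrite e => /(_ pne) /(lt_trans pm); rewrite ltxx.
  + by have [/(_ o)] := beQ t; rewrite e ltxx.
  + by have [/(_ _)] := beQ t; rewrite e => /(_ qne) /(lt_trans qm); rewrite ltxx.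
  + have [o _ ei ip] := Ttail _ i1.
    split=> e.
      by have [_] := alQ t; rewrite e ei => /(_ o); rewrite leNgt ip.
    by have [_] := beQ t; rewrite e ei => /(_ o); rewrite leNgt ip.
Qed.

End two_edges.

Section commutator.
Variables (R : realType) (V : finType) (K : {set {set V}}) (n : nat).
Hypothesis K_complex : simplicial_complex K.
Hypothesis K_dim1 : dimension K = 1%N.
Hypothesis K_connected : connected_graph K.
Hypothesis n_ge2 : (2 <= n)%N.
Local Notation Gamma := (realization R K).
Local Notation I := (unitI R).
Variables (a b v w : V) (m : R).
Hypotheses (ab : a != b) (abK : [set a; b]%SET \in K).
Hypotheses (vw : v != w) (vwK : [set v; w]%SET \in K).
Hypothesis abvw : [set a; b]%SET != [set v; w]%SET.
Hypotheses (m0 : 0 < m) (m1 : m < 1).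
Hypotheses (bv : connect (avoiding K a b v w) b v).
Hypotheses (av : connect (avoiding K a b v w) a v).

Lemma pi1_hol_comm (X : topologicalType) (G : groupType) (c : X -> X -> G)
    (coc : local_cocycle c) (x : X) (g h : pi1 R X x) :
  pi1_hol c (commg g h) = commg (pi1_hol c g) (pi1_hol c h).
Proof. by rewrite /commg /conjg !(pi1_holM coc) !(pi1_holV coc). Qed.

(* The commutator of the two orbit loops is killed by every strand, since each
   strand moves essentially in at most one of them. *)
Lemma kernel_not_normal_closure (x : conf n Gamma) (Gamma0 : set Gamma)
    (y : conf n Gamma0) (yx : conf_incl y = x) :
  (forall t, Gamma0 t -> ~ at_mark a b m t) ->
  kernel (@strand_map R n Gamma x) <>
  normal_closure (range (@incl_map R n Gamma Gamma0 y x yx)).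
Proof.
move=> off0.
have [G [g [h [gg hh gh]]]] := exists_noncommuting_involutions.
have [p [q [d [T [s [al [be [wq]]]]]]]] :=
  exists_commutator_data K_complex n_ge2 ab abK vw vwK abvw m0 m1 bv av.
move=> [[TI T0 T1] [pm qm pnm qnm] Ttail [sab sd wqm wqd wqt] [alm alp bem beq alT]].
have [z [pi] zT] := pebbles (real_hausdorff (K := K)) (real_connected K_complex K_connected)
  x (mk_conf TI).
(* The places [T] are occupied in an unknown order [sg]; [i1] and [i2] are the particles that happen
   to stand at [p] and [q]. *)
have /choice[sg sgE] i : exists j, T j = conf_pt i z.
  by have [|j _ e] := zT (conf_pt i z); [exists i|exists j].
have [tu sgK tuK] : bijective sg.
  by apply: injF_bij => i j e; apply: (@conf_inj _ _ z); rewrite -!sgE e.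
pose i1 := tu (Ordinal (ltnW n_ge2)); pose i2 := tu (Ordinal n_ge2).
have zi1 : p = conf_pt i1 z by rewrite -sgE tuK T0.
have zi2 : q = conf_pt i2 z by rewrite -sgE tuK T1.
have i12 : i1 != i2 by rewrite (can_eq tuK).
have i21 : i2 != i1 by rewrite eq_sym.
have zi i : i != i1 -> i != i2 -> conf_pt i z = T (sg i) /\ (1 < sg i)%N.
  move=> ii1 ii2; split; first by rewrite sgE.
  rewrite -[i]sgK !(can_eq tuK) -!val_eqE /= in ii1 ii2.
  by rewrite ltn_neqAle eq_sym ii2 lt0n.
(* Only the two moving particles get nontrivial letters. *)
pose lab i := if i == i1 then g else if i == i2 then h else 1%g.
have labK i : (lab i * lab i = 1)%g.
  by rewrite /lab; case: eqP => // _; case: eqP => // _; rewrite mulg1.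
have openm t : at_mark a b m t -> open_edge a b t.
  by move=> [ta tb]; rewrite /open_edge ta tb m0.
have zm i : ~ at_mark a b m (conf_pt i z).
  have [->|ii1] := eqVneq i i1; first by rewrite -zi1.
  have [->|ii2] := eqVneq i i2; first by rewrite -zi2.
  have [-> si] := zi _ ii1 ii2.
  by have [_ nab _] := Ttail _ si => /openm.
have s_off t i : i != i1 -> i != i2 -> s t <> conf_pt i z.
  move=> ii1 ii2 e; have [zE si] := zi _ ii1 ii2; have [_ nab _] := Ttail _ si.
  by apply: nab; rewrite -zE -e.
have wq_off t i : i != i1 -> i != i2 -> wq t <> conf_pt i z.
  move=> ii1 ii2 e; have [zE si] := zi _ ii1 ii2; have [ovw _ _] := Ttail _ si.
  by apply: (wqt t); rewrite e zE.
have coc := cross_word_cocycle K_dim1 ab m0 m1 labK.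
have al_off t i : i != i2 -> al t <> conf_pt i z.
  move=> ii2; have [->|ii1] := eqVneq i i1; first by rewrite -zi1; exact: alp.
  by have [-> si] := zi _ ii1 ii2; have [] := alT _ si t.
have be_off t i : i != i1 -> be t <> conf_pt i z.
  move=> ii1; have [->|ii2] := eqVneq i i2; first by rewrite -zi2; exact: beq.
  by have [-> si] := zi _ ii1 ii2; have [_] := alT _ si t.
have sides : (coord b (conf_pt i1 z) < m) != (coord b (conf_pt i2 z) < m).
  by rewrite -zi1 -zi2 pm ltNge (ltW qm).
have [A hA nA] := orbit_loop K_dim1 ab m0 m1 labK zi1 zi2 i12
  al_off sd wqd s_off wq_off alm wqm zm sab sides.
(* The same construction with the two particles exchanged: [s] and [wq] run backwards, and [be] is
   the side step. *)
have [B hB nB] : exists2 B : {path I from z to z},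
    hol (cross_word a b m lab) B = lab i2 &
    forall j, j != i2 -> null_image (@conf_pt n Gamma j) B.
  apply: (orbit_loop K_dim1 ab m0 m1 labK (s := reverse s) (w := reverse wq) zi2 zi1 i21
    be_off _ _ _ _ bem _ zm _ _).
  - exact: (@reverse_values _ _ (fun t => t <> d)).
  - exact: (@reverse_values _ _ (fun t => t <> d)).
  - by move=> t i ii2 ii1; exact: s_off.
  - by move=> t i ii2 ii1; exact: wq_off.
  - exact: (@reverse_values _ _ (fun t => ~ at_mark a b m t)).
  - exact: (@reverse_values _ _ (open_edge a b)).
  - by rewrite eq_sym.
pose c := commg (homotopy_class A) (homotopy_class B).
have nc j : null_image (@conf_pt n Gamma j) (repr c).
  apply/null_image_pi1; rewrite homotopy_class_repr; apply: pi1_map_comm.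
  have [->|ji1] := eqVneq j i1.
    by right; apply/null_image_pi1; exact: nB.
  by left; apply/null_image_pi1; exact: nA.
(* The commutator lives at [z] and is carried back to the base point [x]; conjugation affects
   neither its triviality on strands nor the nontriviality of its holonomy. *)
pose L := concat pi (concat (repr c) (reverse pi)).
have Lker : kernel (@strand_map R n Gamma x) (homotopy_class L).
  apply/prod_groupP => j; apply/null_image_pi1; exact: (null_image_conj pi (nc j)).
move=> ker_eq; rewrite ker_eq in Lker.
have im1 k : range (@incl_map R n Gamma Gamma0 y x yx) k ->
    pi1_hol (cross_word a b m lab) k = 1%g.
  move=> [{}k _ <-]; rewrite /incl_map /pi1_map (pi1_holE coc).
  apply: hol_off => //; first exact: cts_fun.
  by move=> t i; apply: off0; exact: set_valP.
have := normal_closure_hol coc im1 Lker.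
rewrite (pi1_holE coc) !(hol_concat coc) (hol_reverse coc).
rewrite -[hol _ (repr c)]/(pi1_hol _ c) (pi1_hol_comm coc) !(pi1_holE coc) hA hB.
rewrite /lab !eqxx (negbTE i21) => e.
case: (commg_neq1 gh); apply: (mulgI (hol (cross_word a b m lab) pi)).
by apply: (mulIg (hol (cross_word a b m lab) pi)^-1%g); rewrite mulg1 mulgV -mulgA.
Qed.

End commutator.

(** * Compactness of polyhedra and closedness of subcomplexes *)

Section closed_subcomplex.
Variables (R : realType).

Lemma sum_fun_continuous (Y : topologicalType) (J : Type) (r : seq J) (f : J -> Y -> R) :
  (forall j, continuous (f j)) -> continuous (fun y => \sum_(j <- r) f j y).
Proof.
move=> cf; elim: r => [|j r IH].
  by under eq_fun do rewrite big_nil; exact: fun_cst_continuous.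
by under eq_fun do rewrite big_cons; exact: addr_fun_continuous.
Qed.

Lemma compact_seq_bigcup (J : eqType) (X : topologicalType) (r : seq J) (F : J -> set X) :
  (forall j, compact (F j)) -> compact [set t | exists2 j, j \in r & F j t].
Proof.
move=> cF; elim: r => [|j r IH].
  have -> : [set t | exists2 j, j \in [::] & F j t] = set0 by apply/seteqP; split=> // t [].
  exact: compact0.
have -> : [set t | exists2 i, i \in j :: r & F i t] =
    F j `|` [set t | exists2 j, j \in r & F j t].
  apply/seteqP; split=> t /=.
    by move=> [i]; rewrite in_cons => /predU1P[-> ?|ir ?]; [left|right; exists i].
  by move=> [jt|[i ir it]]; [exists j|exists i]; rewrite ?mem_head// in_cons ir orbT.
exact: compactU.
Qed.

Lemma compact_polyhedron (V : finType) (K : {set {set V}}) : compact (@polyhedron R V K).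
Proof.
have -> : @polyhedron R V K = [set t | exists2 s, s \in enum K & simplex s t] :> set _.
  by apply/seteqP; split=> t [s sK ts]; exists s; rewrite ?mem_enum// -mem_enum.
apply: (@compact_seq_bigcup {set V} {ptws V -> R} (enum K) (@simplex R V)) => s.
have -> : @simplex R V s = [set t | forall v, `[0, 1]%classic (t v)] `&`
    ([set t | \sum_v t v = 1] `&` \bigcap_(v in [set v | v \notin s]) [set t | t v = 0]).
  apply/seteqP; split=> t /=.
    move=> [t0 t1 ts]; split; last first.
      by split=> // v; apply: contraNeq; exact: ts.
    move=> v; rewrite /= in_itv /= t0 /= -t1 (bigD1 v)//= lerDl.
    by apply: sumr_ge0 => w _.
  move=> [ti [t1 ts]]; split=> // v; first by have := ti v; rewrite /= in_itv => /andP[].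
  by apply: contraNT => /ts ->.
have closed_at (f : {ptws V -> R} -> R) r : continuous f -> closed [set t | f t = r].
  move=> cf; apply: (@preimage_closed _ _ f [set r]) => [? _|]; first exact: cf.
  exact: closed_eq.
have cproj v : continuous (fun t : {ptws V -> R} => t v).
  exact: (@proj_continuous _ (fun=> R) v).
apply: compact_closedI.
  by apply: (@tychonoff V (fun=> R) (fun=> `[0, 1]%classic)) => v; exact: segment_compact.
apply: closedI.
  by apply: (closed_at (fun t => \sum_v t v)); exact: sum_fun_continuous.
by apply: closed_bigI => v _; exact: (closed_at (fun t => t v)).
Qed.

(** The subcomplex is the image of a compact polyhedron under a continuous map. Closedness yields
    the endpoints of an edge from its interior in [edge_in_closed], and the continuity of the arc
    parameter in [exists_arc]. *)
Lemma closed_subcomplex (V : finType) (K : {set {set V}}) (A : set (realization R K)) :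
  subcomplex_after_subdivision A -> closed A.
Proof.
move=> [W [L [L0 [p [_ _ _ _ AE]]]]].
have -> : A = (fun t : set_type (@polyhedron R V K) => \val t) @^-1`
    (affine_ext p @` polyhedron L0).
  rewrite -AE; apply/seteqP; split=> t /=; first by exists t.
  by move=> [t' At' /val_inj <-].
apply: preimage_closed => [t _|]; first exact: initial_continuous.
apply: compact_closed; first by apply: hausdorff_product => v; exact: Rhausdorff.
apply: continuous_compact; last exact: compact_polyhedron.
apply: continuous_subspaceT.
apply: fun_prod_continuous => v; apply: sum_fun_continuous => w.
apply: mulr_fun_continuous; last exact: fun_cst_continuous.
exact: (@proj_continuous _ (fun=> R) w).
Qed.

End closed_subcomplex.

(** * A circuit does not lie in a contractible set *)

Section mark_cocycle.
Variables (R : realType) (V : finType) (K : {set {set V}}).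
Hypothesis K_complex : simplicial_complex K.
Hypothesis K_dim1 : dimension K = 1%N.
Local Notation Gamma := (realization R K).
Local Notation I := (unitI R).
Variables (u v : V) (m : R).
Hypotheses (uv : u != v) (uvK : [set u; v]%SET \in K) (m0 : 0 < m) (m1 : m < 1).
Variables (G : groupType) (g : G).
Hypothesis gg : (g * g = 1)%g.

(** The counterpart of [cross_word_cocycle] for a single point moving on the graph. *)
Lemma cross_letter_cocycle : local_cocycle (cross_letter (K := K) u v m g).
Proof.
move=> y; have [my|my] := pselect (at_mark u v m y).
  exists [set x | open_edge u v x]; last by move=> *; exact: cross_letterM.
  by apply: nbhs_open_edge; rewrite /open_edge my.1 my.2.
have [U nU cU] := crosses_off K_dim1 uv m1 my; exists U => // a b d Ua Ub Ud.
by rewrite /cross_letter !cU// mulg1.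
Qed.

Lemma hol_letter_off (p : I -> Gamma) : continuous p ->
  (forall t, ~ at_mark u v m (p t)) -> hol (cross_letter u v m g) p = 1%g.
Proof.
move=> cp off; apply: hol_trivial => //; first exact: cross_letter_cocycle.
move=> t; have [U nU cU] := crosses_off K_dim1 uv m1 (off t); exists U => // a b Ua Ub.
by rewrite /cross_letter cU.
Qed.

Lemma hol_letter_cross (p : I -> Gamma) : continuous p ->
  (forall t, open_edge u v (p t)) ->
  (coord v (p zero) < m) != (coord v (p one) < m) -> hol (cross_letter u v m g) p = g.
Proof.
move=> cp op sides.
rewrite (@hol_global _ _ _ _ cross_letter_cocycle (open_edge u v))//.
  by rewrite /cross_letter /crosses !op sides.
by move=> *; exact: cross_letterM.
Qed.

(* An arc of a circuit that avoids the mark, closed up across the mark, is a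
   loop of nontrivial holonomy, hence not contained in a contractible set. *)
Lemma no_contractible_circuit (Gamma0 : set Gamma) (e : rel V) :
  g <> 1%g -> contractible R Gamma0 ->
  (forall x y, e x y -> [set x; y]%SET \in K) ->
  (forall x y, e x y -> [set x; y]%SET != [set u; v]%SET) ->
  (forall x y t, e x y -> simplex [set x; y]%SET (\val t) -> Gamma0 t) ->
  (forall t, simplex [set u; v]%SET (\val t) -> Gamma0 t) ->
  ~ connect e v u.
Proof.
move=> g1 c0 eK euv e0 uv0 vu; have [m0' m1'] := (m0, m1).
have uK := vertex_of_simplex K_complex uvK (set21 u v).
have vK := vertex_of_simplex K_complex uvK (set22 u v).
have [p [sp pu pv]] : exists t : Gamma, [/\ simplex [set u; v]%SET (\val t),
  coord u t = 1 - m / 2 & coord v t = m / 2] by apply: exists_edge_point => //; lra.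
have [q [sq qu qv]] : exists t : Gamma, [/\ simplex [set u; v]%SET (\val t),
  coord u t = 1 - (1 + m) / 2 & coord v t = (1 + m) / 2] by apply: exists_edge_point => //; lra.
have su : simplex [set u; v]%SET (\val (vtx R uK)) by apply: vtx_simplex; rewrite !inE eqxx.
have sv : simplex [set u; v]%SET (\val (vtx R vK)) by apply: vtx_simplex; rewrite !inE eqxx orbT.
have [s sE] := exists_segment uvK sp sq.
have [qb qbE] := exists_segment uvK sq sv.
have [ap apE] := exists_segment uvK su sp.
pose Q (t : Gamma) := Gamma0 t /\ ~ open_edge u v t.
have Qe x y t : e x y -> simplex [set x; y]%SET (\val t) -> Q t.
  move=> xy st; split; first exact: (e0 _ _ _ xy).
  by move/(simplex_open_edge uv st) => E; move: (euv _ _ xy); rewrite E eqxx.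
have Qv : Q (vtx R vK).
  split; first exact: uv0.
  by rewrite /open_edge !coord_vtx (negbTE uv) ltxx.
have [wk wkQ] := exists_walk K_complex eK Qe uK vu Qv.
pose ret := concat qb (concat wk ap).
have qb_m t : m < coord v (qb t).
  rewrite qbE coord_vtx eqxx qv; have /andP[t0 t1] := ival_itv t.
  have : 0 <= ival t * (1 - m) by rewrite mulr_ge0//; lra.
  by rewrite /=; lra.
have ap_m t : coord v (ap t) < m.
  rewrite apE coord_vtx [v == u]eq_sym (negbTE uv) pv mulr0 add0r.
  have /andP[t0 t1] := ival_itv t.
  apply: le_lt_trans (_ : m / 2 < m); last by lra.
  by rewrite ler_piMl//; lra.
pose P (t : Gamma) := Gamma0 t /\ ~ at_mark u v m t.
have retP t : P (ret t).
  move: t; apply: (concat_values (P := P)) => [t|].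
    split; first by apply: uv0; exact: segment_simplex sq sv (qbE t).
    by move=> [_ E]; have := qb_m t; rewrite E ltxx.
  apply: (concat_values (P := P)) => t; split.
  - by have [] := wkQ t.
  - by have [_ ho] := wkQ t => -[tu tv]; apply: ho; rewrite /open_edge tu tv.
  - by apply: uv0; exact: segment_simplex su sp (apE t).
  - by move=> [_ E]; have := ap_m t; rewrite E ltxx.
have s_uv t : open_edge u v (s t).
  by rewrite /open_edge !sE pu pv qu qv !convex_gt0//; lra.
pose L := concat s ret.
have L0 t : Gamma0 (L t).
  move: t; apply: (concat_values (P := Gamma0)) => t; last by have [] := retP t.
  by apply: uv0; exact: segment_simplex sp sq (sE t).
pose l t : Gamma0 := exist _ (L t) (mem_set (L0 t)).
have cl : continuous l by apply: subset_continuous; exact: cts_fun.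
pose p0 : Gamma0 := exist _ p (mem_set (uv0 _ sp)).
have l0 : l zero = p0 by apply: val_inj; rewrite /= path_zero.
have l1 : l one = p0 by apply: val_inj; rewrite /= path_one.
(* The null homotopy takes place in [Gamma0] and is pushed forward to [Gamma], where the cocycle is
   defined. *)
have [H [cH H0 H1 Hb]] := contractible_loop (mk_path cl l0 l1) c0.
have : homotopic L (cst p).
  exists (fun st => \val (H st)); split.
  - by apply: fun_comp_continuous cH _; exact: val_set_continuous.
  - by move=> t; rewrite H0.
  - by move=> t; rewrite H1.
  - by move=> r; have [-> ->] := Hb r.
move=> /(hol_homotopic cross_letter_cocycle).
have hr : hol (cross_letter u v m g) ret = 1%g.
  by apply: hol_letter_off => [|t]; [exact: cts_fun|have [] := retP t].
have hs : hol (cross_letter u v m g) s = g.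
  apply: hol_letter_cross => //; first exact: cts_fun.
  by rewrite path_zero path_one pv qv; apply/eqP; case: ltP; case: ltP => //; lra.
by rewrite (hol_concat cross_letter_cocycle) hr hs mulg1 (hol_cst R cross_letter_cocycle).
Qed.

End mark_cocycle.

Lemma closed_path_end (R : realType) (X : topologicalType) (A : set X) (a b : X)
    (p : {path unitI R from a to b}) : closed A ->
  (forall t, ival t < 1 -> A (p t)) -> A b.
Proof.
move=> cA pA; apply: contrapT => Ab.
have nb : nbhs (1 : R) [set r | ~ A (p (clamp r))].
  apply: (@path_clamp_continuous R X a b p 1 (~` A)).
  rewrite (clamp_ge1 (lexx 1)) path_one.
  by apply: open_nbhs_nbhs; split => //; exact: closed_openC.
have /nbhs_ballP[e /= e0 eb] := nb.
(* The bound [2^-1] keeps [r] inside the unit interval. *)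
pose r : R := 1 - Num.min (e / 2) 2^-1.
have d0 : 0 < Num.min (e / 2) 2^-1 by rewrite lt_min divr_gt0//=; lra.
have d1 : Num.min (e / 2) 2^-1 <= 2^-1 by rewrite ge_min lexx orbT.
have d2 : Num.min (e / 2) 2^-1 <= e / 2 by rewrite ge_min lexx.
apply: (eb r); last by apply: pA; rewrite ival_clamp max_l ?min_l /r; lra.
by rewrite /ball /= /r subKr ger0_norm; lra.
Qed.

(** * Circuits with one edge removed *)

Section circuit.
Variables (V : finType) (K : {set {set V}}) (c : seq V).
Hypotheses (c_cycle : ucycle (edge K) c) (c_size : (2 < size c)%N).

Definition cyc_edge (u v : V) : bool :=
  [&& u \in c, v \in c & (v == next c u) || (u == next c v)].

Lemma cyc_edge_sym : symmetric cyc_edge.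
Proof. by move=> u v; rewrite /cyc_edge andbCA orbC. Qed.

Lemma cyc_edge_next u : u \in c -> cyc_edge u (next c u).
Proof. by move=> uc; rewrite /cyc_edge mem_next uc eqxx. Qed.

Lemma edge_next u : u \in c -> edge K u (next c u).
Proof. by case/andP: c_cycle => cc _; exact: next_cycle. Qed.

Lemma cyc_edge_pair a b u v : cyc_edge a b -> [set a; b]%SET = [set u; v]%SET ->
  a != b -> cyc_edge u v.
Proof.
move=> cab abuv ab.
have : a \in [set u; v]%SET by rewrite -abuv !inE eqxx.
have : b \in [set u; v]%SET by rewrite -abuv !inE eqxx orbT.
rewrite !inE => /orP[]/eqP bE /orP[]/eqP aE; move: ab cab; rewrite aE bE ?eqxx//.
by rewrite cyc_edge_sym.
Qed.

Definition other_edges (x : V) : rel V := fun u v =>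
  [&& edge K u v, cyc_edge u v & [set u; v]%SET != [set x; next c x]%SET].

(** The vertex [x] occurs only at the very end, so no step departs from it. For a circuit rotated to
    start at [x], this says that the return does not use the edge leaving [x]. *)
Lemma path_rcons_neq (e : rel V) (x y : V) q : x \notin y :: q ->
  path e y (rcons q x) -> path (fun u v => e u v && (u != x)) y (rcons q x).
Proof.
elim: q y => [|z q IH] y /=; first by rewrite inE eq_sym => xy /andP[-> _]; rewrite xy.
rewrite inE negb_or => /andP[xy xq] /andP[-> zq].
by rewrite eq_sym xy IH.
Qed.

(** Starting at [next c x], the circuit visits all its vertices before it returns to [x]. A step
    from [z] distinct from [x] could use the removed edge only for [z = next c x] and
    [next c z = x], that is, in a circuit of two vertices, which [c_size] excludes. *)
Lemma other_edges_connect x u : x \in c -> u \in c -> connect (other_edges x) (next c x) u.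
Proof.
move=> xc uc; have /andP[cc cU] := c_cycle.
have [i q cE] := rot_to xc.
case: q cE => [|y q] cE.
  by move: c_size; rewrite -(size_rot i) cE.
have nE z : next c z = next [:: x, y & q] z by rewrite -cE next_rot.
have U : uniq [:: x, y & q] by rewrite -cE rot_uniq.
have yE : next c x = y by rewrite nE /= eqxx.
have mE z : (z \in c) = (z \in [:: x, y & q]) by rewrite -cE mem_rot.
have fc : cycle [rel z z' | next c z == z'] [:: x, y & q].
  rewrite (@eq_cycle _ _ [rel z z' | next [:: x, y & q] z == z']); first exact: cycle_next.
  by move=> z z'; rewrite /= nE.
have /= /andP[_ fp] := fc.
have xq : x \notin y :: q by have /= /andP[] := U.
have {}fp := path_rcons_neq xq fp.
have qn : q != [::].
  by apply/eqP => q0; move: c_size; rewrite -(size_rot i) cE q0.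
have op : path (other_edges x) y (rcons q x).
  apply: (@sub_in_path _ (mem c)) fp; last first.
    by apply/allP => z; rewrite -rcons_cons mem_rcons -mE.
  move=> z z' zc z'c /andP[/= /eqP zz' zx]; have ez := edge_next zc.
  rewrite /other_edges -zz' ez cyc_edge_next//=.
  apply/negP => /eqP E; have : next c z \in [set x; next c x]%SET by rewrite -E !inE eqxx orbT.
  have : z \in [set x; next c x]%SET by rewrite -E !inE eqxx.
  rewrite !inE (negbTE zx) /= => /eqP zy.
  move=> /orP[/eqP nx|/eqP e].
    move: nx; rewrite zy nE yE /= [y == x]eq_sym.
    have -> : x == y = false by apply/negP => /eqP xy; rewrite xy mem_head in xq.
    case: (q) qn xq => // z1 q1 _ xq1; rewrite /= eqxx => z1x.
    by rewrite -z1x !inE eqxx orbT in xq1.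
  by case/andP: ez; rewrite e -zy eqxx.
have : u \in y :: rcons q x by rewrite -rcons_cons mem_rcons -mE.
by rewrite yE; exact: path_connect op _.
Qed.

End circuit.

Section weakly_Goldberg_circuit.
Variables (R : realType) (V : finType) (K : {set {set V}}) (n : nat).
Hypothesis K_complex : simplicial_complex K.
Hypothesis K_dim1 : dimension K = 1%N.
Hypothesis K_connected : connected_graph K.
Hypothesis n_ge2 : (2 <= n)%N.
Local Notation Gamma := (realization R K).
Variables (c : seq V).
Hypotheses (c_cycle : ucycle (edge K) c) (c_size : (2 < size c)%N).

(** A point of the closed edge is the end of a segment from the midpoint. The earlier points of the
    segment are interior to the edge, hence in [A] since each mark is a single point. *)
Lemma edge_in_closed (A : set Gamma) (a b : V) : a != b -> [set a; b]%SET \in K -> closed A ->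
  (forall m, 0 < m < 1 -> exists2 t, A t & at_mark a b m t) ->
  forall t, simplex [set a; b]%SET (\val t) -> A t.
Proof.
move=> ab abK cA marks t st.
have [p [sp pa pb]] : exists t : Gamma, [/\ simplex [set a; b]%SET (\val t),
  coord a t = 1 - 2^-1 & coord b t = 2^-1] by apply: exists_edge_point => //; lra.
have [q qE] := exists_segment abK sp st.
apply: (closed_path_end (p := q)) => // r r1.
have r1' : 0 < 1 - ival r by rewrite subr_gt0.
have /andP[r0 _] := ival_itv r.
have qo x : 2^-1 <= coord x p -> 0 < coord x (q r).
  move=> x0; rewrite qE ltr_pwDl ?mulr_ge0 ?coord_ge0// mulr_gt0//.
  by apply: lt_le_trans x0; lra.
have qa : 0 < coord a (q r) by apply: qo; rewrite pa; lra.
have qb : 0 < coord b (q r) by apply: qo; rewrite pb.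
have qs := simplex_pair_sum ab (segment_simplex sp st (qE r)).
have [|t' At' mt'] := marks (coord b (q r)); first by lra.
have mq : at_mark a b (coord b (q r)) (q r) by [].
by rewrite (at_mark_inj K_dim1 ab qb mq mt').
Qed.

Lemma weakly_Goldberg_cyc_edge (x : conf n Gamma) : weakly_Goldberg x ->
  forall u w, u \in c -> edge K u w -> cyc_edge c u w.
Proof.
move=> [Gamma0 [y [yx [sub0 con0 ker0]]]] u w uc uw; apply: contrapT => ncyc.
have [G [g [h [gg hh gh]]]] := exists_noncommuting_involutions.
have g1 : g <> 1%g by move=> g1; apply: gh; rewrite g1 mulg1 mul1g.
have cl0 := closed_subcomplex sub0.
have nextP a : a \in c -> a != next c a /\ [set a; next c a]%SET \in K.
  by move=> ac; have /andP[] := edge_next c_cycle ac.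
(* If every mark on every edge of the circuit were met, the closed set [Gamma0] would contain the
   whole circuit, against its contractibility. *)
have [a [m [ac m01 off]]] : exists a m, [/\ a \in c, 0 < m < 1 &
    forall t, Gamma0 t -> ~ at_mark a (next c a) m t].
  apply: contrapT => noff.
  have full a : a \in c -> forall t, simplex [set a; next c a]%SET (\val t) -> Gamma0 t.
    move=> ac; have [an aK] := nextP _ ac; apply: edge_in_closed => // m m01.
    apply: contrapT => nt; apply: noff; exists a, m; split=> // t tG tm.
    by apply: nt; exists t.
  have [un uK] := nextP _ uc; have half0 : 0 < (2^-1 : R) by lra.
  have half1 : (2^-1 : R) < 1 by lra.
  apply: (@no_contractible_circuit R V K K_complex K_dim1 u (next c u) 2^-1 un uK half0 half1
    G g gg Gamma0 (other_edges K c u)) => //.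
  - by move=> a b /andP[/andP[]].
  - by move=> a b /and3P[].
  - move=> a b t /and3P[_ /and3P[ac bc /orP[]/eqP E] _]; rewrite E; first exact: full.
    by rewrite finset.setUC; exact: full.
  - exact: full.
  - exact: other_edges_connect.
have /andP[m0 m1] := m01; have [an aK] := nextP _ ac.
have /andP[uw' uwK] := uw.
have neq p q : cyc_edge c p q -> p != q -> [set p; q]%SET != [set u; w]%SET.
  by move=> pq pq'; apply/negP => /eqP E; apply: ncyc; exact: cyc_edge_pair pq E pq'.
(* The rest of the circuit joins both ends of the marked edge to [u] and does not use the attached
   edge [uw], which leaves that edge free for parking. *)
have sub_av : subrel (other_edges K c a) (avoiding K a (next c a) u w).
  move=> p q /and3P[pq cpq pqa]; rewrite /avoiding pq pqa neq//.
  by case/andP: pq.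
have nu : connect (avoiding K a (next c a) u w) (next c a) u.
  by apply: connect_sub (other_edges_connect c_cycle c_size ac uc) => p q /sub_av/connect1.
have na : connect (avoiding K a (next c a) u w) (next c a) a.
  by apply: connect_sub (other_edges_connect c_cycle c_size ac ac) => p q /sub_av/connect1.
apply: (kernel_not_normal_closure K_complex K_dim1 K_connected n_ge2 an aK uw' uwK
  (neq _ _ (cyc_edge_next ac) an) m0 m1 nu _ off ker0).
apply: connect_trans nu.
by rewrite (sym_connect_sym (@avoiding_sym _ _ _ _ _ _)).
Qed.

End weakly_Goldberg_circuit.

Section unit_interval_ivt.
Variable R : realType.

Lemma ivt_unitI (g : unitI R -> R) (s t : unitI R) (r : R) : continuous g ->
  g s <= r <= g t -> exists2 w, g w = r &
    Num.min (ival s) (ival t) <= ival w <= Num.max (ival s) (ival t).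
Proof.
move=> cg /andP[sr rt]; pose f (r : R) := g (clamp r).
have cf : continuous f by exact: fun_comp_continuous (@clamp_continuous R) cg.
have fE w : f (ival w) = g w by rewrite /f ivalK.
have bd : Num.min (f (ival s)) (f (ival t)) <= r <= Num.max (f (ival s)) (f (ival t)).
  by rewrite !fE ge_min le_max sr rt orbT.
have key (a b : R) : 0 <= a -> b <= 1 -> a <= b ->
    Num.min (f a) (f b) <= r <= Num.max (f a) (f b) -> exists2 w, g w = r & a <= ival w <= b.
  move=> a0 b1 ab /(IVT ab)[|w]; first by apply: continuous_subspaceT => ?; exact: cf.
  rewrite in_itv /= => /andP[aw wb] fw; exists (clamp w) => //.
  by rewrite ival_clamp max_l ?min_l ?aw ?wb//; lra.
have /andP[s0 s1] := ival_itv s; have /andP[t0 t1] := ival_itv t.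
have [st|ts] := leP (ival s) (ival t); first exact: key.
by apply: key => //; [exact: ltW|rewrite minC maxC].
Qed.

End unit_interval_ivt.

(** * The covering of the circle by the line *)

Section circle_covering.
Variable R : realType.
Local Notation I := (unitI R).
Local Notation S := (circle R).

Definition circ_x (z : S) : R :=
  (\val (z : set_type [set z : R * R | z.1 ^+ 2 + z.2 ^+ 2 = 1])).1.
Definition circ_y (z : S) : R :=
  (\val (z : set_type [set z : R * R | z.1 ^+ 2 + z.2 ^+ 2 = 1])).2.

Lemma circ_x_continuous : continuous circ_x.
Proof. by apply: fun_fst_continuous; exact: val_set_continuous. Qed.

Lemma circ_y_continuous : continuous circ_y.
Proof. by apply: fun_snd_continuous; exact: val_set_continuous. Qed.

Lemma circP (z : S) : circ_x z ^+ 2 + circ_y z ^+ 2 = 1.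
Proof. exact: (set_valP z). Qed.

Lemma circ_eq (z z' : S) : circ_x z = circ_x z' -> circ_y z = circ_y z' -> z = z'.
Proof.
move=> ex ey; apply: val_inj; rewrite [LHS]surjective_pairing [RHS]surjective_pairing.
by congr pair.
Qed.

Definition wrap (th : R) : S :=
  exist _ (cos (pi *+ 2 * th), sin (pi *+ 2 * th)) (mem_set (cos2Dsin2 (pi *+ 2 * th))).

Lemma circ_x_wrap th : circ_x (wrap th) = cos (pi *+ 2 * th).
Proof. by []. Qed.

Lemma circ_y_wrap th : circ_y (wrap th) = sin (pi *+ 2 * th).
Proof. by []. Qed.

Lemma wrap_continuous : continuous wrap.
Proof.
apply: subset_continuous; apply: fun_pair_continuous.
  apply: fun_comp_continuous (@continuous_cos R).
  by apply: mulr_fun_continuous; [exact: fun_cst_continuous|exact: fun_id_continuous].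
apply: fun_comp_continuous (@continuous_sin R).
by apply: mulr_fun_continuous; [exact: fun_cst_continuous|exact: fun_id_continuous].
Qed.

Lemma pi2_gt0 : 0 < pi *+ 2 :> R.
Proof. by rewrite pmulrn_lgt0 ?pi_gt0. Qed.

Lemma periodic_int (f : R -> R) (T : R) (k : int) (a : R) :
  (forall x, f (x + T) = f x) -> f (a + T *~ k) = f a.
Proof.
move=> fT; case: k => k; first by rewrite -pmulrn (periodicn fT).
by rewrite NegzE mulrNz -[in RHS](subrK (T *~ k.+1) a) -pmulrn (periodicn fT).
Qed.

Lemma wrap_int (a : R) (k : int) : wrap (a + k%:~R) = wrap a.
Proof.
apply: circ_eq; rewrite ?circ_x_wrap ?circ_y_wrap mulrDr mulrzr.
  by apply: periodic_int => x; exact: cosD2pi.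
by apply: periodic_int => x; exact: sinD2pi.
Qed.

(** Injectivity of [cos] settles fractional parts up to one half; the others are reflected by
    [1 - r]. *)
Lemma cos_eq1 (d : R) : cos (pi *+ 2 * d) = 1 -> d \is a Num.int.
Proof.
have small (r : R) : 0 <= r -> r <= 2^-1 -> cos (pi *+ 2 * r) = 1 -> r = 0.
  move=> r0 r1 cr; have : pi *+ 2 * r = 0.
    apply: (@cos_inj R); rewrite ?in_itv/= ?lexx ?pi_ge0//; last by rewrite cr cos0.
    rewrite -mulr_natr -mulrA mulr_ge0 ?pi_ge0 ?mulr_ge0//= -[leRHS]mulr1.
    by rewrite ler_pM2l ?pi_gt0//; lra.
  by move=> /eqP; rewrite mulf_eq0 gt_eqF ?pi2_gt0//= => /eqP.
move=> d1; pose k : int := Num.floor d; pose r := d - k%:~R.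
have r01 : 0 <= r < 1.
  rewrite subr_ge0 ltrBlDl; have := Num.Theory.floor_itv d.
  by rewrite intrD1.
have cr : cos (pi *+ 2 * r) = 1.
  have <- := @periodic_int cos (pi *+ 2) k (pi *+ 2 * r) (@cosD2pi R).
  by rewrite -mulrzr -mulrDr subrK.
suff r0 : r = 0 by apply/intrP; exists k; apply/eqP; rewrite -subr_eq0 -/r r0.
case/andP: r01 => r0 r1.
have [r2|r2] := leP r 2^-1; first exact: small.
have : 1 - r = 0.
  apply: small; [lra|lra|].
  by rewrite mulrBr mulr1 cosB cos2pi sin2pi mul0r addr0 mul1r.
by move=> e; move: r1; rewrite -subr_gt0 e ltxx.
Qed.

Lemma wrap_eqP (a b : R) : wrap a = wrap b <-> a - b \is a Num.int.
Proof.
split=> [e|/intrP[k e]]; last by rewrite -[a](subrK b) e addrC wrap_int.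
apply: cos_eq1; rewrite mulrBr cosB.
have ex : cos (pi *+ 2 * a) = cos (pi *+ 2 * b) by have := congr1 circ_x e.
have ey : sin (pi *+ 2 * a) = sin (pi *+ 2 * b) by have := congr1 circ_y e.
by rewrite ex ey -!expr2 cos2Dsin2.
Qed.

Lemma circ_x_itv (z : S) : -1 <= circ_x z <= 1.
Proof.
rewrite -ler_norml -(@ler_pXn2r _ 2)// ?nnegrE//.
by rewrite expr1n real_normK ?num_real// -(circP z) lerDl sqr_ge0.
Qed.

Lemma wrap_surj (z : S) : exists2 th, 0 <= th <= 1 & wrap th = z.
Proof.
have P := pi2_gt0; have Pn : pi *+ 2 != 0 :> R by rewrite gt_eqF.
have ac := acosK (_ : circ_x z \in `[(-1), 1]); rewrite in_itv /= in ac.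
have {ac} ac := ac (circ_x_itv z).
have acs : sin (acos (circ_x z)) = `|circ_y z|.
  by rewrite sin_acos ?circ_x_itv// -(circP z) [_ + circ_y z ^+ 2]addrC addrK sqrtr_sqr.
have a0 := acos_ge0 (circ_x_itv z); have api := acos_lepi (circ_x_itv z).
have api2 : acos (circ_x z) <= pi *+ 2 by rewrite (le_trans api)// mulr2n lerDl pi_ge0.
have [y0|y0] := leP 0 (circ_y z).
  exists (acos (circ_x z) / (pi *+ 2)).
    by rewrite divr_ge0 ?(ltW P)//= ler_pdivrMr// mul1r.
  apply: circ_eq; rewrite ?circ_x_wrap ?circ_y_wrap mulrC divfK//.
  by rewrite acs ger0_norm.
exists (1 - acos (circ_x z) / (pi *+ 2)).
  rewrite subr_ge0 ler_pdivrMr// mul1r api2 /= lerBlDl lerDr.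
  by rewrite divr_ge0 ?(ltW P).
apply: circ_eq; rewrite ?circ_x_wrap ?circ_y_wrap mulrBr mulr1 mulrCA divff// mulr1.
  by rewrite cosB cos2pi sin2pi mul0r addr0 mul1r.
by rewrite sinB cos2pi sin2pi mul0r mul1r sub0r acs ltr0_norm// opprK.
Qed.

Definition circ_dot (z z' : S) : R := circ_x z * circ_x z' + circ_y z * circ_y z'.
Definition circ_cross (z z' : S) : R := circ_x z * circ_y z' - circ_y z * circ_x z'.

(* The signed angle, in turns, between two points less than 60 degrees apart;
   the truncation makes it globally continuous. *)
Definition angle (z z' : S) : R :=
  asin (Num.max (- (9 / 10)) (Num.min (9 / 10) (circ_cross z z'))) / (pi *+ 2).

Lemma angle_continuous (Y : topologicalType) (f g : Y -> S) :
  continuous f -> continuous g -> continuous (fun y => angle (f y) (g y)).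
Proof.
move=> cf cg; apply: mulr_fun_continuous; last exact: fun_cst_continuous.
pose h y := Num.max (- (9 / 10)) (Num.min (9 / 10) (circ_cross (f y) (g y))).
have ch : continuous h.
  apply: maxr_continuous; first exact: fun_cst_continuous.
  apply: minr_continuous; first exact: fun_cst_continuous.
  apply: subr_fun_continuous; apply: mulr_fun_continuous.
  - exact: fun_comp_continuous cf circ_x_continuous.
  - exact: fun_comp_continuous cg circ_y_continuous.
  - exact: fun_comp_continuous cf circ_y_continuous.
  - exact: fun_comp_continuous cg circ_x_continuous.
move=> y; apply: (@continuous_comp _ _ _ h (@asin R)); first exact: ch.
apply: continuous_asin; rewrite /h lt_max gt_max gt_min; apply/andP; split.
  by apply/orP; left; lra.
by apply/andP; split; [lra|apply/orP; left; lra].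
Qed.

Lemma angle0 z : angle z z = 0.
Proof.
rewrite /angle /circ_cross [X in _ - X]mulrC subrr min_r ?max_r; [|lra|lra].
have -> : asin 0 = 0 :> R.
  have pp := @pi_ge0 R.
  by rewrite -[X in asin X]sin0 sinK// in_itv /= oppr_le0 divr_ge0.
by rewrite mul0r.
Qed.

Lemma dot_cross z z' : circ_dot z z' ^+ 2 + circ_cross z z' ^+ 2 = 1.
Proof.
rewrite -[RHS]mulr1 -{1}(circP z) -(circP z') /circ_dot /circ_cross.
rewrite !expr2; lra.
Qed.

Lemma wrap_angle (a : R) z z' : 2^-1 < circ_dot z z' -> wrap a = z -> wrap (a + angle z z') = z'.
Proof.
move=> dz wa; have dc := dot_cross z z'.
(* An inner product above 1/2 leaves at most 3/4 for the squared sine, which is below 81/100; so the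
   truncation in [angle] does not act here. *)
have c2 : circ_cross z z' ^+ 2 <= (9 / 10) ^+ 2.
  have : 2^-1 * 2^-1 <= circ_dot z z' ^+ 2 by rewrite expr2 ler_pM// ltW.
  by rewrite !expr2 in dc *; lra.
have /andP[c9 c9'] : - (9 / 10) <= circ_cross z z' <= 9 / 10.
  rewrite -ler_norml -(@ler_pXn2r _ 2)// ?nnegrE//.
  by rewrite real_normK ?num_real.
have c1 : -1 <= circ_cross z z' <= 1 by lra.
have E : pi *+ 2 * (a + angle z z') = pi *+ 2 * a + asin (circ_cross z z').
  rewrite mulrDr /angle min_r// max_r// [_ / _]mulrC mulrA divff ?mul1r//.
  by rewrite gt_eqF// pi2_gt0.
have sa : sin (asin (circ_cross z z')) = circ_cross z z' by rewrite asinK// in_itv.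
have ca : cos (asin (circ_cross z z')) = circ_dot z z'.
  by rewrite cos_asin// -dc addrK sqrtr_sqr ger0_norm//; lra.
have wx : cos (pi *+ 2 * a) = circ_x z by rewrite -wa.
have wy : sin (pi *+ 2 * a) = circ_y z by rewrite -wa.
have P := circP z.
apply: circ_eq; rewrite ?circ_x_wrap ?circ_y_wrap E.
  rewrite cosD sa ca wx wy /circ_dot /circ_cross -[RHS]mul1r -P !expr2; lra.
rewrite sinD sa ca wx wy /circ_dot /circ_cross -[RHS]mul1r -P !expr2; lra.
Qed.

End circle_covering.

(** * Lifting paths and homotopies *)

Section lifting.
Variable R : realType.
Local Notation I := (unitI R).
Local Notation S := (circle R).

Lemma circ_dot_near (F : R * R -> S) (q : R * R) : continuous F ->
  exists2 U, nbhs q U & forall q1 q2, U q1 -> U q2 -> 2^-1 < circ_dot (F q1) (F q2).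
Proof.
move=> cF; pose f (w : (R * R) * (R * R)) := circ_dot (F w.1) (F w.2).
have c1 : continuous (fun w : (R * R) * (R * R) => F w.1).
  apply: fun_comp_continuous cF; apply: fun_fst_continuous; exact: fun_id_continuous.
have c2 : continuous (fun w : (R * R) * (R * R) => F w.2).
  apply: fun_comp_continuous cF; apply: fun_snd_continuous; exact: fun_id_continuous.
have cf : continuous f.
  apply: addr_fun_continuous; apply: mulr_fun_continuous.
  - exact: fun_comp_continuous c1 (@circ_x_continuous R).
  - exact: fun_comp_continuous c2 (@circ_x_continuous R).
  - exact: fun_comp_continuous c1 (@circ_y_continuous R).
  - exact: fun_comp_continuous c2 (@circ_y_continuous R).
have [|[U1 U2] /= [n1 n2] U12] := cf (q, q) [set r | 2^-1 < r].
  apply: open_nbhs_nbhs; split; first exact: open_gt.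
  by rewrite /f /= /circ_dot -!expr2 circP; lra.
exists (U1 `&` U2); first exact: filterI.
by move=> q1 q2 [? _] [_ ?]; exact: (U12 (q1, q2)).
Qed.

(** The lift is one finite sum of angles, so its continuity needs no gluing. [P k] follows the path
    in the second variable and stops at time [x k]; consecutive [P k] are less than 60 degrees
    apart, and the last one is [H]. *)
Lemma lift_square (H : I * I -> S) (th : R) : continuous H ->
  (forall s, H (s, zero) = wrap th) ->
  exists T : I * I -> R, [/\ continuous T, forall s, T (s, zero) = th &
    forall q, wrap (T q) = H q].
Proof.
move=> cH H0; pose F (q : R * R) := H (clamp q.1, clamp q.2).
have cF : continuous F.
  apply: fun_comp_continuous cH; apply: fun_pair_continuous.
    apply: fun_comp_continuous (@clamp_continuous R).
    by apply: fun_fst_continuous; exact: fun_id_continuous.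
  apply: fun_comp_continuous (@clamp_continuous R).
  by apply: fun_snd_continuous; exact: fun_id_continuous.
have [||N /(_ N (leqnn N)) HN] := @lebesgue_box R (fun U => forall q1 q2, U q1 -> U q2 ->
    2^-1 < circ_dot (F q1) (F q2)).
- by move=> A B AB gB q1 q2 /AB ? /AB ?; exact: gB.
- by move=> q; exact: circ_dot_near.
pose x (k : nat) : R := k%:R / N.+1%:R.
pose P (k : nat) (q : I * I) : S := H (q.1, clamp (Num.min (ival q.2) (x k))).
have cP k : continuous (P k).
  apply: fun_comp_continuous cH; apply: fun_pair_continuous.
    by apply: fun_fst_continuous; exact: fun_id_continuous.
  apply: fun_comp_continuous (@clamp_continuous R).
  apply: minr_continuous; last exact: fun_cst_continuous.
  apply: fun_comp_continuous (@ival_continuous R).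
  by apply: fun_snd_continuous; exact: fun_id_continuous.
pose T j (q : I * I) := th + \sum_(0 <= k < j) angle (P k q) (P k.+1 q).
have x0 : x 0%N = 0 by rewrite /x mul0r.
have x1 : x N.+1 = 1 by rewrite /x divff.
have xge k : 0 <= x k by rewrite divr_ge0.
have wT j q : (j <= N.+1)%N -> wrap (T j q) = P j q.
  elim: j => [|j IH] jN.
    rewrite /T big_geq// addr0 /P x0 min_r; last by have /andP[] := ival_itv q.2.
    by rewrite -(H0 q.1) (clamp_le0 (lexx 0)).
  rewrite /T big_nat_recr//= addrA -/(T j q); apply: wrap_angle; last exact: IH (ltnW jN).
  have /andP[q0 q1] := ival_itv q.2.
  pose y k := Num.min (ival q.2) (x k).
  have FP k : P k q = F (ival q.1, y k) by rewrite /F /= ivalK.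
  have xS : x j.+1 = x j + N.+1%:R^-1 by rewrite /x -natr1 mulrDl mul1r.
  have N0 : 0 <= N.+1%:R^-1 :> R by rewrite invr_ge0.
  rewrite !FP; apply: (HN (ival q.1, y j)) => /=.
  - exact: ival_itv.
  - by rewrite /y le_min q0 xge /= ge_min q1.
  - by rewrite !subrr normr0.
  - split; first by rewrite subrr normr0.
    rewrite /y xS; set e := N.+1%:R^-1 in N0 *.
    rewrite ler_norml; have [h1|h1] := leP (ival q.2) (x j);
      have [h2|h2] := leP (ival q.2) (x j + e); clear -N0 h1 h2; lra.
exists (T N.+1); split.
- apply: addr_fun_continuous; first exact: fun_cst_continuous.
  apply: (@sum_fun_continuous R (I * I)%type nat (index_iota 0 N.+1)
    (fun k q => angle (P k q) (P k.+1 q))) => k.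
  exact: angle_continuous.
- move=> s; rewrite /T big1 ?addr0// => k _.
  by rewrite /P /= ival0 !min_l// angle0.
- move=> [s t]; rewrite wT// /P /= x1 min_l ?ivalK//.
  by have /andP[] := ival_itv t.
Qed.

Lemma path_lift (f : I -> S) (th : R) : continuous f -> f zero = wrap th ->
  exists T : I -> R, [/\ continuous T, T zero = th & forall t, wrap (T t) = f t].
Proof.
move=> cf f0.
have [|T [cT T0 wT]] := lift_square (path_square cf) (th := th); first by [].
exists (fun t => T (zero, t)); split; [|exact: T0|by move=> t; exact: wT].
apply: fun_comp_continuous cT; apply: fun_pair_continuous.
  exact: cst_continuous.
exact: fun_id_continuous.
Qed.

(** By the intermediate value theorem, a convex combination of two values of [g] is again a value of
    [g]. *)
Lemma gap_convex (g : I -> R) : continuous g -> (forall t, g t \isn't a Num.int) ->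
  forall s t (r : R), 0 <= r <= 1 -> (1 - r) * g s + r * g t \isn't a Num.int.
Proof.
move=> cg gint s t r r01; set v := _ + _.
have [w <- //] : exists w, g w = v.
have [st|ts] := leP (g s) (g t).
  by have [w wE _] := ivt_unitI cg (convex_itv r01 st); exists w.
have r01' : 0 <= 1 - r <= 1 by lra.
have [w wE _] := ivt_unitI cg (convex_itv r01' (ltW ts)).
by exists w; rewrite wE /v subKr addrC.
Qed.

Lemma wrap_const (g : I -> R) : continuous g -> (forall t, wrap (g t) = wrap (g zero)) ->
  forall t, g t = g zero.
Proof.
move=> cg wg.
have le0 (g' : I -> R) t : continuous g' -> (forall t, g' t - g' zero \is a Num.int) ->
    g' t <= g' zero.
  move=> cg' ig; rewrite leNgt; apply/negP => lt0.
  (* If [g'] increased, it would attain [g' zero + d] with [d] positive and at most one half, hence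
     not an integer. *)
  pose d := Num.min (g' t - g' zero) 2^-1.
  have d0 : 0 < d by rewrite lt_min subr_gt0 lt0 /=; lra.
  have d1 : d <= 2^-1 by rewrite ge_min lexx orbT.
  have d2 : d <= g' t - g' zero by rewrite ge_min lexx.
  have [|w wE _] := @ivt_unitI _ g' zero t (g' zero + d) cg'; first by lra.
  have /intrP[k kE] := ig w; have dk : d = k%:~R by rewrite -kE wE addrC addKr.
  move: d0 d1; rewrite dk ltr0z => k0 k1.
  have : (1 : R) <= k%:~R by rewrite ler1z.
  by lra.
move=> t; apply/le_anti/andP; split.
  by apply: le0 => // t'; apply/wrap_eqP.
rewrite -lerN2; apply: (le0 (fun t => - g t)).
  by move=> y; apply: continuousN; exact: cg.
by move=> t'; rewrite -opprD rpredN; apply/wrap_eqP.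
Qed.

(** At the end of the null homotopy the lifted path is constant, and during the homotopy its
    endpoint covers [z] throughout, so [wrap_const] keeps it fixed. Hence the lift of [p] is
    closed. *)
Lemma null_loop_lift (z : S) (p : {path I from z to z}) (th : R) : wrap th = z ->
  homotopic p (cst z) -> exists T : I -> R,
    [/\ continuous T, T zero = th, T one = th & forall t, wrap (T t) = p t].
Proof.
move=> wz [H [cH H0 H1 Hb]].
have [|T [cT T0 wT]] := lift_square cH (th := th).
  by move=> s; rewrite wz; have [] := Hb s.
have cfst t : continuous (fun s => T (s, t)).
  apply: fun_comp_continuous cT; apply: fun_pair_continuous.
    exact: fun_id_continuous.
  exact: cst_continuous.
have csnd s : continuous (fun t => T (s, t)).
  apply: fun_comp_continuous cT; apply: fun_pair_continuous.
    exact: cst_continuous.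
  exact: fun_id_continuous.
exists (fun t => T (zero, t)); split=> // [|t]; last by rewrite wT H0.
rewrite -(@wrap_const (fun s => T (s, one)) (cfst one) _ one) => [|s]; last first.
  by rewrite !wT (Hb s).2 (Hb zero).2.
rewrite (@wrap_const (fun t => T (one, t)) (csnd one) _ one) ?T0// => t.
by rewrite !wT !H1.
Qed.

End lifting.

(** * Circuits that are circles *)

Section compact_quotient.
Variables (R : realType) (J : finType).
Local Notation I := (unitI R).

Lemma compact_unitI : compact [set: I].
Proof.
have -> : [set: I] = (@clamp R) @` `[0, 1]%classic.
  apply/seteqP; split=> // t _; exists (ival t); last exact: ivalK.
  by rewrite /= in_itv /= ival_itv.
apply: continuous_compact; last exact: segment_compact.
by apply: continuous_subspaceT; exact: clamp_continuous.
Qed.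

(** The preimage of a closed set is a finite union of images of compact sets, which are closed in a
    Hausdorff space. *)
Lemma quotient_map_continuous (X Y : topologicalType) (g : J -> I -> X) (h : J -> I -> Y)
    (f : X -> Y) :
  hausdorff_space X -> (forall j, continuous (g j)) -> (forall j, continuous (h j)) ->
  (forall x, exists j t, g j t = x) -> (forall j t, f (g j t) = h j t) -> continuous f.
Proof.
move=> hX cg ch gs fE; apply/continuous_closedP => D cD.
have -> : f @^-1` D = \bigcup_(j in setT) (g j @` (h j @^-1` D)).
  apply/seteqP; split=> [x /= Dx|x [j _ [t /= Dt <-]]]; last by rewrite /= fE.
  by have [j [t e]] := gs x; exists j => //; exists t => //=; rewrite -fE e.
apply: closed_bigcup => [|j _]; first exact: finite_finset.
apply: compact_closed => //; apply: continuous_compact.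
  by apply: continuous_subspaceT; exact: cg.
apply: (subclosed_compact _ compact_unitI) => //.
by apply: preimage_closed cD => ? _; exact: ch.
Qed.

(** A continuous map from a compact space onto a Hausdorff space is a quotient map, so both spaces
    are the quotient of finitely many intervals by the same relation. *)
Lemma quotient_homeomorphic (X Y : topologicalType) (g : J -> I -> X) (h : J -> I -> Y) :
  hausdorff_space X -> hausdorff_space Y ->
  (forall j, continuous (g j)) -> (forall j, continuous (h j)) ->
  (forall x, exists j t, g j t = x) -> (forall y, exists j t, h j t = y) ->
  (forall i j s t, g i s = g j t <-> h i s = h j t) -> homeomorphic X Y.
Proof.
move=> hX hY cg ch gs hs gh.
have /choice[f fE] x : exists y, forall j t, g j t = x -> h j t = y.
  have [j [t e]] := gs x; exists (h j t) => i s; rewrite -e.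
  by move/gh.
have /choice[f' f'E] y : exists x, forall j t, h j t = y -> g j t = x.
  have [j [t e]] := hs y; exists (g j t) => i s; rewrite -e.
  by move/gh.
have fg j t : f (g j t) = h j t by rewrite (fE (g j t) j t).
have f'h j t : f' (h j t) = g j t by rewrite (f'E (h j t) j t).
exists f, f'; split.
- exact: (quotient_map_continuous hX cg ch gs fg).
- exact: (quotient_map_continuous hY ch cg hs f'h).
- by move=> x; have [j [t <-]] := gs x; rewrite fg f'h.
- by move=> y; have [j [t <-]] := hs y; rewrite f'h fg.
Qed.

End compact_quotient.

Lemma circle_hausdorff (R : realType) : hausdorff_space (circle R).
Proof.
move=> a b ab; apply: circ_eq; apply: (@Rhausdorff R) => A B nA nB.
  have [t [tA tB]] := ab _ _ (@circ_x_continuous R a A nA) (@circ_x_continuous R b B nB).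
  by exists (circ_x t).
have [t [tA tB]] := ab _ _ (@circ_y_continuous R a A nA) (@circ_y_continuous R b B nB).
by exists (circ_y t).
Qed.

Section circuit_homeomorphic_circle.
Variables (R : realType) (V : finType) (K : {set {set V}}).
Hypothesis K_complex : simplicial_complex K.
Hypothesis K_dim1 : dimension K = 1%N.
Hypothesis K_connected : connected_graph K.
Local Notation Gamma := (realization R K).
Local Notation I := (unitI R).
Variables (c : seq V).
Hypotheses (c_cycle : ucycle (edge K) c) (c_size : (2 < size c)%N).
Hypothesis c_all : forall u w, u \in c -> edge K u w -> cyc_edge c u w.
Variables (v0 : V).
Local Notation k := (size c).
Local Notation pt := (nth v0 c).

Let k_gt0 : (0 < k)%N. Proof. exact: ltn_trans c_size. Qed.

Lemma next_nth_mod (i : nat) : (i < k)%N -> next c (pt i) = pt (i.+1 %% k).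
Proof.
have /andP[_ cU] := c_cycle => ik; rewrite next_nth mem_nth// index_uniq//.
case: (c) cU ik => // y p cU /= ik.
move: ik; rewrite ltnS leq_eqVlt => /predU1P[->|ip].
  by rewrite nth_default// modnn.
by rewrite modn_small// ?ltnS//= (set_nth_default v0).
Qed.

Definition succ_mod (i : 'I_k) : 'I_k := Ordinal (ltn_pmod i.+1 k_gt0).

Lemma pt_in (i : 'I_k) : pt i \in c.
Proof. exact: mem_nth. Qed.

Lemma next_pt (i : 'I_k) : next c (pt i) = pt (succ_mod i).
Proof. exact: next_nth_mod. Qed.

Lemma pt_eq (i j : 'I_k) : (pt i == pt j) = (i == j).
Proof. by have /andP[_ cU] := c_cycle; rewrite nth_uniq. Qed.

Lemma edge_pt (i : 'I_k) : edge K (pt i) (pt (succ_mod i)).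
Proof. by rewrite -next_pt; apply: (edge_next c_cycle); exact: pt_in. Qed.

Lemma pt_vertex (i : 'I_k) : [set pt i]%SET \in K.
Proof.
by have /andP[_ eK] := edge_pt i; apply: (vertex_of_simplex K_complex eK); exact: set21.
Qed.

(** By [c_all] a walk that starts on the circuit never leaves it. *)
Lemma in_circuit u : [set u]%SET \in K -> u \in c.
Proof.
move=> uK; have := K_connected (pt_vertex (Ordinal k_gt0)) uK.
move=> /connectP[p pp ->]; elim: p (pt _) pp (pt_in (Ordinal k_gt0)) => //= w p IH y.
by move=> /andP[yw wp] yc; apply: IH => //; have /and3P[] := c_all yc yw.
Qed.

Lemma exists_circuit_edge (i : 'I_k) : exists q : I -> Gamma, continuous q /\
  forall r v, coord v (q r) =
    (1 - ival r) * (v == pt i)%:R + ival r * (v == pt (succ_mod i))%:R.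
Proof.
have /andP[_ eK] := edge_pt i.
have [||q qE] := exists_segment (a := vtx R (pt_vertex i)) (b := vtx R (pt_vertex (succ_mod i))) eK.
- by apply: vtx_simplex; rewrite !inE eqxx.
- by apply: vtx_simplex; rewrite !inE eqxx orbT.
by exists q; split => //; exact: cts_fun.
Qed.

(** The relation that glues the intervals end to end into a cycle. Both the edges of the circuit and
    the arcs of the circle induce it. *)
Definition same_point (i j : 'I_k) (s t : I) : Prop :=
  [\/ i = j /\ s = t, [/\ s = one, t = zero & j = succ_mod i] |
      [/\ s = zero, t = one & i = succ_mod j]].

Lemma succ_mod_neq i : succ_mod i != i.
Proof.
by have /andP[] := edge_pt i; rewrite pt_eq eq_sym.
Qed.

(** In a circuit of two vertices the two edges would share both ends; [c_size] rules this out. *)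
Lemma succ_mod2_neq i : succ_mod (succ_mod i) != i.
Proof.
rewrite -val_eqE /= -[(i.+1 %% k).+1]addn1 modnDml addn1; apply/negP => /eqP e.
have := ltn_ord i; have [ik|ki] := ltnP i.+2 k.
  by move: e; rewrite modn_small// => /eqP; rewrite -addn2 -[X in _ == X]addn0 eqn_add2l.
move=> ik; have e2 : i.+2 = (i.+2 - k + k)%N by rewrite subnK.
move: e; rewrite e2 modnDr modn_small; last by lia.
by have := c_size; lia.
Qed.

Lemma succ_mod_inj : injective succ_mod.
Proof.
move=> i j /(congr1 val) /= e; apply: val_inj => /=.
move: (ltn_ord i) (ltn_ord j) => ik jk.
have := e; rewrite -[i.+1]addn1 -[j.+1]addn1 => /eqP; rewrite eqn_modDr => /eqP.
by rewrite !modn_small.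
Qed.

Lemma circuit_edge_eq (q : 'I_k -> I -> Gamma) :
  (forall i r v, coord v (q i r) =
    (1 - ival r) * (v == pt i)%:R + ival r * (v == pt (succ_mod i))%:R) ->
  forall i j s t, q i s = q j t <-> same_point i j s t.
Proof.
move=> qE i j s t.
have qi (l m : 'I_k) r : coord (pt l) (q m r) =
    (1 - ival r) * (l == m)%:R + ival r * (l == succ_mod m)%:R by rewrite qE !pt_eq.
split; last first.
  case=> [[-> ->]//|[-> -> ->]|[-> -> ->]]; apply: coordP => v;
    by rewrite !qE !ival1 !ival0 !(subrr, subr0, mul0r, mul1r, add0r, addr0).
move=> E; have [ij|ij] := eqVneq i j.
  subst j; constructor 1; split=> //; apply: ival_inj.
  have := congr1 (coord (pt (succ_mod i))) E.
  by rewrite !qi eqxx (negbTE (succ_mod_neq i)) !mulr0 !add0r !mulr1.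
(* For distinct edges, compare the coordinates at both start vertices: [1 - ival s] vanishes unless
   edge [j] ends where edge [i] starts, and symmetrically. *)
have Ei := congr1 (coord (pt i)) E; have Ej := congr1 (coord (pt j)) E.
rewrite !qi eqxx [i == succ_mod i]eq_sym (negbTE (succ_mod_neq _)) (negbTE ij) in Ei.
rewrite !qi eqxx [j == succ_mod j]eq_sym (negbTE (succ_mod_neq _)) [j == i]eq_sym (negbTE ij) in Ej.
rewrite !(mulr0, mulr1, addr0, add0r) in Ei Ej.
have ione (r : I) : 1 - ival r = 0 -> r = one.
  by move=> r1; apply: ival_inj; rewrite ival1; lra.
have izero (r : I) : ival r = 0 -> r = zero.
  by move=> r0; apply: ival_inj; rewrite ival0.
move: Ei Ej; have [ij'|ij'] := eqVneq i (succ_mod j); have [ji|ji] := eqVneq j (succ_mod i).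
- by have := succ_mod2_neq i; rewrite -ji -ij' eqxx.
- rewrite mulr1 mulr0 => Ei /esym/ione t1; constructor 3; split=> //.
  by apply: izero; rewrite t1 ival1 in Ei; lra.
- rewrite mulr0 mulr1 => /ione s1 Ej; constructor 2; split=> //.
  by apply: izero; rewrite s1 ival1 in Ej; lra.
- rewrite !mulr0 => /ione s1 /esym/ione t1.
  have := congr1 (coord (pt (succ_mod i))) E.
  rewrite !qi s1 t1 !ival1 eqxx subrr !mul0r !mul1r !add0r.
  by rewrite (inj_eq succ_mod_inj) (negbTE ij) => /eqP; rewrite oner_eq0.
Qed.

Lemma wrap_eq (i j : 'I_k) (s t : I) :
  wrap ((i%:R + ival s) / k%:R) = wrap ((j%:R + ival t) / k%:R) <-> same_point i j s t.
Proof.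
have /andP[s0 s1] := ival_itv s; have /andP[t0 t1] := ival_itv t.
have kp : 0 < k%:R :> R by rewrite ltr0n.
have kn : k%:R != 0 :> R by rewrite gt_eqF.
have succE (l : 'I_k) : (succ_mod l = l.+1 :> nat) \/ (l.+1 = k /\ succ_mod l = 0%N :> nat).
  have := ltn_ord l; rewrite leq_eqVlt => /predU1P[lk|lk].
    by right; rewrite /= lk modnn.
  by left; rewrite /= modn_small.
have wrap_succ (l : 'I_k) : wrap ((l%:R + 1) / k%:R) = wrap ((succ_mod l)%:R / k%:R) :> circle R.
  have [->|[lk ->]] := succE l; first by rewrite -natr1.
  rewrite natr1 lk divff// mul0r.
  by apply/wrap_eqP; rewrite subr0.
split; last first.
  case=> [[-> ->]//|[-> -> ->]|[-> -> ->]]; rewrite ival1 ival0 addr0; first exact: wrap_succ.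
  exact/esym/wrap_succ.
move=> /wrap_eqP/intrP[m]; rewrite -mulrBl => /(congr1 (fun r => r * k%:R)).
rewrite divfK// => mE.
have ik : i%:R <= k%:R - 1 :> R by rewrite lerBrDr natr1 ler_nat.
have jk : j%:R <= k%:R - 1 :> R by rewrite lerBrDr natr1 ler_nat.
have i0 : 0 <= i%:R :> R by []. have j0 : 0 <= j%:R :> R by [].
have ione (r : I) : 1 <= ival r -> r = one.
  by have /andP[_ ?] := ival_itv r => r1; apply: ival_inj; rewrite ival1; lra.
have izero (r : I) : ival r <= 0 -> r = zero.
  by have /andP[? _] := ival_itv r => r1; apply: ival_inj; rewrite ival0; lra.
have key (a b : 'I_k) (x y : I) : a%:R + ival x = b%:R + ival y -> (a < b)%N ->
    [/\ x = one, y = zero & b = succ_mod a].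
  move=> e ab; have /andP[x0 x1] := ival_itv x; have /andP[y0 y1] := ival_itv y.
  have ab1 : a%:R + 1 <= b%:R :> R by rewrite natr1 ler_nat.
  have x1' : x = one by apply: ione; lra.
  have y0' : y = zero by apply: izero; lra.
  split=> //; apply: ord_inj; rewrite /= modn_small; last exact: leq_ltn_trans ab (ltn_ord b).
  move: e; rewrite x1' y0' ival1 ival0 addr0 natr1 => /eqP; rewrite eqr_nat => /eqP ->.
  by [].
have wraparound (a b : 'I_k) (x y : I) : a%:R + ival x = b%:R + ival y + k%:R ->
    [/\ x = one, y = zero & b = succ_mod a].
  move=> e; have /andP[x0 x1] := ival_itv x; have /andP[y0 y1] := ival_itv y.
  have ak : a%:R <= k%:R - 1 :> R by rewrite lerBrDr natr1 ler_nat.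
  have b0 : 0 <= b%:R :> R by [].
  have x1' : x = one by apply: ione; lra.
  have y0' : y = zero by apply: izero; lra.
  have ak' : a%:R + 1 = k%:R :> R by lra.
  have bz : b%:R = 0 :> R by lra.
  split=> //; apply: ord_inj => /=; move/eqP: ak'; rewrite natr1 eqr_nat => /eqP ->.
  by move/eqP: bz; rewrite pnatr_eq0 modnn => /eqP.
(* Both positions lie between 0 and [k], so their difference [m * k] allows only these values; the
   outer two are the passage from the last arc to the first. *)
have [m1|[m0|m1]] : m = 1 \/ m = 0 \/ m = -1.
  have h1 : (-1)%:~R * k%:R <= m%:~R * k%:R :> R by rewrite -mE; lra.
  have h2 : m%:~R * k%:R <= 1%:~R * k%:R :> R by rewrite -mE; lra.
  by move: h1 h2; rewrite !ler_pM2r// !ler_int; lia.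
- by constructor 2; apply: wraparound; rewrite m1 in mE; lra.
- have {}mE : i%:R + ival s = j%:R + ival t by rewrite m0 mul0r in mE; lra.
  have [ij|ji|ij] := ltngtP i j.
  + by constructor 2; apply: key.
  + by have [-> -> ->] := key _ _ _ _ (esym mE) ji; constructor 3.
  + constructor 1; split; first exact: ord_inj.
    by apply: ival_inj; rewrite ij in mE; lra.
- have [-> -> ->] : [/\ t = one, s = zero & i = succ_mod j].
    by apply: wraparound; rewrite m1 in mE; lra.
  by constructor 3.
Qed.

Lemma circuit_homeomorphic_circle : homeomorphic Gamma (circle R).
Proof.
have /choice[q qP] := exists_circuit_edge.
have qE i := (qP i).2.
apply: (@quotient_homeomorphic R 'I_k _ _ q (fun j s => wrap ((j%:R + ival s) / k%:R))).
- exact: real_hausdorff.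
- exact: circle_hausdorff.
- by move=> i; exact: (qP i).1.
- move=> j; apply: fun_comp_continuous (@wrap_continuous R).
  apply: mulr_fun_continuous; last exact: fun_cst_continuous.
  apply: addr_fun_continuous; first exact: fun_cst_continuous.
  exact: ival_continuous.
- move=> t; have [u tu uK] := exists_vertex K_complex t.
  have uc := in_circuit uK.
  have ptP w : w \in c -> exists i : 'I_k, pt i = w.
    move=> wc; have wk : (index w c < k)%N by rewrite index_mem.
    by exists (Ordinal wk); rewrite /= nth_index.
  have two (i : 'I_k) : (forall w, w != pt i -> w != pt (succ_mod i) -> coord w t = 0) ->
      coord (pt i) t + coord (pt (succ_mod i)) t = 1 -> q i (clamp (coord (pt (succ_mod i)) t)) = t.
    move=> others t1; apply: coordP => w; rewrite qE ival_clamp max_l ?coord_ge0//.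
    have nn := succ_mod_neq i.
    rewrite min_l; last by have := coord_ge0 (pt i) t; lra.
    have [->|wi] := eqVneq w (pt i).
      by rewrite pt_eq [i == _]eq_sym (negbTE nn) mulr1 mulr0 addr0; lra.
    have [->|ws] := eqVneq w (pt (succ_mod i)); first by rewrite mulr0 add0r mulr1.
    by rewrite !mulr0 addr0 others.
  (* A point inside an edge lies on a circuit edge, traversed in one of the two directions;
     otherwise the point is the vertex [u]. *)
  have [[w [wu tw]]|none] := pselect (exists w, w != u /\ coord w t != 0).
    have uw : u != w by rewrite eq_sym.
    have [uwK uw1 others] := two_coords K_dim1 uw tu tw.
    have euw : edge K u w by rewrite /edge uw uwK.
    have /and3P[_ wc /orP[/eqP wE|/eqP uE]] := c_all uc euw.
      have [i iE] := ptP _ uc; exists i, (clamp (coord w t)).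
      by rewrite wE -iE next_pt; apply: two; rewrite -next_pt iE -wE.
    have [i iE] := ptP _ wc; exists i, (clamp (coord u t)).
    rewrite uE -iE next_pt; apply: two; rewrite -next_pt iE -uE; last by rewrite addrC.
    by move=> y yw yu; exact: others.
  have zero_others w : w != u -> coord w t = 0.
    by move=> wu; apply/eqP; apply: contrapT => /negP tw; apply: none; exists w.
  have [i iE] := ptP _ uc.
  have nn : pt (succ_mod i) != u by rewrite -iE pt_eq succ_mod_neq.
  exists i, (clamp (coord (pt (succ_mod i)) t)); apply: two.
    by move=> w; rewrite iE => wu _; exact: zero_others.
  rewrite (zero_others _ nn) addr0 iE -(sum_coord t) (bigD1 u)//= big1 ?addr0//.
- move=> z; have [th /andP[th0 th1] <-] := wrap_surj z.
  have kp : 0 < k%:R :> R by rewrite ltr0n.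
  have [j [jk /andP[j0 j1]]] : exists j : nat, (j < k)%N /\ j%:R <= th * k%:R <= j%:R + 1.
    have : 0 <= th * k%:R <= k%:R by rewrite mulr_ge0//= ler_piMl.
    move: (th * k%:R) => y; elim: (k) k_gt0 => // l IH _ /andP[y0 yl].
    have [yl'|yl'] := leP y l%:R; last by exists l; rewrite ltnSn natr1 (ltW yl').
    case: l IH yl yl' => [|l] IH yl yl'.
      by exists 0%N; split=> //; rewrite y0 add0r (le_trans yl').
    by have [//||j [jl jy]] := IH; [rewrite y0|exists j; split => //; exact: ltnW].
  exists (Ordinal jk), (clamp (th * k%:R - j%:R)); congr wrap.
  rewrite ival_clamp max_l ?min_l; [|lra..].
  by rewrite addrC subrK mulfK// gt_eqF.
- by move=> i j s t; rewrite circuit_edge_eq// wrap_eq.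
Qed.

End circuit_homeomorphic_circle.

(** * Circles are Goldberg *)

Section edge_subdivision.
Variables (R : realType) (V : finType) (K : {set {set V}}).
Hypothesis K_complex : simplicial_complex K.
Hypothesis K_dim1 : dimension K = 1%N.
Variables (u v : V) (l : R).
Hypotheses (uv : u != v) (uvK : [set u; v]%SET \in K) (l0 : 0 < l) (l1 : l < 1).

Definition old_vertices (r : {set option V}) : {set V} := [set x | Some x \in r]%SET.

(* None is the new vertex, placed inside the edge uv. *)
Definition subdivided : {set {set option V}} :=
  [set r | (old_vertices r != [set u; v]%SET) &&
    (if None \in r then old_vertices r \subset [set u; v]%SET else old_vertices r \in K)]%SET.

(** This drops the segment between [u] and the new vertex. Its interior is the open arc to be cut
    out, the complement of [cut_set]. *)
Definition cut_complex : {set {set option V}} :=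
  [set r in subdivided | ~~ ((None \in r) && (Some u \in r))]%SET.

Definition new_weight (x : V) : R := (1 - l) * (x == u)%:R + l * (x == v)%:R.

Definition placement (w : option V) : {ptws V -> R} :=
  if w is Some y then fun x => (x == y)%:R else new_weight.

Lemma old_vertices_sub (r r' : {set option V}) : r' \subset r ->
  old_vertices r' \subset old_vertices r.
Proof.
by move=> /fintype.subsetP rr; apply/fintype.subsetP => x; rewrite !inE; exact: rr.
Qed.

Lemma sup_uv (s : {set V}) : s \in K -> [set u; v]%SET \subset s -> s = [set u; v]%SET.
Proof.
move=> sK es; apply/esym/eqP; rewrite eqEcard es cards2 uv.
exact: card_simplex K_dim1 _ sK.
Qed.

Lemma subdivided_complex : simplicial_complex subdivided.
Proof.
split; first by rewrite inE !inE (_ : old_vertices _ = finset.set0) ?(negbTE K_complex.1) ?andbF//;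
  apply/setP => x; rewrite !inE.
move=> r r'; rewrite !inE => /andP[re rK] rr r0; have ss := old_vertices_sub rr.
have e_sub : old_vertices r' = [set u; v]%SET -> False.
  move=> e; rewrite e in ss; move: rK re; case: ifP => _ rK.
    by rewrite finset.eqEsubset rK ss.
  by rewrite (sup_uv rK ss) eqxx.
apply/andP; split; first by apply/eqP.
case: ifP => nr'.
  have nr : None \in r by move/fintype.subsetP: rr; apply.
  by rewrite nr in rK; exact: fintype.subset_trans rK.
have s0 : old_vertices r' != finset.set0.
  have /set0Pn[[x|] xr] := r0; last by rewrite nr' in xr.
  by apply/set0Pn; exists x; rewrite inE.
move: rK; case: ifP => _ rK.
  by apply: (K_complex.2 _ _ uvK) => //; exact: fintype.subset_trans rK.
exact: (K_complex.2 _ _ rK).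
Qed.

Lemma cut_complex_complex : simplicial_complex cut_complex.
Proof.
split; first by rewrite inE (negbTE subdivided_complex.1).
move=> r r' /[!inE] /andP[rL rn] rr r0.
have /= := subdivided_complex.2 r r'; rewrite !inE => -> //=.
by apply: contraNN rn => /andP[n1 n2]; move/fintype.subsetP: rr => rr; rewrite !rr.
Qed.

Lemma sum_option (F : option V -> R) : \sum_w F w = F None + \sum_x F (Some x).
Proof.
rewrite (bigD1 None)//=; congr (_ + _).
rewrite (reindex_omap Some id)//=; last by case.
by apply: eq_bigl => x; rewrite eqxx.
Qed.

Lemma affine_extE (t : {ptws option V -> R}) (x : V) :
  affine_ext placement t x = t (Some x) + t None * new_weight x.
Proof.
rewrite /affine_ext sum_option addrC; congr (_ + _).
rewrite (bigD1 x)//= eqxx mulr1 big1 ?addr0// => y yx.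
by rewrite eq_sym (negbTE yx) mulr0.
Qed.

Lemma new_weight_u : new_weight u = 1 - l.
Proof. by rewrite /new_weight eqxx (negbTE uv) mulr1 mulr0 addr0. Qed.

Lemma new_weight_v : new_weight v = l.
Proof. by rewrite /new_weight eqxx eq_sym (negbTE uv) mulr1 mulr0 add0r. Qed.

Lemma new_weight_other x : x \notin [set u; v]%SET -> new_weight x = 0.
Proof.
by rewrite !inE negb_or /new_weight => /andP[/negbTE -> /negbTE ->]; rewrite !mulr0 addr0.
Qed.

Lemma new_weight_ge0 x : 0 <= new_weight x.
Proof. by rewrite addr_ge0// mulr_ge0// ?subr_ge0 ltW. Qed.

Lemma sum_new_weight : \sum_x new_weight x = 1.
Proof.
rewrite (bigD1 u)//= (bigD1 v) 1?eq_sym//= new_weight_u new_weight_v big1; last first.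
  by move=> x /andP[xu xv]; apply: new_weight_other; rewrite !inE negb_or xu.
by rewrite addr0 subrK.
Qed.

Lemma supportE (T : finType) (t : T -> R) x : (x \in support_of t) = (t x != 0).
Proof. by rewrite inE. Qed.

Section point.
Variable t : {ptws option V -> R}.
Hypothesis tL : polyhedron subdivided t.

Lemma sub_ge0 w : 0 <= t w.
Proof. by have /(polyhedronP subdivided_complex _)[] := tL. Qed.

Lemma sub_support : support_of t \in subdivided.
Proof. by have /(polyhedronP subdivided_complex _)[] := tL. Qed.

Lemma sub_sum : t None + \sum_x t (Some x) = 1.
Proof. by rewrite -sum_option; have /(polyhedronP subdivided_complex _)[] := tL. Qed.

Lemma sub_uv : t (Some u) = 0 \/ t (Some v) = 0.
Proof.
have [|tu] := eqVneq (t (Some u)) 0; first by left.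
have [|tv] := eqVneq (t (Some v)) 0; first by right.
have := sub_support; rewrite inE => /andP[re rK].
have es : [set u; v]%SET \subset old_vertices (support_of t).
  by apply/fintype.subsetP => x; rewrite !inE => /orP[] /eqP ->.
case/eqP: re; move: rK; case: ifP => _ rK; last exact: sup_uv.
by apply/eqP; rewrite finset.eqEsubset rK.
Qed.

Lemma sub_other x : t None != 0 -> x \notin [set u; v]%SET -> t (Some x) = 0.
Proof.
move=> tn; apply: contraNeq => tx; have := sub_support; rewrite inE supportE tn.
by move=> /andP[_ /fintype.subsetP]; apply; rewrite inE supportE.
Qed.

Lemma sub_image : polyhedron K (affine_ext placement t).
Proof.
apply/(polyhedronP K_complex _); have s1 : \sum_x affine_ext placement t x = 1.
  under eq_bigr do rewrite affine_extE.
  by rewrite big_split/= -mulr_sumr sum_new_weight mulr1 addrC sub_sum.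
split=> //; first by move=> x; rewrite affine_extE addr_ge0 ?mulr_ge0 ?sub_ge0 ?new_weight_ge0.
have [tn|tn] := eqVneq (t None) 0.
  have := sub_support; rewrite inE supportE tn eqxx /= => /andP[_].
  suff -> : support_of (affine_ext placement t) = old_vertices (support_of t) by [].
  by apply/setP => x; rewrite !inE affine_extE tn mul0r addr0.
apply: (K_complex.2 _ _ uvK); last exact: support_neq0.
apply/fintype.subsetP => x; rewrite supportE; apply: contraNT => xe.
by rewrite affine_extE sub_other// new_weight_other// mulr0 addr0.
Qed.

(** One of the weights at [u] and [v] vanishes, so the weight of the new vertex can be read off the
    image point. This gives injectivity, and the same formula defines the preimage in
    [sub_preimage]. *)
Lemma sub_None :
  t None = Num.min (affine_ext placement t u / (1 - l)) (affine_ext placement t v / l).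
Proof.
rewrite !affine_extE new_weight_u new_weight_v !mulrDl !mulfK ?gt_eqF ?subr_gt0//.
have hu : 0 <= t (Some u) / (1 - l) by rewrite divr_ge0 ?sub_ge0 ?subr_ge0 ?ltW.
have hv : 0 <= t (Some v) / l by rewrite divr_ge0 ?sub_ge0 ?ltW.
have [->|->] := sub_uv.
  by rewrite mul0r add0r min_l// lerDr.
by rewrite mul0r add0r min_r// lerDr.
Qed.

Lemma cut_image : polyhedron cut_complex t <->
  ~ (0 < affine_ext placement t v < l /\ 0 < affine_ext placement t u).
Proof.
have cutE : polyhedron cut_complex t <-> ~~ ((t None != 0) && (t (Some u) != 0)).
  split=> [/(polyhedronP cut_complex_complex _)[_ _]|h].
    by rewrite inE !supportE => /andP[].
  apply/(polyhedronP cut_complex_complex _).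
  have /(polyhedronP subdivided_complex _)[h1 h2 h3] := tL.
  by split=> //; rewrite inE h3 !supportE.
have [l0' l1'] := (l0, l1); have tn0 := sub_ge0 None; have tu0 := sub_ge0 (Some u).
have tv0 := sub_ge0 (Some v).
have sum_le : t None + t (Some u) + t (Some v) <= 1.
  rewrite -[leRHS]sub_sum -addrA lerD2l (bigD1 u)//= lerD2l (bigD1 v) 1?eq_sym//= lerDl.
  by apply: sumr_ge0 => x _; exact: sub_ge0.
rewrite cutE negb_and !negbK !affine_extE new_weight_u new_weight_v; split.
  have un (z : R) : 0 <= z -> z <> 0 -> 0 < z by move=> z0 /eqP zn; rewrite lt_def zn.
  case/orP => /eqP t0 [/andP[h1 h2] h3].
    have [e|e] := sub_uv.
      by move: h3; rewrite t0 e mul0r addr0 ltxx.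
    by move: h1; rewrite t0 e mul0r addr0 ltxx.
  have tn : t None != 0 by apply: contraTneq h3 => ->; rewrite t0 mul0r addr0 ltxx.
  have tv : t None + t (Some v) = 1.
    rewrite -[RHS]sub_sum; congr (_ + _); rewrite (bigD1 u)//= (bigD1 v) 1?eq_sym//= t0 add0r.
    rewrite big1 ?addr0// => x /andP[xu xv]; apply: sub_other => //.
    by rewrite !inE negb_or xu.
  have : 0 <= (1 - t None) * (1 - l) by rewrite mulr_ge0//; lra.
  by lra.
move=> h; apply: contrapT => /negP; rewrite negb_or => /andP[tn tu]; apply: h.
have tnp : 0 < t None by rewrite lt_def tn.
have tup : 0 < t (Some u) by rewrite lt_def tu.
have tvz : t (Some v) = 0 by have [e|//] := sub_uv; rewrite e eqxx in tu.
rewrite tvz add0r; split.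
  by rewrite mulr_gt0//= gtr_pMl//; lra.
by rewrite addr_gt0// mulr_gt0// subr_gt0.
Qed.

End point.

Lemma sub_preimage (T : {ptws V -> R}) : polyhedron K T ->
  exists2 t : {ptws option V -> R}, polyhedron subdivided t & affine_ext placement t = T.
Proof.
move=> TK; have /(polyhedronP K_complex _)[T0 T1 TsK] := TK.
have [l0' l1'] := (l0, l1); have l1p : 0 < 1 - l by rewrite subr_gt0.
pose d := Num.min (T u / (1 - l)) (T v / l).
pose t : {ptws option V -> R} :=
  fun w => if w is Some x then T x - d * new_weight x else d.
have d0 : 0 <= d by rewrite le_min !divr_ge0// ltW.
have du : d * (1 - l) <= T u by rewrite -ler_pdivlMr// ge_min lexx.
have dv : d * l <= T v by rewrite -ler_pdivlMr// ge_min lexx orbT.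
have tE : affine_ext placement t = T.
  by apply/funext => x; rewrite affine_extE subrK.
have duv : t (Some u) = 0 \/ t (Some v) = 0.
  rewrite /t new_weight_u new_weight_v /d; case: leP => _; [left|right];
    by rewrite divfK ?subrr// gt_eqF.
have dpos : d != 0 -> support_of T = [set u; v]%SET.
  move=> dn; have dp : 0 < d by rewrite lt_def dn.
  apply: sup_uv => //; apply/fintype.subsetP => x; rewrite !inE => /orP[]/eqP ->.
    by rewrite gt_eqF// (lt_le_trans _ du)// mulr_gt0.
  by rewrite gt_eqF// (lt_le_trans _ dv)// mulr_gt0.
exists t => //; apply/(polyhedronP subdivided_complex _); split.
- case=> [x|] //; rewrite /t; have [xe|xe] := boolP (x \in [set u; v]%SET).
    by move: xe; rewrite !inE => /orP[]/eqP ->; rewrite ?new_weight_u ?new_weight_v subr_ge0.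
  by rewrite new_weight_other// mulr0 subr0.
- by rewrite sum_option /= sumrB -mulr_sumr sum_new_weight mulr1 T1 addrC subrK.
rewrite inE; apply/andP; split.
  apply/eqP => /setP E; have := E u; have := E v; rewrite !inE !eqxx orbT.
  by have [->|->] := duv; rewrite eqxx.
rewrite supportE /=; case: ifP => [dn|/negbFE/eqP dz].
  apply/fintype.subsetP => x; rewrite inE supportE /=; apply: contraNT => xe.
  rewrite new_weight_other// mulr0 subr0; move: xe; rewrite -(dpos dn) supportE.
  by rewrite negbK.
suff -> : old_vertices (support_of t) = support_of T by [].
by apply/setP => x; rewrite !inE /= dz mul0r subr0.
Qed.

Lemma subdivided_subdivision : subdivision K subdivided placement.
Proof.
have [l0' l1'] := (l0, l1).
split.
  move=> r; rewrite inE => /andP[re]; case: ifP => nr rK.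
    exists [set u; v]%SET => // -[y|] yr; split.
    - by move=> x; exact: ler0n.
    - by rewrite /= (bigD1 y)//= eqxx big1 ?addr0// => x /negbTE ->.
    - move=> x /=; have [->|] := eqVneq x y; last by rewrite eqxx.
      by move=> _; move/fintype.subsetP: rK; apply; rewrite inE.
    - exact: new_weight_ge0.
    - exact: sum_new_weight.
    - by move=> x; apply: contraNT => /new_weight_other /= ->.
  exists (old_vertices r) => // -[y|] yr; last by rewrite yr in nr.
  split.
  - by move=> x; exact: ler0n.
  - by rewrite /= (bigD1 y)//= eqxx big1 ?addr0// => x /negbTE ->.
  - move=> x /=; have [->|] := eqVneq x y; last by rewrite eqxx.
    by move=> _; rewrite inE.
split.
- by move=> t tL; exact: sub_image.
- move=> t t'; rewrite !inE => tL t'L e; apply/funext.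
  have en : t None = t' None by rewrite !sub_None// e.
  case=> [x|//]; have := congr1 (fun f : {ptws V -> R} => f x) e.
  by rewrite !affine_extE en => /addIr.
- by move=> T /sub_preimage[t tL tE]; exists t.
Qed.

Definition cut_set : set (realization R K) :=
  [set t | ~ (0 < coord v t < l /\ 0 < coord u t)].

Lemma cut_set_subcomplex : subcomplex_after_subdivision cut_set.
Proof.
exists (option V), subdivided, cut_complex, placement; split.
- exact: subdivided_complex.
- exact: subdivided_subdivision.
- exact: cut_complex_complex.
- by apply/fintype.subsetP => r; rewrite inE => /andP[].
have cutL (t : {ptws option V -> R}) : polyhedron cut_complex t -> polyhedron subdivided t.
  by move=> [s sc st]; exists s => //; move: sc; rewrite inE => /andP[].
apply/seteqP; split=> [_ [T cT <-]|_ [t tc <-]].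
  have TK : polyhedron K (\val (T : set_type (@polyhedron R V K))) by exact: (set_valP T).
  have [t tL tE] := sub_preimage TK; exists t => //.
  by apply/(cut_image tL); rewrite tE.
have tL : polyhedron subdivided t := cutL _ tc; exists (mk_real (sub_image tL)) => //.
by apply/(cut_image tL).
Qed.

End edge_subdivision.

(** * Straight-line homotopies of configurations *)

Section straight_line.
Variables (R : realType) (X : topologicalType) (n : nat).
Local Notation I := (unitI R).
(** There are two instances: the covering of the circle with [D] the whole line, and the arc with
    [D] its interval of parameters. Continuity of [k] is asked only along maps into [D], since
    outside [D] the parametrisation of the arc takes a default value. *)
Variables (D : set R) (k : R -> X).
Hypothesis D_convex : forall a b r : R, D a -> D b -> 0 <= r <= 1 -> D ((1 - r) * a + r * b).
Hypothesis k_cont : forall g : I * I -> R, continuous g -> (forall y, D (g y)) ->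
  continuous (fun y => k (g y)).
Hypothesis k_eq : forall a b, D a -> D b -> (k a = k b <-> a - b \is a Num.int).

(* Lifts of distinct points never differ by an integer, so the gap between two
   of them stays in an interval between consecutive integers, which is convex. *)
Lemma conf_straight (x : conf n X) (p : {path I from x to x}) (T : 'I_n -> I -> R) :
  (forall i, continuous (T i)) -> (forall i t, D (T i t)) ->
  (forall i, T i one = T i zero) -> (forall i t, k (T i t) = conf_pt i (p t)) ->
  homotopic p (cst x).
Proof.
move=> cT DT T10 kT.
pose g i (q : I * I) : R := (1 - ival q.1) * T i q.2 + ival q.1 * T i zero.
have Dg i q : D (g i q) by apply: D_convex => //; exact: ival_itv.
have cg i : continuous (g i).
  have c1 : continuous (fun q : I * I => ival q.1).
    apply: fun_comp_continuous (@ival_continuous R).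
    by apply: fun_fst_continuous; exact: fun_id_continuous.
  apply: addr_fun_continuous; apply: mulr_fun_continuous => //.
  - by apply: subr_fun_continuous => //; exact: fun_cst_continuous.
  - apply: fun_comp_continuous (cT i).
    by apply: fun_snd_continuous; exact: fun_id_continuous.
  - exact: fun_cst_continuous.
have gI q : injective (fun i => k (g i q)).
  move=> i j /k_eq; move=> /(_ (Dg i q) (Dg j q)); apply: contraPP => /eqP ij.
  have -> : g i q - g j q = (1 - ival q.1) * (T i q.2 - T j q.2) +
      ival q.1 * (T i zero - T j zero) by rewrite /g; lra.
  apply/negP; apply: (@gap_convex _ (fun t => T i t - T j t)).
  - by apply: subr_fun_continuous; exact: cT.
  - move=> t; apply/negP => /k_eq; move=> /(_ (DT i t) (DT j t)); rewrite !kT.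
    by move/conf_inj => e; rewrite e eqxx in ij.
  - exact: ival_itv.
have [H HE] : {H : I * I -> conf n X | forall q i, conf_pt i (H q) = k (g i q)}.
  by exists (fun q => mk_conf (gI q)).
exists H; split.
- apply: conf_continuous => i; have -> : (fun y => conf_pt i (H y)) = (fun y => k (g i y)).
    by apply/funext.
  exact: k_cont.
- by move=> t; apply: conf_eqP => i; rewrite HE /g ival0 subr0 mul1r mul0r addr0 kT.
- move=> t; apply: conf_eqP => i; rewrite HE /g ival1 subrr mul1r mul0r add0r kT.
  by rewrite path_zero.
- move=> s; split; apply: conf_eqP => i; rewrite HE /g ?T10 -mulrDl subrK mul1r kT;
    by rewrite path_zero.
Qed.

End straight_line.

(** * Configurations on a circle and on an arc *)

Section circle_lifts.
Variables (R : realType) (V : finType) (K : {set {set V}}) (n : nat).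
Hypothesis K_complex : simplicial_complex K.
Hypothesis K_dim1 : dimension K = 1%N.
Local Notation Gamma := (realization R K).
Local Notation I := (unitI R).
Local Notation S := (circle R).
Variables (f : Gamma -> S) (f' : S -> Gamma).
Hypotheses (cf : continuous f) (cf' : continuous f').
Hypotheses (fK : cancel f f') (f'K : cancel f' f).

Lemma circle_strand_kernel (x : conf n Gamma) (a : pi1 R (conf n Gamma) x) :
  kernel (@strand_map R n Gamma x) a -> a = 1%g.
Proof.
move=> a1; rewrite -(homotopy_class_repr a); apply/homotopy_classP.
set p := repr a.
have wE b c : f' (wrap b) = f' (wrap c) <-> b - c \is a Num.int.
  by rewrite -wrap_eqP; split=> [/(can_inj f'K)|->].
have /choice[T TP] i : exists T : I -> R, [/\ continuous T, T one = T zero &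
    forall t, f' (wrap (T t)) = conf_pt i (p t)].
  have np : null_image (@conf_pt n Gamma i) p.
    by apply/null_image_pi1; rewrite homotopy_class_repr; exact: (congr1 (fun h => h i) a1).
  have [th _ thE] := wrap_surj (f (conf_pt i x)).
  pose q (t : I) := f (conf_pt i (p t)).
  have cq : continuous q.
    apply: fun_comp_continuous cf; apply: fun_comp_continuous (@cts_fun _ _ p) _.
    exact: conf_pt_continuous.
  have q0 : q zero = f (conf_pt i x) by rewrite /q path_zero.
  have q1 : q one = f (conf_pt i x) by rewrite /q path_one.
  have [|T [cT T0 T1 wT]] := null_loop_lift (p := mk_path cq q0 q1) thE.
    have [H [cH H0 H1 Hb]] := np; exists (f \o H); split=> [|t|t|s].
    - exact: fun_comp_continuous cH cf.
    - by rewrite /= H0.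
    - by rewrite /= H1.
    - by rewrite /= (Hb s).1 (Hb s).2.
  exists T; split=> // [|t]; first by rewrite T0 T1.
  by rewrite wT /= /mk_path /q fK.
apply: (@conf_straight R Gamma n setT (fun b => f' (wrap b)) _ _ _ x p T) => //.
- move=> g cg _; apply: fun_comp_continuous cf'; exact: fun_comp_continuous cg (@wrap_continuous R).
- by move=> i; have [] := TP i.
- by move=> i; have [] := TP i.
- by move=> i t; have [] := TP i.
Qed.

Section arc.
Variables (u v : V) (l : R).
Hypotheses (uv : u != v) (uvK : [set u; v]%SET \in K) (l0 : 0 < l) (l1 : l < 1).
Local Notation Gamma0 := (@cut_set R V K u v l).

Lemma exists_arc : exists (k : R -> Gamma) (psi : Gamma0 -> R),
  [/\ continuous k, continuous psi,
    (forall a b, 0 < a < 1 -> 0 < b < 1 -> (k a = k b <-> a - b \is a Num.int)),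
    (forall y : Gamma0, k (psi y) = \val y /\ 0 < psi y < 1) &
    (forall a b c, 0 < a < 1 -> 0 < b < 1 -> Gamma0 (k a) -> Gamma0 (k b) ->
       a <= c <= b -> Gamma0 (k c))].
Proof.
have [l0' l1'] := (l0, l1).
(* The midpoint of the removed arc. *)
have [m [sm mu mv]] : exists t : Gamma, [/\ simplex [set u; v]%SET (\val t),
  coord u t = 1 - l / 2 & coord v t = l / 2] by apply: exists_edge_point => //; lra.
have [th0 _ th0E] := wrap_surj (f m).
pose k (a : R) := f' (wrap (a + th0)).
have k_eq a b : k a = k b <-> a - b \is a Num.int.
  have -> : a - b = (a + th0) - (b + th0) by lra.
  by rewrite -wrap_eqP; split=> [/(can_inj f'K)|e]; rewrite // /k e.
have k0 : k 0 = m by rewrite /k add0r th0E fK.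
have k1 : k 1 = m by rewrite -k0; apply/k_eq; rewrite subr0.
have ck : continuous k.
  apply: fun_comp_continuous cf'; apply: (fun_comp_continuous _ (@wrap_continuous R)).
  by apply: addr_fun_continuous; [exact: fun_id_continuous|exact: fun_cst_continuous].
have mcut : ~ Gamma0 m by apply; rewrite /= mu mv; split; [apply/andP; split|]; lra.
have k_surj y : y <> m -> exists2 a, 0 < a < 1 & k a = y.
  move=> ym; have [b _ bE] := wrap_surj (f y).
  pose a := (b - th0) - (Num.floor (b - th0))%:~R.
  have ka : k a = y.
    rewrite -[y]fK -bE /k; congr f'; apply/wrap_eqP.
    have -> : a + th0 - b = - (Num.floor (b - th0))%:~R by rewrite /a; lra.
    by rewrite rpredN intr_int.
  exists a => //; have := Num.Theory.floor_itv (b - th0); rewrite intrD1 => /andP[h1 h2].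
  apply/andP; split; last by rewrite /a; lra.
  rewrite lt_def; apply/andP; split; last by rewrite /a; lra.
  by apply/eqP => a0; apply: ym; rewrite -ka a0 k0.
have lift_m a (q : I -> Gamma) : continuous q -> q zero = k a -> q one = m -> 0 < a < 1 ->
    forall b c, 0 < b -> c < 1 -> b <= a <= c -> exists t, q t = k b \/ q t = k c.
  move=> cq q0 q1 /andP[a0 a1] b c b0 c1 /andP[ba ac].
  have [||T [cT T0 wT]] := @path_lift R (fun t => f (q t)) (a + th0).
  - exact: fun_comp_continuous cq cf.
  - by rewrite q0 f'K.
  have kT t : k (T t - th0) = q t by rewrite /k subrK wT fK.
  have : T one - th0 \is a Num.int.
    by rewrite -[_ - th0]subr0; apply/k_eq; rewrite kT q1 k0.
  move=> /intrP[j jE].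
  have cT' : continuous (fun t => T t - th0).
    by apply: subr_fun_continuous => //; exact: fun_cst_continuous.
  (* The lift ends at an integer, either at most 0, so that it passes [b], or at least 1, so that it
     passes [c]. *)
  have [j0|j0] := leP j 0.
    have : j%:~R <= (0 : R) by rewrite lerz0.
    rewrite -jE => T1.
    have [|t tE _] := @ivt_unitI _ (fun t => T t - th0) one zero b cT'; first by rewrite T0; lra.
    by exists t; left; rewrite -kT tE.
  have : (1 : R) <= j%:~R by rewrite ler1z.
  rewrite -jE => T1.
  have [|t tE _] := @ivt_unitI _ (fun t => T t - th0) zero one c cT'; first by rewrite T0; lra.
  by exists t; right; rewrite -kT tE.
have arc a b c : 0 < a < 1 -> 0 < b < 1 -> Gamma0 (k a) -> Gamma0 (k b) ->
    a <= c <= b -> Gamma0 (k c).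
  move=> /andP[a0 a1] /andP[b0 b1] Ga Gb /andP[ac cb] [/andP[v0 vl] u0].
  have [_ _ others] := two_coords K_dim1 uv (lt0r_neq0 u0) (lt0r_neq0 v0).
  have sc : simplex [set u; v]%SET (\val (k c)).
    apply/simplexP => w; rewrite !inE; case: (eqVneq w u) => // wu; case: (eqVneq w v) => // wv.
    by rewrite others ?eqxx.
  have [q qE] := exists_segment uvK sc sm.
  have qcut t : ~ Gamma0 (q t).
    apply; rewrite /= !qE mu mv; have /andP[t0 t1] := ival_itv t.
    split; last by apply: convex_gt0 => //; lra.
    rewrite convex_gt0//=; last by lra.
    have := @convex_gt0 R t (l - coord v (k c)) (l / 2) _ _; rewrite subr_gt0 vl => /(_ isT).
    have -> : 0 < l / 2 by lra.
    by move=> /(_ isT); lra.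
  have [|||||t [tE|tE]] := lift_m c q _ _ _ _ a b a0 b1.
  - exact: cts_fun.
  - exact: path_zero.
  - exact: path_one.
  - by rewrite (lt_le_trans a0)//= (le_lt_trans cb).
  - by rewrite ac.
  - by apply: (qcut t); rewrite tE.
  - by apply: (qcut t); rewrite tE.
have k_eq' a b : 0 < a < 1 -> 0 < b < 1 -> k a = k b -> a = b.
  move=> /andP[a0 a1] /andP[b0 b1] /k_eq/intrP[j jE].
  have h1 : j%:~R < (1%:~R : R) by rewrite -jE; lra.
  have h2 : (-1)%:~R < (j%:~R : R) by rewrite -jE; lra.
  rewrite !ltr_int in h1 h2; have j0 : j = 0 by lia.
  by apply/eqP; rewrite -subr_eq0 jE j0.
have /choice[psi psiE] (y : Gamma0) : exists a, k a = \val y /\ 0 < a < 1.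
  have [|a a01 aE] := k_surj (\val y); last by exists a.
  by move=> e; apply: mcut; rewrite -e; exact: set_valP.
exists k, psi; split => //.
(* The preimage of a closed set under [psi] is cut out by the image of the compact set [J]. The ends
   0 and 1 of the interval do no harm: [k] maps both to [m], which is not in [Gamma0]. *)
apply/continuous_closedP => D cD.
pose J : set R := `[0, 1]%classic `&` (k @^-1` Gamma0 `&` D).
have cG0 : closed Gamma0 := closed_subcomplex (cut_set_subcomplex K_complex K_dim1 uv uvK l0 l1).
have -> : psi @^-1` D = (fun y : Gamma0 => \val y) @^-1` (k @` J).
  apply/seteqP; split=> y /=.
    move=> Dy; have [ky /andP[y0 y1]] := psiE y; exists (psi y) => //; split => /=.
      by rewrite in_itv /= !ltW.
    by split => //=; rewrite ky; exact: set_valP.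
  move=> [a [/= a01 [Ga Da]] ay]; have [ky y01] := psiE y.
  suff -> : psi y = a by [].
  apply: k_eq' => //; last by rewrite ky ay.
  move: a01; rewrite in_itv /= => /andP[a0 a1]; apply/andP; split.
    by rewrite lt_def a0 andbT; apply/eqP => az; apply: mcut; rewrite -k0 -az.
  by rewrite lt_def a1 andbT; apply/eqP => az; apply: mcut; rewrite -k1 az.
apply: preimage_closed => [y _|]; first exact: val_set_continuous.
apply: compact_closed; first exact: real_hausdorff.
apply: continuous_compact; first by apply: continuous_subspaceT; exact: ck.
apply: compact_closedI; first exact: segment_compact.
by apply: closedI => //; apply: preimage_closed cG0 => ? _; exact: ck.
Qed.

End arc.

End circle_lifts.

Section circle_is_Goldberg.
Variables (R : realType) (V : finType) (K : {set {set V}}) (n : nat).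
Hypothesis K_complex : simplicial_complex K.
Hypothesis K_dim1 : dimension K = 1%N.
Local Notation Gamma := (realization R K).
Local Notation I := (unitI R).

Lemma exists_edge : exists u v : V, u != v /\ [set u; v]%SET \in K.
Proof.
have [s sK s2] : exists2 s, s \in K & (1 < #|s|)%N.
  apply: contrapT => none; have : (dimension K <= 0)%N.
    apply/bigmax_leqP => s sK; rewrite leqn0.
    by case E : #|s| => [|[|j]] //; case: none; exists s; rewrite ?E.
  by rewrite K_dim1.
have /cards2P[u [v [uv sE]]] : #|s| == 2.
  by rewrite eqn_leq s2 (card_simplex K_dim1).
by exists u, v; rewrite -sE.
Qed.

Lemma exists_gap (v : V) (x : conf n Gamma) : exists l : R,
  [/\ 0 < l, l < 1 & forall i, 0 < coord v (conf_pt i x) -> l <= coord v (conf_pt i x)].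
Proof.
pose c i := coord v (conf_pt i x).
have c1 i : 0 <= c i <= 1 by rewrite coord_ge0 (coord_le1 v).
(* A product of numbers in (0, 1] is at most each of its factors. Halving it makes it less than 1
   even when the product is 1. *)
pose P := \prod_(i < n | 0 < c i) c i.
have P0 : 0 < P by apply: prodr_gt0.
have P1 : P <= 1 by apply: prodr_ile1 => i; rewrite c1.
exists (P / 2); split; [lra|lra|move=> i ci].
have : P <= c i.
  rewrite /P (bigD1 i)//= ler_piMr ?(andP (c1 i)).1//.
  by apply: prodr_ile1 => j; rewrite c1.
by rewrite /c; lra.
Qed.

Lemma circle_Goldberg (x : conf n Gamma) : homeomorphic Gamma (circle R) -> Goldberg x.
Proof.
move=> [f [f' [cf cf' fK f'K]]].
have [u [v [uv uvK]]] := exists_edge; have [l [l0 l1 lx]] := exists_gap v x.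
have [k [psi [ck cpsi k_eq kpsi arc]]] := exists_arc K_complex K_dim1 cf cf' fK f'K uv uvK l0 l1.
pose Gamma0 : set Gamma := cut_set u v l.
have x0 i : Gamma0 (conf_pt i x).
  by move=> [/andP[h1 h2] _]; have := lx i h1; rewrite leNgt h2.
pose yf i : Gamma0 := exist _ (conf_pt i x) (mem_set (x0 i)).
have yI : injective yf by move=> i j /(congr1 val) /= /conf_inj.
pose y : conf n Gamma0 := mk_conf yI.
have yx : conf_incl y = x by apply: conf_eqP.
have uK := vertex_of_simplex K_complex uvK (set21 u v).
have u0 : Gamma0 (vtx R uK) by move=> [/andP[+ _] _]; rewrite coord_vtx eq_sym (negbTE uv) ltxx.
pose z0 : Gamma0 := exist _ (vtx R uK) (mem_set u0).
pose D : set R := [set a | 0 < a < 1 /\ Gamma0 (k a)].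
have Dpsi z : D (psi z) by have [kz z01] := kpsi z; split=> //; rewrite kz; exact: set_valP.
have Dconv a b r : D a -> D b -> 0 <= r <= 1 -> D ((1 - r) * a + r * b).
  move=> [a01 Ga] [b01 Gb] r01.
  have [a0 a1] := andP a01; have [b0 b1] := andP b01.
  have [ab|ba] := leP a b.
    have h := convex_itv r01 ab; split; last exact: (arc a b).
    by have /andP[h1 h2] := h; rewrite (lt_le_trans a0)// (le_lt_trans h2).
  have h : b <= (1 - r) * a + r * b <= a.
    have r01' : 0 <= 1 - r <= 1 by lra.
    by have := convex_itv r01' (ltW ba); rewrite subKr [r * b + _]addrC.
  split; last exact: (arc b a).
  by have /andP[h1 h2] := h; rewrite (lt_le_trans b0)// (le_lt_trans h2).
(* [z0] is a default for parameters whose image leaves [Gamma0]; it also serves as the centre of the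
   contraction. *)
pose k0 (a : R) : Gamma0 := if pselect (Gamma0 (k a)) is left h
  then exist _ (k a) (mem_set h) else z0.
have k0E a : D a -> \val (k0 a) = k a.
  by move=> [_ Ga]; rewrite /k0; case: pselect.
have k0psi z : k0 (psi z) = z by apply: val_inj; rewrite k0E// (kpsi z).1.
have k0_cont (Y : topologicalType) (g : Y -> R) : continuous g -> (forall q, D (g q)) ->
    continuous (fun q => k0 (g q)).
  move=> cg Dg; apply: subset_continuous.
  have -> : (fun q => \val (k0 (g q))) = (fun q => k (g q)) by apply/funext => q; rewrite k0E.
  exact: fun_comp_continuous cg ck.
have contr : contractible R Gamma0.
  exists z0, (fun q : Gamma0 * I => k0 ((1 - ival q.2) * psi q.1 + ival q.2 * psi z0)).
  split=> [|z|z].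
  - apply: k0_cont => [|q]; last by apply: Dconv => //; exact: ival_itv.
    have c2 : continuous (fun q : Gamma0 * I => ival q.2).
      apply: fun_comp_continuous (@ival_continuous R).
      by apply: fun_snd_continuous; exact: fun_id_continuous.
    apply: addr_fun_continuous; apply: mulr_fun_continuous => //.
    + by apply: subr_fun_continuous => //; exact: fun_cst_continuous.
    + apply: fun_comp_continuous cpsi.
      by apply: fun_fst_continuous; exact: fun_id_continuous.
    + exact: fun_cst_continuous.
  - by rewrite ival0 subr0 mul1r mul0r addr0.
  - by rewrite ival1 subrr mul1r mul0r add0r.
(* On the arc [psi] provides closed lifts of every strand at once, so the straight-line homotopy
   applies to all loops. *)
have triv (a : pi1 R (conf n Gamma0) y) : a = 1%g.
  rewrite -(homotopy_class_repr a); apply/homotopy_classP; set p := repr a.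
  apply: (@conf_straight R Gamma0 n D k0 Dconv (k0_cont _) _ y p
    (fun i t => psi (conf_pt i (p t)))) => //.
  - move=> b c [b01 Gb] [c01 Gc]; rewrite -(k_eq b c b01 c01).
    by split=> [/(congr1 val)|e]; [rewrite !k0E|apply: val_inj; rewrite !k0E].
  - move=> i; apply: fun_comp_continuous cpsi.
    apply: fun_comp_continuous (@cts_fun _ _ p) _; exact: conf_pt_continuous.
  - by move=> i; rewrite path_zero path_one.
have cl1 (a : pi1 R (conf n Gamma) x) : range (@incl_map R n Gamma Gamma0 y x yx) a -> a = 1%g.
  by move=> [b _ <-]; rewrite (triv b); exact: pi1_map1.
exists Gamma0, y, yx; split.
- exact: (cut_set_subcomplex K_complex K_dim1 uv uvK l0 l1).
- exact: contr.
- apply/seteqP; split=> a.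
    move=> /(circle_strand_kernel cf cf' fK f'K) -> N [[N1 _ _ _] _].
    exact: N1.
  move=> /(_ [set 1%g]) h; have -> : a = 1%g.
    apply: h; split; last exact: cl1.
    by split=> //= [b c -> ->|b ->|b c ->]; rewrite ?mulg1 ?invg1 ?conj1g.
  exact: (@strand_map1 R n Gamma x).
- by move=> a b _; rewrite (triv a) (triv b).
Qed.

End circle_is_Goldberg.

(** * Trees are Goldberg *)

Section contiguous.
Variables (R : realType) (V : finType) (K : {set {set V}}).
Local Notation Gamma := (realization R K).
Local Notation I := (unitI R).

(** The vertex maps are contiguous: the two images of a point of [s] lie in the common simplex [s'],
    and so does the segment between them. *)
Lemma contiguous_homotopy (phi psi : V -> V) :
  (forall s, s \in K -> exists2 s', s' \in K & phi @: s :|: psi @: s \subset s')%SET ->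
  exists H : Gamma * I -> Gamma, continuous H /\
    forall t r w, coord w (H (t, r)) =
      \sum_v coord v t * ((1 - ival r) * (phi v == w)%:R + ival r * (psi v == w)%:R).
Proof.
move=> cont.
pose h (q : Gamma * I) (w : V) : R := \sum_v coord v q.1 *
  ((1 - ival q.2) * (phi v == w)%:R + ival q.2 * (psi v == w)%:R).
have hK q : polyhedron K (h q : {ptws V -> R}).
  have [s sK [t0 t1 ts]] := realP q.1; have [s' s'K ss'] := cont _ sK.
  have /andP[r0 r1] := ival_itv q.2.
  exists s' => //; split.
  - move=> w; apply: sumr_ge0 => v _; rewrite mulr_ge0 ?coord_ge0// addr_ge0// mulr_ge0//.
    by rewrite subr_ge0.
  - rewrite exchange_big/= -[RHS](sum_coord q.1); apply: eq_bigr => v _.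
    rewrite -mulr_sumr big_split/= -!mulr_sumr.
    have one_at (x : V) : \sum_w (x == w)%:R = 1 :> R.
      by rewrite (bigD1 x)//= eqxx big1 ?addr0// => w /negbTE; rewrite eq_sym => ->.
    by rewrite !one_at !mulr1 subrK mulr1.
  - move=> w; apply: contraNT => ws; apply/eqP/big1 => v _.
    have [->|tv] := eqVneq (coord v q.1) 0; first by rewrite mul0r.
    have vs : v \in s by exact: ts.
    have out (z : V -> V) : z v \in s' -> (z v == w) = false.
      by move=> zs; apply/negbTE; apply: contraNneq ws => <-.
    rewrite !out ?mulr0 ?addr0 ?mulr0//.
    + by move/fintype.subsetP: ss'; apply; rewrite inE imset_f ?orbT.
    + by move/fintype.subsetP: ss'; apply; rewrite inE imset_f.
exists (fun q => mk_real (hK q)); split=> //.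
apply: real_continuous => w; apply: (@sum_fun_continuous R (Gamma * I)%type V) => v.
apply: mulr_fun_continuous.
  apply: fun_comp_continuous (@coord_continuous R V K v).
  by apply: fun_fst_continuous; exact: fun_id_continuous.
have c2 : continuous (fun q : Gamma * I => ival q.2).
  apply: fun_comp_continuous (@ival_continuous R).
  by apply: fun_snd_continuous; exact: fun_id_continuous.
apply: addr_fun_continuous; apply: mulr_fun_continuous => //;
  try exact: fun_cst_continuous.
by apply: subr_fun_continuous => //; exact: fun_cst_continuous.
Qed.

End contiguous.

Lemma homotopy_concat (R : realType) (X Y : topologicalType) (H1 H2 : X * unitI R -> Y) :
  continuous H1 -> continuous H2 -> (forall x, H1 (x, one) = H2 (x, zero)) ->
  exists H : X * unitI R -> Y, [/\ continuous H, forall x, H (x, zero) = H1 (x, zero) &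
    forall x, H (x, one) = H2 (x, one)].
Proof.
move=> c1 c2 H12; pose sw (H : X * unitI R -> Y) (y : X * unitI R) s := H (y.1, s).
exists (fun q => concat_fun (sw H1 q) (sw H2 q) q.2); split=> [|x|x].
- have csw (L : X * unitI R -> Y) : continuous L -> continuous (fun yt => sw L yt.1 yt.2).
    move=> cL; apply: fun_comp_continuous cL; apply: fun_pair_continuous.
      apply: fun_fst_continuous; apply: fun_fst_continuous; exact: fun_id_continuous.
    by apply: fun_snd_continuous; exact: fun_id_continuous.
  apply: (@concat_fun_continuous R Y (X * unitI R)%type (fun q => ival q.2) (sw H1) (sw H2)).
  + apply: fun_comp_continuous (@ival_continuous R).
    by apply: fun_snd_continuous; exact: fun_id_continuous.
  + exact: csw.
  + exact: csw.
  + by move=> q; exact: H12.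
- by rewrite /concat_fun /sw ival0 invr_ge0 ler0n mulr0 clamp_le0.
- rewrite /concat_fun /sw ival1 mulr1 ifF; last by apply/negbTE; rewrite -ltNge; lra.
  by rewrite clamp_ge1//; lra.
Qed.

Section tree.
Variables (V : finType) (K : {set {set V}}).
Hypothesis K_complex : simplicial_complex K.
Hypothesis K_connected : connected_graph K.
Hypothesis K_acyclic : forall c : seq V, ucycle (edge K) c -> (size c <= 2)%N.
Variables (r : V) (rK : [set r]%SET \in K).

Definition reaches (v : V) (m : nat) : bool :=
  `[< exists p, [/\ size p = m, path (edge K) v p & last v p = r] >].

Lemma edge_sym : symmetric (edge K).
Proof. by move=> u v; rewrite /edge eq_sym finset.setUC. Qed.

Lemma edge_vertex u v : edge K u v -> [set u]%SET \in K.
Proof.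
by move=> /andP[_ uvK]; apply: (vertex_of_simplex K_complex uvK); exact: set21.
Qed.

Lemma exists_dist : exists dist : V -> nat, forall v, [set v]%SET \in K ->
  reaches v (dist v) /\ forall m, reaches v m -> (dist v <= m)%N.
Proof.
suff /choice[d dE] v : exists d, [set v]%SET \in K ->
  reaches v d /\ forall m, reaches v m -> (d <= m)%N by exists d.
have [vK|_] := boolP ([set v]%SET \in K); last by exists 0%N.
have : exists m, reaches v m.
  have /connectP[p pp pr] := K_connected vK rK.
  by exists (size p); apply/asboolP; exists p.
by move=> ex; have [m mP mmin] := ex_minnP ex; exists m.
Qed.

Lemma exists_parent : exists (dist : V -> nat) (par : V -> V), 
  [/\ dist r = 0%N,
   forall v, [set v]%SET \in K -> v != r -> edge K v (par v) /\ dist v = (dist (par v)).+1 &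
   forall v, [set v]%SET \in K -> dist v = 0%N -> v = r].
Proof.
have [dist dP] := exists_dist; exists dist.
have step v : [set v]%SET \in K -> v != r ->
    exists w, edge K v w /\ dist v = (dist w).+1.
  move=> vK vr; have [/asboolP[p [pd pp pr]] dmin] := dP _ vK.
  case: p pd pp pr => [|w p] /= pd pp pr; first by rewrite pr eqxx in vr.
  have /andP[vw wp] := pp; exists w; split=> //.
  have wK : [set w]%SET \in K by apply: (@edge_vertex w v); rewrite edge_sym.
  have [/asboolP[p' [p'd p'p p'r]] wmin] := dP _ wK.
  apply/eqP; rewrite eqn_leq; apply/andP; split.
    by apply: dmin; apply/asboolP; exists (w :: p') => /=; rewrite p'd vw.
  by rewrite -pd ltnS; apply: wmin; apply/asboolP; exists p.
have /choice[par parE] v : exists w, [set v]%SET \in K -> v != r ->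
    edge K v w /\ dist v = (dist w).+1.
  have [vK|_] := boolP ([set v]%SET \in K); last by exists v.
  have [vr|vr] := boolP (v != r); last by exists v.
  by have [w wE] := step _ vK vr; exists w.
exists par; split=> // [|v vK v0].
  by apply/eqP; rewrite -leqn0; apply: (dP _ rK).2; apply/asboolP; exists [::].
by have [/asboolP[p [pd _ pr]] _] := dP _ vK; move: pd; rewrite v0; case: p pr.
Qed.

Variables (dist : V -> nat) (par : V -> V).
Hypothesis dist_root : dist r = 0%N.
Hypothesis par_edge : forall v, [set v]%SET \in K -> v != r ->
  edge K v (par v) /\ dist v = (dist (par v)).+1.
Hypothesis dist0 : forall v, [set v]%SET \in K -> dist v = 0%N -> v = r.

(** Otherwise [u] and [v] could both be joined to the root through parents without using the edge
    [uv], and this edge would close up a circuit. *)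
Lemma edge_par u v : edge K u v -> v = par u /\ u != r \/ u = par v /\ v != r.
Proof.
move=> uv; apply: contrapT => /not_orP[npu npv].
pose e' : rel V := fun x y => edge K x y && ([set x; y]%SET != [set u; v]%SET).
have e'_sym : symmetric e' by move=> x y; rewrite /e' edge_sym finset.setUC.
have /andP[uv' _] := uv.
have uK := edge_vertex uv.
have vK : [set v]%SET \in K by apply: (@edge_vertex v u); rewrite edge_sym.
have to_root m x : (dist x <= m)%N -> [set x]%SET \in K -> connect e' x r.
  elim: m x => [|m IH] x.
    by rewrite leqn0 => /eqP x0 xK; rewrite (dist0 xK x0) connect0.
  move=> xm xK; have [->|xr] := eqVneq x r; first exact: connect0.
  have [xp xd] := par_edge xK xr; rewrite xd ltnS in xm.
  apply: connect_trans (IH _ xm _); last by apply: (@edge_vertex _ x); rewrite edge_sym.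
  apply: connect1; rewrite /e' xp /=; apply/eqP => E.
  have /andP[xp' _] := xp.
  have : x \in [set u; v]%SET by rewrite -E !inE eqxx.
  have : par x \in [set u; v]%SET by rewrite -E !inE eqxx orbT.
  rewrite !inE => /orP[]/eqP pE /orP[]/eqP xE.
  - by move: xp'; rewrite pE xE eqxx.
  - by apply: npv; rewrite -xE pE.
  - by apply: npu; rewrite -xE pE.
  - by move: xp'; rewrite pE xE eqxx.
have : connect e' u v.
  apply: connect_trans (to_root _ _ (leqnn _) uK) _.
  by rewrite (sym_connect_sym e'_sym); exact: to_root (leqnn _) vK.
move=> /connectP[p0 /shortenP[p pp pU _] pv].
(* This circuit has at most two vertices by acyclicity, but a path from [u] to [v] that avoids the
   edge [uv] has at least three. *)
have cyc : ucycle (edge K) (u :: p).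
  apply/andP; split=> //; rewrite /= rcons_path -pv edge_sym uv andbT.
  by apply: sub_path pp => x y /andP[].
have cs := K_acyclic cyc; move: cs pp pv; clear cyc pU; case: p => [|x [|]] //=.
  by move=> _ _ vu; rewrite vu eqxx in uv'.
by move=> _ /andP[/andP[_ ux] _] vx; rewrite vx eqxx in ux.
Qed.

(** The ancestor at distance [m] from the root; by truncated subtraction, vertices nearer to the
    root stay in place. *)
Definition anc (m : nat) (v : V) : V := iter (dist v - m) par v.

Lemma anc_par m v : (m <= dist (par v))%N -> dist v = (dist (par v)).+1 ->
  anc m v = anc m (par v).
Proof. by move=> mv vd; rewrite /anc vd subSn// iterSr. Qed.

Lemma anc_id m v : (dist v <= m)%N -> anc m v = v.
Proof. by rewrite /anc -subn_eq0 => /eqP ->. Qed.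

Lemma anc_dist m v : [set v]%SET \in K -> (m <= dist v)%N ->
  dist (anc m v) = m /\ [set anc m v]%SET \in K.
Proof.
move E : (dist v - m)%N => j; elim: j v E => [|j IH] v E vK mv.
  have -> : m = dist v by apply/eqP; rewrite eqn_leq mv -subn_eq0 E.
  by rewrite anc_id.
have vr : v != r by apply: contraTneq mv => vr; move: E; rewrite vr dist_root sub0n.
have [vp vd] := par_edge vK vr.
have mp : (m <= dist (par v))%N by rewrite -ltnS -vd -subn_gt0 E.
rewrite anc_par//; apply: IH => //; first by move: E; rewrite vd subSn// => -[].
by apply: (@edge_vertex _ v); rewrite edge_sym.
Qed.

Lemma anc0 v : [set v]%SET \in K -> anc 0 v = r.
Proof. by move=> vK; have [d0 dK] := anc_dist vK (leq0n _); exact: dist0. Qed.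

Lemma ancS m v : (m < dist v)%N -> anc m v = par (anc m.+1 v).
Proof. by move=> mv; rewrite /anc -iterS -subSn// subSS. Qed.

Lemma anc_simplex m v : [set v]%SET \in K -> [set anc m.+1 v; anc m v]%SET \in K.
Proof.
move=> vK; have [vm|mv] := leqP (dist v) m.
  by rewrite !anc_id// ?finset.setUid// leqW.
have [dm mK] := anc_dist vK mv; rewrite (ancS mv).
have nr : anc m.+1 v != r by apply: contra_eq_neq dm => ->; rewrite dist_root.
by have [/andP[]] := par_edge mK nr.
Qed.

(** The tree is folded one level at a time. If the parent end of an edge lies above level [m], in
    distance from the root, both ends have the same ancestors at levels [m] and [m.+1]. Otherwise
    the parent end stays fixed and the child end moves within the edge at most. *)
Lemma anc_contiguous m (s : {set V}) : s \in K -> (#|s| <= 2)%N ->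
  exists2 s', s' \in K & (anc m.+1 @: s :|: anc m @: s \subset s')%SET.
Proof.
move=> sK s2; have [s1|s1] := leqP #|s| 1.
  have /cards1P[v sE] : #|s| == 1%N.
    by rewrite eqn_leq s1 card_gt0; apply: contraTneq sK => ->; exact: K_complex.1.
  exists [set anc m.+1 v; anc m v]%SET; last by rewrite sE !imset_set1.
  by apply: anc_simplex; rewrite -sE.
have /cards2P[u [v [uv sE]]] : #|s| == 2 by rewrite eqn_leq s2.
have euv : edge K u v by rewrite /edge uv -sE.
wlog [vE ur] : u v uv sE euv / v = par u /\ u != r.
  move=> wl; have [|[uE vr]] := edge_par euv; first exact: wl.
  apply: (wl v u) => //; first by rewrite eq_sym.
    by rewrite sE finset.setUC.
  by rewrite edge_sym.
have uK := edge_vertex euv.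
have vK : [set v]%SET \in K by apply: (@edge_vertex v u); rewrite edge_sym.
have [_ ud] := par_edge uK ur; rewrite -vE in ud.
have anc_uv j : (j <= dist v)%N -> anc j u = anc j v.
  by move=> jv; rewrite (anc_par (v := u)) -?vE.
have [mv|vm] := ltnP m (dist v).
  exists [set anc m.+1 v; anc m v]%SET; first exact: anc_simplex.
  rewrite sE !imsetU1 !imset_set1 !anc_uv//; last exact: ltnW.
  by rewrite !finset.setUid.
exists s => //; rewrite sE !imsetU1 !imset_set1.
have hv : anc m v = v by rewrite anc_id.
have hv' : anc m.+1 v = v by rewrite anc_id// leqW.
have hu' : anc m.+1 u = u by rewrite anc_id// ud ltnS.
have hu : anc m u \in [set u; v]%SET.
  move: vm; rewrite leq_eqVlt => /predU1P[e|vm].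
    by rewrite anc_uv -?e// e hv !inE eqxx orbT.
  by rewrite anc_id ?ud// !inE eqxx.
rewrite hv hv' hu'; apply/fintype.subsetP => x; rewrite !inE.
by case/orP => [//|/orP[/eqP ->|->]]; [rewrite !inE in hu|rewrite orbT].
Qed.

End tree.

Section tree_contractible.
Variables (R : realType) (V : finType) (K : {set {set V}}).
Hypothesis K_complex : simplicial_complex K.
Hypothesis K_dim1 : dimension K = 1%N.
Local Notation Gamma := (realization R K).
Local Notation I := (unitI R).

Lemma tree_contractible : tree K -> contractible R Gamma.
Proof.
move=> [K_connected K_acyclic].
have [u0 [v0 [uv uvK]]] := exists_edge K_dim1.
have e0 : edge K u0 v0 by rewrite /edge uv.
have rK := edge_vertex K_complex e0; set r := u0 in rK.
have [dist [par [d0 dP dr]]] := exists_parent K_complex K_connected rK.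
pose an m := anc dist par m.
have cont m := contiguous_homotopy R (fun s sK =>
  anc_contiguous K_complex K_acyclic d0 dP dr m sK (card_simplex K_dim1 sK)).
(* The foldings from level [m] down to the root are concatenated. At the largest distance [an] is
   the identity, which gives the contraction. *)
have ladder m : exists H : Gamma * I -> Gamma, [/\ continuous H,
    forall t w, coord w (H (t, zero)) = \sum_v coord v t * (an m v == w)%:R &
    forall t, H (t, one) = vtx R rK].
  elim: m => [|m [H2 [c2 H20 H21]]].
    exists (fun=> vtx R rK); split=> //; first exact: cst_continuous.
    move=> t w; rewrite coord_vtx -[LHS]mul1r -(sum_coord t) mulr_suml.
    apply: eq_bigr => v _; have [->|tv] := eqVneq (coord v t) 0; first by rewrite !mul0r.
    rewrite /an (anc0 K_complex d0 dP dr) ?[r == w]eq_sym//.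
    have [s sK [_ _ ts]] := realP t.
    by apply: (vertex_of_simplex K_complex sK); exact: ts.
  have [H1 [c1 H1E]] := cont m.
  have [|H [cH H0 H1']] := homotopy_concat c1 c2.
    move=> t; apply: coordP => w; rewrite H1E H20; apply: eq_bigr => v _.
    by rewrite ival1 subrr mul0r add0r mul1r.
  exists H; split=> // [t w|t]; last by rewrite H1' H21.
  rewrite H0 H1E; apply: eq_bigr => v _.
  by rewrite ival0 subr0 mul1r mul0r addr0.
have an_id v : an (\max_w dist w) v = v by apply: anc_id; exact: leq_bigmax.
have [H [cH H0 H1]] := ladder (\max_w dist w).
exists (vtx R rK), H; split=> // t; apply: coordP => w; rewrite H0.
rewrite (bigD1 w)//= an_id eqxx mulr1 big1 ?addr0// => v /negbTE vw.
by rewrite an_id vw mulr0.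
Qed.

Lemma whole_subcomplex : subcomplex_after_subdivision [set: Gamma].
Proof.
pose p (w : V) : {ptws V -> R} := fun x => (x == w)%:R.
have pE (t : {ptws V -> R}) : affine_ext p t = t.
  apply/funext => x; rewrite /affine_ext (bigD1 x)//= /p eqxx mulr1 big1 ?addr0// => y yx.
  by rewrite eq_sym (negbTE yx) mulr0.
exists V, K, K, p; split=> //.
  split.
    move=> s sK; exists s => // w ws; split.
    - by move=> x; exact: ler0n.
    - by rewrite /p (bigD1 w)//= eqxx big1 ?addr0// => x /negbTE ->.
    - by move=> x; rewrite /p; have [->|] := eqVneq x w; rewrite ?eqxx.
  split.
  - by move=> t; rewrite pE.
  - by move=> t t' _ _; rewrite !pE.
  - by move=> t tK; exists t => //; rewrite pE.
apply/seteqP; split=> [_ [t _ <-]|t [t' t'K <-]].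
  by exists (\val (t : set_type (@polyhedron R V K))); [exact: (set_valP t)|rewrite pE].
by exists (exist _ t' (mem_set t'K)) => //; rewrite pE.
Qed.

Lemma tree_Goldberg (n : nat) (x : conf n Gamma) : tree K -> Goldberg x.
Proof.
move=> Ktree; have cG := tree_contractible Ktree.
pose A : set Gamma := setT.
(* [Gamma] and its subspace on [setT] are different types; [inj] and [lift] invert the inclusions of
   points and of configurations. *)
pose inj (t : Gamma) : A := exist _ t (mem_set (Logic.I : A t)).
have c_inj : continuous inj by apply: subset_continuous; exact: fun_id_continuous.
have injK (t : A) : inj (\val t) = t by exact: val_inj.
have injI : injective inj by move=> t t' /(congr1 val).
pose lift (y : conf n Gamma) : conf n A := mk_conf (inj_comp injI (@conf_inj n Gamma y)).
have c_lift : continuous lift.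
  apply: conf_continuous => i; apply: (fun_comp_continuous _ c_inj).
  exact: conf_pt_continuous.
have liftK (y : conf n A) : lift (conf_incl y) = y.
  by apply: conf_eqP => i; rewrite conf_pt_mk /=; exact: injK.
have inclK (y : conf n Gamma) : conf_incl (lift y) = y by exact: conf_eqP.
exists A, (lift x), (inclK x); split.
- exact: whole_subcomplex.
- have [t0 [H [cH H0 H1]]] := cG.
  exists (inj t0), (fun q : A * I => inj (H (\val q.1, q.2))); split=> [|t|t].
  + apply: (fun_comp_continuous _ c_inj); apply: fun_comp_continuous cH.
    apply: fun_pair_continuous; last by apply: fun_snd_continuous; exact: fun_id_continuous.
    apply: fun_comp_continuous (@val_set_continuous _ A).
    by apply: fun_fst_continuous; exact: fun_id_continuous.
  + by rewrite H0 injK.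
  + by rewrite H1.
- apply/seteqP; split=> a _.
    move=> N [_]; apply; pose p := repr a.
    have c : continuous (lift \o p) by exact: fun_comp_continuous (@cts_fun _ _ p) c_lift.
    have e0 : (lift \o p) zero = lift x by rewrite /= path_zero.
    have e1 : (lift \o p) one = lift x by rewrite /= path_one.
    exists (homotopy_class (mk_path c e0 e1)) => //.
    rewrite /incl_map pi1_mapE -[RHS]homotopy_class_repr; congr homotopy_class.
    by apply/path_eqP => t; exact: inclK.
  by apply/prod_groupP => i; exact: contractible_pi1.
- move=> a b; rewrite -(homotopy_class_repr a) -(homotopy_class_repr b) /incl_map !pi1_mapE.
  move=> /homotopy_classP[H [cH H0 H1 Hb]]; apply/homotopy_classP.
  exists (lift \o H); split=> [|t|t|s].
  + exact: fun_comp_continuous cH c_lift.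
  + by rewrite /= H0; exact: liftK.
  + by rewrite /= H1; exact: liftK.
  + by rewrite /= (Hb s).1 (Hb s).2.
Qed.

End tree_contractible.

(** If the graph is not a tree it has a circuit; every edge at a vertex of the circuit belongs to
    it, so by connectedness the circuit is the whole graph. *)
Lemma weakly_Goldberg_tree_or_circle (R : realType) (V : finType) (K : {set {set V}}) (n : nat)
    (K_complex : simplicial_complex K) (K_dim1 : dimension K = 1%N)
    (K_connected : connected_graph K) (n_ge2 : (2 <= n)%N) (x : conf n (realization R K)) :
  weakly_Goldberg x -> tree K \/ homeomorphic (realization R K) (circle R).
Proof.
move=> wG; apply: contrapT => /not_orP[ntree ncircle].
apply: ntree; split=> // c c_cycle; rewrite leqNgt; apply/negP => c_size; apply: ncircle.
have cyc := weakly_Goldberg_cyc_edge K_complex K_dim1 K_connected n_ge2 c_cycle c_size wG.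
have [v0 _] : exists v0, v0 \in c by case: (c) c_size => // v0 s _; exists v0; rewrite mem_head.
exact: (circuit_homeomorphic_circle R K_complex K_dim1 K_connected c_cycle c_size cyc v0).
Qed.

Theorem theorem1p21 (R : realType) (V : finType) (K : {set {set V}}) (n : nat)
    (K_complex : simplicial_complex K) (K_dim1 : dimension K = 1%N)
    (K_connected : connected_graph K) (n_ge2 : (2 <= n)%N)
    (x : conf n (realization R K)) :
  (weakly_Goldberg x <-> Goldberg x) /\
  (Goldberg x <-> tree K \/ homeomorphic (realization R K) (circle R)).
Proof.
have weak : Goldberg x -> weakly_Goldberg x.
  by move=> [Gamma0 [y [yx [sub0 con0 ker0 _]]]]; exists Gamma0, y, yx.
have wtc := weakly_Goldberg_tree_or_circle K_complex K_dim1 K_connected n_ge2 (x := x).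
have tcG : tree K \/ homeomorphic (realization R K) (circle R) -> Goldberg x.
  by case; [exact: tree_Goldberg|exact: circle_Goldberg].
split; split=> //.
- by move=> /wtc/tcG.
- by move=> /weak/wtc.
Qed.
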